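(* Let $Q:\mathbb{R}\to\mathbb{R}$ satisfy: (i) $Q\in C^4(\mathbb{R})$; (ii) $Q$ is convex on $\mathbb{R}$; (iii) $\liminf_{x\to\pm\infty}Q(x)>\inf_{\mathbb{R}}Q$ (at both $+\infty$ and $-\infty$); (iv) $\min_{\mathbb{R}}Q=Q(0)=0$; (v) $P^{-1}(y)\ge -P^{-1}(-y)$ for all $y>0$ (i.e. $P^{-1}(n/\beta)\ge -P^{-1}(-n/\beta)$ for all $n\ge 1$, $\beta>0$). Let $[q_1,q_2]:=\{x\in\mathbb{R}: Q(x)=0\}$. Then for all $\Gamma>0$ there exist constants $C,C'>0$ such that for all $n\in\mathbb{N}$ with $n>\max\{q_2,1\}$ and all $\beta$ with $\frac{n}{P(n)}\le\beta\le\Gamma n$, setting $$\alpha:=P^{-1}\Big(\frac n\beta\Big),\qquad B_n^\beta:=C'\,\frac{n^2}{\alpha}\min\Big\{\frac{\alpha}{n}\log\Big(\frac{n}{\alpha}\Big(1+\frac{\beta\alpha^3}{n}\|Q''\|_{L^\infty(\operatorname{supp}\overline\mu)}\Big)\Big),\,1\Big\},$$ there holds $\operatorname{supp}\overline\mu\subset[-C\alpha,C\alpha]$, $$-\sqrt{\frac{n^2}{\alpha}B_n^\beta}\;\le\;F_n^D-F_n^C\;\le\;0,$$ and $$-B_n^\beta\;\le\;I_n^D(\overline{\mathbf a})-I_n^C(\overline\mu)\;\le\;B_n^\beta.$$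
   Context: The interaction potential is $K(x):=-\log|\tanh x|$. The function $P(x):=\int_0^xQ(y)\,dy$ is a primitive of $Q$. The set $[q_1,q_2]$ of minimizers of $Q$ is a compact interval containing $0$ (possibly $\{0\}$, in which case $q_1=q_2=0$), and $P^{-1}:\mathbb{R}\setminus\{0\}\to\mathbb{R}$ denotes the inverse of $P|_{\mathbb{R}\setminus[q_1,q_2]}$. For $n\ge2$, $\beta>0$ and $\mathbf a=(a_1,\dots,a_n)\in\mathbb{R}^n$ with $a_1<\dots<a_n$, the discrete energy is $$I_n^D(\mathbf a):=\frac{n}{n-1}\sum_{i=1}^n\sum_{j\ne i}K(a_i-a_j)+2\beta\sum_{i=1}^nQ(a_i).$$ Let $\mathcal P(\mathbb{R})$ be the space of probability measures on $\mathbb{R}$ and $n\mathcal P(\mathbb{R})=\{n\mu:\mu\in\mathcal P(\mathbb{R})\}$. The continuum energy $I_n^C:n\mathcal P(\mathbb{R})\to\mathbb{R}\cup\{\infty\}$ is $$I_n^C(\mu):=\int_{\mathbb{R}}\int_{\mathbb{R}}K(x-y)\,d\mu(y)\,d\mu(x)+2\beta\int_{\mathbb{R}}Q(x)\,d\mu(x).$$ Minimizers exist for both energies. $\overline\mu$ denotes the minimizer of $I_n^C$ (it is unique), and $\overline{\mathbf a}=(\overline a_1,\dots,\overline a_n)$ denotes a minimizer of $I_n^D$ over $\{a_1<\dots<a_n\}$ (possibly not unique; one minimizer, chosen arbitrarily, is fixed). The potential values are $$F_n^D:=I_n^D(\overline{\mathbf a})-\beta\sum_{i=1}^nQ(\overline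 a_i),\qquad F_n^C:=I_n^C(\overline\mu)-\beta\int_{\mathbb{R}}Q\,d\overline\mu.$$ All of $\overline{\mathbf a},\overline\mu,F_n^D,F_n^C$ depend on $n$ and $\beta$. *)

(* Defs.v *)
From HB Require Import structures.
From mathcomp Require Import all_boot all_order all_algebra.
From mathcomp Require Import all_classical all_reals all_analysis.
Set Implicit Arguments.
Unset Strict Implicit.
Unset Printing Implicit Defensive.
Import Order.TTheory GRing.Theory Num.Theory.
Import numFieldNormedType.Exports.

Local Open Scope classical_set_scope.
Local Open Scope ring_scope.

Definition tanh {R : realType} (x : R) : R :=
  (expR x - expR (- x)) / (expR x + expR (- x)).

(* Since lne 0 = -oo, this gives K 0 = +oo; the real logarithm of the library
   would give ln 0 = 0 instead. *)
Definition K {R : realType} (x : R) : \bar R := (- lne (`|tanh x|%:E))%E.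

Definition C4 {R : realType} (Q : R -> R) : Prop :=
  (forall k, (k < 4)%N -> forall x, derivable (derive1n k Q) x 1) /\
  continuous (derive1n 4 Q).

(* The integral of Q from 0 to x, which is oriented when x < 0. *)
Definition P {R : realType} (Q : R -> R) (x : R) : R :=
  if 0 <= x then \int[lebesgue_measure]_(t in `[0, x]) Q t
  else - (\int[lebesgue_measure]_(t in `[x, 0]) Q t).

(* 'pinv_ is the inverse of P restricted to the complement of [q1, q2]; its
   default value 0 is taken only off the image of this restriction. *)
Definition Pinv {R : realType} (Q : R -> R) (q1 q2 : R) : R -> R :=
  'pinv_(fun=> 0) (~` `[q1, q2]) (P Q).

Definition ordered {R : realType} {n : nat} (a : 'I_n -> R) : Prop :=
  forall i j : 'I_n, (i < j)%N -> a i < a j.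

Definition ID {R : realType} (Q : R -> R) (n : nat) (beta : R)
    (a : 'I_n -> R) : \bar R :=
  ((n%:R / (n%:R - 1))%:E *
     (\sum_(i < n) \sum_(j < n | j != i) K (a i - a j)) +
   (2 * beta * \sum_(i < n) Q (a i))%:E)%E.

Definition ID_minimizer {R : realType} (Q : R -> R) (n : nat) (beta : R)
    (a : 'I_n -> R) : Prop :=
  ordered a /\
  forall b : 'I_n -> R, ordered b -> (ID Q beta a <= ID Q beta b)%E.

(* Equality of measures is equality on measurable sets: the values of a
   measure on the other sets are unconstrained. *)
Definition nProb {R : realType} (n : nat) :
    set {measure set (measurableTypeR R) -> \bar R} :=
  [set mu | exists nu : probability (measurableTypeR R) R,
     forall A : set (measurableTypeR R), measurable A ->
       mu A = (n%:R%:E * nu A)%E].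

Definition IC {R : realType} (Q : R -> R) (beta : R)
    (mu : {measure set (measurableTypeR R) -> \bar R}) : \bar R :=
  (\int[mu]_x \int[mu]_y K (x - y) + (2 * beta)%:E * \int[mu]_x (Q x)%:E)%E.

Definition IC_minimizer {R : realType} (Q : R -> R) (n : nat) (beta : R)
    (mu : {measure set (measurableTypeR R) -> \bar R}) : Prop :=
  nProb n mu /\
  forall mu' : {measure set (measurableTypeR R) -> \bar R},
    nProb n mu' -> (IC Q beta mu <= IC Q beta mu')%E.

(* The potential values F_n^D and F_n^C, at given configurations. *)
Definition FD {R : realType} (Q : R -> R) (n : nat) (beta : R)
    (a : 'I_n -> R) : \bar R :=
  (ID Q beta a - (beta * \sum_(i < n) Q (a i))%:E)%E.

Definition FC {R : realType} (Q : R -> R) (beta : R)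
    (mu : {measure set (measurableTypeR R) -> \bar R}) : \bar R :=
  (IC Q beta mu - beta%:E * \int[mu]_x (Q x)%:E)%E.

Definition supp {R : realType}
    (mu : {measure set (measurableTypeR R) -> \bar R}) : set R :=
  [set x | forall U : set R, open U -> U x -> (0 < mu U)%E].

(* The L^oo norm of f over A with respect to the Lebesgue measure.  An
   infinite norm would become 0 under fine; this does not happen for f
   continuous and A bounded. *)
Definition Linfty {R : realType} (A : set R) (f : R -> R) : R :=
  fine (Lnorm (@lebesgue_measure R) +oo%E (fun x => (\1_A x * f x)%:E)).

Definition Bbound {R : realType} (Q : R -> R) (C' : R) (n : nat)
    (beta alpha : R) (mu : {measure set (measurableTypeR R) -> \bar R}) : R :=
  C' * (n%:R ^+ 2 / alpha) *
  Num.min (alpha / n%:R *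
           ln (n%:R / alpha *
               (1 + beta * alpha ^+ 3 / n%:R * Linfty (supp mu) (derive1n 2 Q))))
          1.

(* Main.v *)
Require Import Defs.
From HB Require Import structures.
From mathcomp Require Import all_boot all_order all_algebra.
From mathcomp Require Import all_classical all_reals all_analysis.
From mathcomp Require Import measurable_realfun ess_sup_inf ring lra.
Set Implicit Arguments.
Unset Strict Implicit.
Unset Printing Implicit Defensive.
Import Order.TTheory GRing.Theory Num.Theory.
Import numFieldNormedType.Exports.

Local Open Scope classical_set_scope.
Local Open Scope ring_scope.

(* Idea.  Write mu = n p with p a probability measure, b = beta / n and let
   lam = F_n^C / n^2; then P(alpha) = 1 / b.

   Continuum side.  Testing minimality against the uniform measure on
   [0, alpha] bounds the energy by 14 / alpha.  The first variation tested on
   short segments, together with an inequality comparing the kernel with its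
   averages, gives the Euler-Lagrange conditions pointwise: pot p + b Q >= lam
   everywhere, with equality on the support.  By convexity of K and Q the
   support is an interval, it lies in [-14 alpha, 14 alpha] and meets the zero
   set of Q.  The same averaging inequality shows that the part of the
   potential produced at distance r decays like a power of r, with a constant
   that involves only the Lipschitz norm of Q on the support, hence Q''.
   Comparing p with its dilations shows that beta alpha^3 |Q''| / n is bounded
   below, so that the logarithm in the error bound does not degenerate.

   Comparison.  K is the increasing limit of the bounded kernels K(|z| + d),
   which are sums of exponentials e^{-c |z|} with positive coefficients, hence
   positive definite.  Choosing the points one at a time according to p gives
   I_n^D <= I_n^C; conversely the Cauchy-Schwarz inequality for the regularised
   kernel, applied to p and to the empirical measure of the minimizer, bounds
   the energy gap from below by the regularisation error, where d is taken as a
   negative power of (n / alpha) (1 + beta alpha^3 |Q''| / n).  Finally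
   F_n^D <= F_n^C follows by integrating the discrete and continuum
   Euler-Lagrange conditions against an (almost) equilibrium measure of the
   support. *)

(** * The kernel *)

(** The measure [mu] enters only through its minimality: no density is at hand, and [K] is infinite
    at 0. The decay of [gpot r p] under halving of r takes the place of regularity. Each halving
    gains a factor 1 - c with a fixed c <= 1/300, so about (ln X) / c halvings make the
    regularisation error of order 1 / n, where X = (n / alpha) (1 + b alpha^3 |Q''|). Then d is a
    power of X, and the diagonal of the regularised empirical energy costs kr d / n, of order (ln X)
    / n: this is the logarithm of the error bound. The energies I are stationary at their minimizers
    and inherit this error linearly. F is not stationary; it requires the difference of two
    quadratic forms, which Cauchy-Schwarz controls only by the root of the error, hence the square
    root. The sign of F_n^D - F_n^C is exact, so it cannot result from estimates that lose a
    regularisation error, and a domination argument supplies it. The number 14 is 12 + 2: 12 / alpha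
    bounds the potential of the uniform measure on [0, alpha], and 2 / alpha is its confinement
    energy. *)

(** This is 1 / sinh(2x), minus half the derivative of [kr] on the positive axis. *)
Definition kap {R : realType} (x : R) : R :=
  2 / (expR (2 * x) - expR (- (2 * x))).

(** The real-valued form of [K], equal to it off 0. Since ln 0 = 0 its value at 0 is 0, so
    monotonicity and convexity are stated for positive arguments only. *)
Definition kr {R : realType} (x : R) : R := - ln `|tanh x|.

Lemma expR_sub_gt0 (R : realType) (x : R) : 0 < x -> 0 < expR x - expR (- x).
Proof. by move=> x0; rewrite subr_gt0 ltr_expR; lra. Qed.

Lemma expR_add_gt0 (R : realType) (x : R) : 0 < expR x + expR (- x).
Proof. by rewrite addr_gt0 ?expR_gt0. Qed.

Lemma tanh_gt0 (R : realType) (x : R) : 0 < x -> 0 < tanh x.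
Proof. by move=> x0; rewrite divr_gt0 ?expR_sub_gt0 ?expR_add_gt0. Qed.

Lemma tanh_lt1 (R : realType) (x : R) : tanh x < 1.
Proof.
rewrite /tanh ltr_pdivrMr ?expR_add_gt0// mul1r.
have := expR_gt0 (- x); lra.
Qed.

Lemma tanh0 (R : realType) : tanh (0 : R) = 0.
Proof. by rewrite /tanh oppr0 subrr mul0r. Qed.

Lemma tanhN (R : realType) (x : R) : tanh (- x) = - tanh x.
Proof. by rewrite /tanh opprK -mulNr opprB (addrC (expR (- x)) (expR x)). Qed.

Lemma krN (R : realType) (x : R) : kr (- x) = kr x.
Proof. by rewrite /kr tanhN normrN. Qed.

Lemma kr_norm (R : realType) (x : R) : kr `|x| = kr x.
Proof. by case: (ger0P x) => // _; rewrite krN. Qed.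

Lemma kr_gt0E (R : realType) (x : R) : 0 < x -> kr x = - ln (tanh x).
Proof. by move=> x0; rewrite /kr gtr0_norm// tanh_gt0. Qed.

Lemma kr_lnB (R : realType) (x : R) : 0 < x ->
  kr x = ln (expR x + expR (- x)) - ln (expR x - expR (- x)).
Proof.
move=> x0; rewrite kr_gt0E// /tanh ln_div ?posrE ?expR_sub_gt0 ?expR_add_gt0//.
by rewrite opprB.
Qed.

Lemma kr_ge0 (R : realType) (x : R) : 0 <= kr x.
Proof.
rewrite -kr_norm; have [->|x0] := eqVneq x 0.
  by rewrite normr0 /kr tanh0 normr0 ln0// oppr0.
rewrite kr_gt0E ?normr_gt0// oppr_ge0 ln_le0//.
exact/ltW/tanh_lt1.
Qed.

Lemma kap_gt0 (R : realType) (x : R) : 0 < x -> 0 < kap x.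
Proof. by move=> x0; rewrite divr_gt0// expR_sub_gt0//; lra. Qed.

Lemma kap_decr (R : realType) (x y : R) : 0 < x -> x < y -> kap y < kap x.
Proof.
move=> x0 xy; rewrite /kap ltr_pM2l// ltf_pV2 ?posrE ?expR_sub_gt0//; try lra.
have : expR (2 * x) < expR (2 * y) by rewrite ltr_expR; lra.
have : expR (- (2 * y)) < expR (- (2 * x)) by rewrite ltr_expR; lra.
lra.
Qed.

Lemma kap_nincr (R : realType) (x y : R) : 0 < x -> x <= y -> kap y <= kap x.
Proof.
by move=> x0; rewrite le_eqVlt => /predU1P[->//|/(kap_decr x0)/ltW].
Qed.

Lemma expR_mul_opp (R : realType) (x : R) : expR x * expR (- x) = 1.
Proof. exact: expRxMexpNx_1. Qed.

Lemma kapE (R : realType) (x : R) :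
  kap x = 2 / ((expR x - expR (- x)) * (expR x + expR (- x))).
Proof.
by rewrite /kap -mulrN !expRM_natl subr_sqr.
Qed.

Lemma is_derive_kr (R : realType) (x : R) : 0 < x ->
  is_derive x 1 (fun x : R => ln (expR x + expR (- x)) - ln (expR x - expR (- x)))
    (- (2 * kap x)).
Proof.
move=> x0.
have h1 := expR_sub_gt0 x0; have h2 := expR_add_gt0 x.
have d1 : is_derive x 1 (fun x : R => expR x + expR (- x)) (expR x - expR (- x)).
  apply: is_derive_eq.
  by rewrite mulrN1.
have d2 : is_derive x 1 (fun x : R => expR x - expR (- x)) (expR x + expR (- x)).
  apply: is_derive_eq.
  by rewrite mulrN1 opprK.
have e1 := @is_derive1_comp _ (@ln R) _ x _ _ (is_derive1_ln h2) d1.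
have e2 := @is_derive1_comp _ (@ln R) _ x _ _ (is_derive1_ln h1) d2.
have := is_deriveB e1 e2.
move=> /is_derive_eq; apply.
rewrite kapE.
have uv := expR_mul_opp x.
set u := expR x in h1 h2 uv *; set v := expR (- x) in h1 h2 uv *.
have -> : - (2 * (2 / ((u - v) * (u + v)))) = - (4 * (u * v) / ((u - v) * (u + v))).
  by rewrite uv; field; rewrite !gt_eqF.
by field; rewrite !gt_eqF.
Qed.

Lemma kr_MVT (R : realType) (x y : R) : 0 < x -> x < y ->
  exists2 c, x < c < y & kr y - kr x = - (2 * kap c) * (y - x).
Proof.
move=> x0 xy; rewrite !kr_lnB//; last exact: lt_trans xy.
have dk c : x <= c -> is_derive c 1
    (fun x : R => ln (expR x + expR (- x)) - ln (expR x - expR (- x))) (- (2 * kap c)).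
  by move=> xc; apply: is_derive_kr; exact: lt_le_trans xc.
have [||c cxy e] := @MVT R
  (fun x : R => ln (expR x + expR (- x)) - ln (expR x - expR (- x)))
  (fun c => - (2 * kap c)) x y xy.
- by move=> c; rewrite in_itv/= => /andP[xc _]; exact/dk/ltW.
- by apply: derivable_within_continuous => c; rewrite in_itv/= => /andP[xc _]; have [] := dk _ xc.
- by exists c => //; rewrite in_itv/= in cxy.
Qed.

(** The mean value theorem together with the decrease of [kap]. Convexity of the kernel is used in
    this tangent form throughout, so second derivatives of [kr] never appear. *)
Lemma kr_tangent_lt (R : realType) (x y : R) : 0 < x -> 0 < y -> x != y ->
  kr x - 2 * kap x * (y - x) < kr y.
Proof.
move=> x0 y0; rewrite neq_lt => /orP[xy|yx].
- have [c /andP[xc cy] e] := kr_MVT x0 xy.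
  have := kap_decr x0 xc; nra.
- have [c /andP[yc cx] e] := kr_MVT y0 yx.
  have := kap_decr (lt_trans y0 yc) cx; nra.
Qed.

Lemma kr_tangent (R : realType) (x y : R) : 0 < x -> 0 < y ->
  kr x - 2 * kap x * (y - x) <= kr y.
Proof.
move=> x0 y0; have [->|xy] := eqVneq x y; first by rewrite subrr mulr0 subr0.
exact/ltW/kr_tangent_lt.
Qed.

Lemma kr_decr (R : realType) (x y : R) : 0 < x -> x < y -> kr y < kr x.
Proof.
move=> x0 xy; have y0 := lt_trans x0 xy.
have := kr_tangent y0 x0; have := kap_gt0 y0; nra.
Qed.

Lemma kr_nincr (R : realType) (x y : R) : 0 < x -> x <= y -> kr y <= kr x.
Proof.
by move=> x0; rewrite le_eqVlt => /predU1P[->//|/(kr_decr x0)/ltW].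
Qed.

Lemma kr_convex (R : realType) (t x y : R) : 0 < x -> 0 < y -> 0 <= t <= 1 ->
  kr (t * x + (1 - t) * y) <= t * kr x + (1 - t) * kr y.
Proof.
move=> x0 y0 /andP[t0 t1]; set z := _ + _.
have z0 : 0 < z.
  rewrite /z; have [->|tn] := eqVneq t 0; first by rewrite mul0r subr0 mul1r add0r.
  by rewrite ltr_wpDr ?mulr_gt0 ?mulr_ge0 ?subr_ge0// ?ltW// lt_def tn.
have hx := kr_tangent z0 x0; have hy := kr_tangent z0 y0.
have e : kr z = t * (kr z - 2 * kap z * (x - z)) + (1 - t) * (kr z - 2 * kap z * (y - z)).
  by rewrite /z; ring.
by rewrite e lerD// ler_wpM2l// subr_ge0.
Qed.

(** Exponentiated, this is coth x >= 1 + 1 / sinh(2x), which holds because coth x - 1 / sinh(2x) =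
    coth(2x). It makes [gam r] a minorant of [K] for r <= 1. *)
Lemma kr_ge_ln (R : realType) (x : R) : 0 < x -> ln (1 + kap x) <= kr x.
Proof.
move=> x0; rewrite kr_gt0E// -lnV ?posrE ?tanh_gt0//.
rewrite ler_ln ?posrE ?invr_gt0 ?tanh_gt0//; last first.
  by have := kap_gt0 x0; lra.
rewrite kapE /tanh invf_div.
have h1 := expR_sub_gt0 x0; have h2 := expR_add_gt0 x.
have uv := expR_mul_opp x.
set u := expR x in h1 h2 uv *; set v := expR (- x) in h1 h2 uv *.
rewrite -subr_ge0.
have -> : (u + v) / (u - v) - (1 + 2 / ((u - v) * (u + v))) =
   (2 * v ^+ 2 + 2 * (u * v - 1)) / ((u - v) * (u + v)).
  by field; rewrite !gt_eqF.
rewrite uv; apply: divr_ge0; last by rewrite mulr_ge0// ltW.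
by have := sqr_ge0 v; lra.
Qed.

Lemma expR_sub_ge (R : realType) (x : R) : 0 <= x -> x <= expR x - expR (- x).
Proof.
move=> x0; have h := expR_ge1Dx x; rewrite expRN.
have h2 : (expR x)^-1 <= (1 + x)^-1 by rewrite lef_pV2 ?posrE ?expR_gt0//; lra.
have h3 : (1 + x)^-1 <= 1 by rewrite invf_le1; lra.
by lra.
Qed.

Lemma expR_sub_le (R : realType) (x : R) : 0 <= x <= 1 / 2 ->
  expR x - expR (- x) <= 3 * x.
Proof.
move=> /andP[x0 x1]; have h := expR_ge1Dx (- x).
have h2 : expR x <= (1 - x)^-1.
  by rewrite -[x in leLHS]opprK expRN lef_pV2 ?posrE ?expR_gt0//; lra.
have h3 : (1 - x)^-1 <= 1 + 2 * x.
  by rewrite -[leLHS]mul1r ler_pdivrMr; nra.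
lra.
Qed.

Lemma kap_le_inv (R : realType) (x : R) : 0 < x -> kap x <= x^-1.
Proof.
move=> x0; rewrite /kap ler_pdivrMr ?expR_sub_gt0//; last by lra.
have h : 2 * x <= expR (2 * x) - expR (- (2 * x)) by apply: expR_sub_ge; lra.
by rewrite mulrC ler_pdivlMr//; lra.
Qed.

Lemma kap_ge_exp (R : realType) (x : R) : 0 < x -> expR (- (2 * x)) / (2 * x) <= kap x.
Proof.
move=> x0; rewrite /kap ler_pdivlMr ?expR_sub_gt0//; last by lra.
rewrite mulrAC ler_pdivrMr; last by lra.
rewrite mulrBr mulrC expR_mul_opp -expRD.
have := expR_ge1Dx (- (2 * x) + - (2 * x)); lra.
Qed.

Lemma kap_ge_near (R : realType) (x r : R) : 0 < x -> x <= 2 * r -> r <= 1 / 8 ->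
  (6 * r)^-1 <= kap x.
Proof.
move=> x0 xr r8; apply: le_trans (kap_nincr x0 xr).
rewrite /kap -div1r ler_pdivlMr ?expR_sub_gt0//; try lra.
rewrite mulrAC ler_pdivrMr; last by lra.
rewrite mul1r.
(* The restriction r <= 1/8 brings 4r into the range [0, 1/2] of [expR_sub_le]. *)
have := @expR_sub_le R (2 * (2 * r)); lra.
Qed.

Lemma kap_shift (R : realType) (w r : R) : 0 < r -> r <= w -> r <= 1 / 8 ->
  kap w <= 3 * kap (w + r).
Proof.
move=> r0 rw r8; rewrite /kap mulrA ler_pdivrMr ?expR_sub_gt0//; last by lra.
rewrite mulrAC ler_pdivlMr ?expR_sub_gt0//; last by lra.
have -> : 2 * (w + r) = 2 * w + 2 * r by ring.
rewrite !expRN expRD.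
set u := expR (2 * w); set s := expR (2 * r).
have s1 : 1 < s by rewrite expR_gt1; lra.
have su : s <= u by rewrite ler_expR; lra.
have s2 : s <= 2.
  have := expR_ge1Dx (- (2 * r)).
  rewrite expRN -/s => h; rewrite -(ler_pV2) ?inE ?unitfE ?gt_eqF//=; lra.
have u0 : 0 < u by lra.
have s0 : 0 < s by lra.
suff : u * s - (u * s)^-1 <= 3 * (u - u^-1) by lra.
rewrite -(ler_pM2r (mulr_gt0 u0 s0)).
have -> : (u * s - (u * s)^-1) * (u * s) = (u ^+ 2 * s ^+ 2 - 1).
  by field; rewrite !gt_eqF.
have -> : 3 * (u - u^-1) * (u * s) = 3 * s * (u ^+ 2 - 1).
  by field; rewrite !gt_eqF.
have us2 : s ^+ 2 <= u ^+ 2 by nra.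
have : 0 <= (s ^+ 2 - 1) * (3 * s - s ^+ 2 - 1) by apply: mulr_ge0; nra.
have : 0 <= (u ^+ 2 - s ^+ 2) * (3 * s - s ^+ 2) by apply: mulr_ge0; nra.
nra.
Qed.

(** One has tanh(x + d) / tanh x = 1 + sinh d / (sinh x cosh(x + d)). Replacing cosh(x + d) by cosh
    x turns the fraction into 2 sinh d times [kap x], and 2 sinh d <= 3d. *)
Lemma kr_shift (R : realType) (x d : R) : 0 < x -> 0 <= d <= 1 / 2 ->
  kr x - kr (x + d) <= ln (1 + 4 * d * kap x).
Proof.
move=> x0 /andP[d0 d1].
have xd0 : 0 < x + d by lra.
have hd : expR d - expR (- d) <= 3 * d by apply: expR_sub_le; lra.
have kp := kap_gt0 x0.
rewrite !kr_gt0E// opprK addrC -ln_div ?posrE; [|exact: tanh_gt0..].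
rewrite ler_ln ?posrE; [|by apply: divr_gt0; exact: tanh_gt0|by nra].
apply: (@le_trans _ _ (1 + (expR d - expR (- d)) * kap x)); last by nra.
rewrite kapE /tanh opprD !expRD.
have h1 := expR_sub_gt0 x0; have h2 := expR_add_gt0 x.
have := expR_sub_gt0 xd0; have := expR_add_gt0 (x + d).
rewrite opprD !expRD => h4 h3.
have uv := expR_mul_opp x; have st := expR_mul_opp d.
have u1 : 1 <= expR d by have := expR_ge1Dx d; lra.
have up := expR_gt0 x; have vp := expR_gt0 (-x); have tp := expR_gt0 (- d).
set u := expR x in h1 h2 h3 h4 uv up *; set v := expR (- x) in h1 h2 h3 h4 uv vp *.
set s := expR d in h3 h4 u1 st *; set t := expR (- d) in h3 h4 st tp *.
have t1 : t <= 1 by nra.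
have -> : (u * s - v * t) / (u * s + v * t) / ((u - v) / (u + v)) =
  1 + 2 * (u * v) * (s - t) / ((u * s + v * t) * (u - v)).
  by field; rewrite !gt_eqF.
rewrite uv mulr1 lerD2l mulrA -[leRHS]mulrA (mulrC (s - t)) -!mulrA.
rewrite ler_pM2l// (mulrC (s - t)) ler_wpM2r//; first by lra.
have st2 : 0 <= (s - 1) * (1 - t) by apply: mulr_ge0; lra.
have uvst : u + v <= u * s + v * t by nra.
by rewrite lef_pV2 ?posrE ?mulr_gt0// mulrC ler_pM2r.
Qed.

(** From coth^2 = 1 + 1 / sinh^2 and 2 sinh x >= x. *)
Lemma kr_le_ln (R : realType) (x : R) : 0 < x -> kr x <= ln (1 + 4 / x ^+ 2) / 2.
Proof.
move=> x0; have hx : x <= expR x - expR (- x) by apply: expR_sub_ge; exact: ltW.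
have h1 := expR_sub_gt0 x0; have h2 := expR_add_gt0 x.
rewrite ler_pdivlMr// mulr_natr mulr2n kr_gt0E// -lnV ?posrE ?tanh_gt0//.
have T0 : 0 < (tanh x)^-1 by rewrite invr_gt0 tanh_gt0.
rewrite -lnM ?posrE// ler_ln ?posrE ?mulr_gt0//; last first.
  by rewrite ltr_pwDl// divr_ge0// sqr_ge0.
have uv := expR_mul_opp x.
rewrite /tanh invf_div.
set u := expR x in hx h1 h2 uv *; set v := expR (- x) in hx h1 h2 uv *.
have -> : (u + v) / (u - v) * ((u + v) / (u - v)) = 1 + 4 * (u * v) / (u - v) ^+ 2.
  by field; rewrite !gt_eqF.
rewrite uv mulr1 lerD2l ler_pM2l// lef_pV2 ?posrE ?exprn_gt0//.
by rewrite lerXn2r// nnegrE ltW.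
Qed.

(** * Averages of the kernel *)

(** A majorant of the singular part of the kernel that has an elementary primitive, [Phi r]. Its
    integral over the whole line is pi r, so the bound 6r over a segment depends neither on the
    segment nor on the position of the singularity. *)
Definition phi {R : realType} (r v : R) : R := ln (1 + r ^+ 2 / v ^+ 2) / 2.

Definition Phi {R : realType} (r v : R) : R := v * phi r v + r * atan (v / r).

Lemma phi_ge0 (R : realType) (r v : R) : 0 <= phi r v.
Proof.
by rewrite /phi divr_ge0// ln_ge0// lerDl divr_ge0// sqr_ge0.
Qed.

Lemma is_derive_phi (R : realType) (r v : R) : v != 0 ->
  is_derive v 1 (phi r) (- (r ^+ 2 / (v * (v ^+ 2 + r ^+ 2)))).
Proof.
move=> v0.
have v2 : v ^+ 2 != 0 by rewrite expf_neq0.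
have p0 : 0 < 1 + r ^+ 2 / v ^+ 2 by rewrite ltr_pwDl// divr_ge0// sqr_ge0.
have q0 : v ^+ 2 + r ^+ 2 != 0.
  by rewrite gt_eqF// ltr_pwDl ?sqr_ge0// lt_def v2 sqr_ge0.
have d0 : is_derive v 1 (fun v : R => v ^+ 2) (2 * v).
  apply: is_derive_eq.
  by rewrite /GRing.scale/= mulr1; ring.
have d1 := @is_deriveV R (fun v : R => v ^+ 2) v (2 * v) 1 v2 d0.
have d2 : is_derive v 1 (fun v : R => 1 + r ^+ 2 / v ^+ 2) (- (2 * r ^+ 2 / v ^+ 3)).
  have := is_deriveD (is_derive_cst (1 : R) v 1) (is_deriveZ (r ^+ 2) d1).
  move=> /is_derive_eq; apply.
  rewrite add0r !scalerA /GRing.scale/=; field; exact: v0.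
have d3 := @is_derive1_comp _ (@ln R) _ v _ _ (is_derive1_ln p0) d2.
have := is_deriveZ (2^-1) d3.
have -> : (2^-1 \*: (@ln R \o (fun v0 : R => 1 + r ^+ 2 / v0 ^+ 2))) = phi r.
  by apply/funext => u; rewrite /= /phi /GRing.scale/= mulrC.
move=> /is_derive_eq; apply.
by rewrite /GRing.scale/=; field; rewrite v0 q0.
Qed.

Lemma is_derive_Phi (R : realType) (r v : R) : 0 < r -> v != 0 ->
  is_derive v 1 (Phi r) (phi r v).
Proof.
move=> r0 v0.
have q0 : v ^+ 2 + r ^+ 2 != 0.
  by rewrite gt_eqF// ltr_wpDl ?sqr_ge0// exprn_gt0.
have d1 := is_deriveM (is_derive_id v 1) (is_derive_phi r v0).
have d2 : is_derive v 1 (fun v : R => v / r) (r^-1).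
  have := is_deriveZ r^-1 (is_derive_id v 1).
  have -> : (r^-1 \*: id) = (fun v : R => v / r).
    by apply/funext => u; rewrite /= /GRing.scale/= mulrC.
  by move=> /is_derive_eq; apply; rewrite /GRing.scale/= mulr1.
have d3 := @is_derive1_comp _ (@atan R) _ v _ _ (is_derive1_atan _) d2.
have := is_deriveD d1 (is_deriveZ r d3).
move=> /is_derive_eq; apply.
rewrite /GRing.scale/=; field.
by rewrite v0 addrC q0 gt_eqF.
Qed.

Lemma Phi_le (R : realType) (r v : R) : 0 < r -> 0 < v -> 0 <= Phi r v <= 3 * r.
Proof.
move=> r0 v0; rewrite /Phi.
have a0 : 0 <= atan (v / r) by rewrite -(@atan0 R) le_atan// divr_ge0// ltW.
have a1 : atan (v / r) <= 2.
  by have := atan_ltpi2 (v / r); have := @pihalf_lt2 R; lra.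
have h : phi r v <= r / v.
  rewrite /phi ler_pdivrMr//.
  have -> : r / v * 2 = ln (expR (r / v * 2)) by rewrite expRK.
  have rv : 0 < r / v by rewrite divr_gt0.
  rewrite ler_ln ?posrE ?expR_gt0//; last first.
    by rewrite ltr_pwDl// divr_ge0// sqr_ge0.
  rewrite (mulrC (r / v)) expRM_natl -expr_div_n.
  have := expR_ge1Dx (r / v); nra.
have pv := phi_ge0 r v.
have hv : v * phi r v <= r.
  by rewrite -[leRHS](divfK (lt0r_neq0 v0)) mulrC ler_pM2r.
by apply/andP; split; nra.
Qed.

Lemma PhiN (R : realType) (r v : R) : Phi r (- v) = - Phi r v.
Proof. by rewrite /Phi /phi sqrrN mulNr mulNr atanN mulrN -opprD. Qed.

Lemma measurable_inv_sqr (R : realType) :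
  measurable_fun [set: R] (fun v : R => (v ^+ 2)^-1).
Proof.
have -> : (fun v : R => (v ^+ 2)^-1) = (fun v : R => (v ^+ 2) `^ (-1)).
  by apply/funext => v; rewrite powR_inv1// sqr_ge0.
by apply: (measurableT_comp (measurable_powR (-1))).
Qed.

Lemma measurable_phi (R : realType) (r y : R) :
  measurable_fun [set: R] (EFin \o (fun u : R => phi r (u - y))).
Proof.
apply/measurable_EFinP; rewrite /phi.
apply: measurable_funM => //; apply: measurableT_comp => //.
apply: measurable_funD => //; apply: measurable_funM => //.
apply: (measurableT_comp (@measurable_inv_sqr R)) => //.
exact: measurable_funB.
Qed.

Lemma int_phi_away (R : realType) (r y a b : R) : 0 < r -> a < b ->
  (y < a \/ b < y) ->
  (\int[lebesgue_measure]_(u in `[a, b]) (phi r (u - y))%:E <= (3 * r)%:E)%E.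
Proof.
move=> r0 ab yab.
have ne (u : R) : a <= u <= b -> u - y != 0.
  by move=> /andP[au ub]; rewrite subr_eq0; apply/eqP; lra.
have ds (u : R) : is_derive u 1 (fun u : R => u - y) 1.
  by apply: is_derive_eq; rewrite subr0.
have dPhi (u : R) : a <= u <= b -> is_derive u 1 (fun u => Phi r (u - y)) (phi r (u - y)).
  move=> /ne u0.
  have := @is_derive1_comp _ (Phi r) _ u _ _ (is_derive_Phi r0 u0) (ds u).
  by rewrite mulr1.
have dphi (u : R) : a <= u <= b -> derivable (fun u => phi r (u - y)) u 1.
  move=> /ne u0.
  by have [] := @is_derive1_comp _ (phi r) _ u _ _ (is_derive_phi r u0) (ds u).
have cPhi : {within `[a, b], continuous (fun u => Phi r (u - y))}.
  by apply: derivable_within_continuous => u; rewrite in_itv/= => /dPhi[].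
rewrite (@continuous_FTC2 _ _ (fun u => Phi r (u - y)))//; last 3 first.
- by apply: derivable_within_continuous => u; rewrite in_itv/= => /dphi.
- have [_ ca cb] := (continuous_within_itvP _ ab).1 cPhi; split; [|exact: ca|exact: cb].
  by move=> u; rewrite in_itv/= => /andP[/ltW h1 /ltW h2]; have [] := dPhi u (introT andP (conj h1 h2)).
- move=> u; rewrite in_itv/= => /andP[/ltW h1 /ltW h2].
  by rewrite derive1E; have [_ ->] := dPhi u (introT andP (conj h1 h2)).
rewrite -EFinB lee_fin.
case: yab => yab.
- have /andP[ha1 ha2] := @Phi_le R r (a - y) r0 ltac:(lra).
  have /andP[hb1 hb2] := @Phi_le R r (b - y) r0 ltac:(lra).
  lra.
- have /andP[ha1 ha2] := @Phi_le R r (y - a) r0 ltac:(lra).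
  have /andP[hb1 hb2] := @Phi_le R r (y - b) r0 ltac:(lra).
  rewrite -(opprB y a) -(opprB y b) !PhiN.
  lra.
Qed.

Lemma int_phi_right (R : realType) (r y M : R) : 0 < r -> 0 < M ->
  (\int[lebesgue_measure]_(u in `[y, (y + M)%R]) (phi r (u - y))%:E <= (3 * r)%:E)%E.
Proof.
move=> r0 M0.
rewrite -integral_itv_obnd_cbnd; last first.
  exact: measurable_funTS (measurable_phi r y).
(* The segments exhaust ]y, y + M] and avoid the singularity; [k.+2] keeps each of them
   nondegenerate already for k = 0. *)
pose F : nat -> set (measurableTypeR R) := fun k => `[y + M / k.+2%:R, y + M]%classic.
have FE : \bigcup_k F k = `]y, (y + M)]%classic.
  apply/seteqP; split => u /=.
    move=> [k _]; rewrite /F/= !in_itv/= => /andP[h1 ->]; rewrite andbT.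
    by apply: lt_le_trans h1; rewrite ltrDl divr_gt0.
  rewrite in_itv/= => /andP[yu uM].
  have [k hk] : exists k : nat, M / (u - y) < k%:R.
    by exists (Num.trunc (M / (u - y))).+1; rewrite truncnS_gt.
  exists k => //; rewrite /F/= in_itv/= uM andbT -lerBrDl ler_pdivrMr//.
  rewrite -ler_pdivrMl ?subr_gt0// mulrC; apply: le_trans (ltW hk) _.
  by rewrite ler_nat; apply: ltnW.
have mF k : measurable (F k) by exact: measurable_itv.
have := @ge0_nondecreasing_set_cvg_integral _ (measurableTypeR R) R F
  (fun u => (phi r (u - y))%:E) lebesgue_measure.
rewrite FE => H.
have cv : (\int[lebesgue_measure]_(u in F k) (phi r (u - y))%:E @[k --> \oo] -->
   \int[lebesgue_measure]_(u in `]y, (y + M)%R]) (phi r (u - y))%:E)%E.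
  apply: H => //.
  - apply/nondecreasing_seqP => k; rewrite subsetEset => u /=.
    rewrite /F/= !in_itv/= => /andP[h ->]; rewrite andbT; apply: le_trans h.
    by rewrite lerD2l ler_pM2l// lef_pV2 ?posrE// ler_nat.
  - by move=> k; exact: measurable_funTS (measurable_phi r y).
  - by move=> k u _; rewrite lee_fin phi_ge0.
rewrite -(cvg_lim _ cv)//; apply: lime_le; first by apply/cvg_ex; eexists; exact: cv.
apply: nearW => k; apply: int_phi_away => //.
  rewrite ltrD2l ltr_pdivrMr// ltr_pMr// ltr1n//.
by left; rewrite ltrDl divr_gt0.
Qed.

Lemma int_phi_left (R : realType) (r y M : R) : 0 < r -> 0 < M ->
  (\int[lebesgue_measure]_(u in `[(y - M)%R, y]) (phi r (u - y))%:E <= (3 * r)%:E)%E.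
Proof.
move=> r0 M0.
rewrite -integral_itv_bndo_bndc; last first.
  exact: measurable_funTS (measurable_phi r y).
pose F : nat -> set (measurableTypeR R) := fun k => `[y - M, y - M / k.+2%:R]%classic.
have FE : \bigcup_k F k = `[y - M, y[%classic.
  apply/seteqP; split => u /=.
    move=> [k _]; rewrite /F/= !in_itv/= => /andP[-> h1] /=.
    by apply: le_lt_trans h1 _; rewrite gtrBl divr_gt0.
  rewrite in_itv/= => /andP[uM yu].
  have [k hk] : exists k : nat, M / (y - u) < k%:R.
    by exists (Num.trunc (M / (y - u))).+1; rewrite truncnS_gt.
  exists k => //; rewrite /F/= in_itv/= uM/= lerBrDr -lerBrDl ler_pdivrMr//.
  rewrite -ler_pdivrMl ?subr_gt0// mulrC; apply: le_trans (ltW hk) _.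
  by rewrite ler_nat; apply: ltnW.
have mF k : measurable (F k) by exact: measurable_itv.
have := @ge0_nondecreasing_set_cvg_integral _ (measurableTypeR R) R F
  (fun u => (phi r (u - y))%:E) lebesgue_measure.
rewrite FE => H.
have cv : (\int[lebesgue_measure]_(u in F k) (phi r (u - y))%:E @[k --> \oo] -->
   \int[lebesgue_measure]_(u in `[(y - M)%R, y[) (phi r (u - y))%:E)%E.
  apply: H => //.
  - apply/nondecreasing_seqP => k; rewrite subsetEset => u /=.
    rewrite /F/= !in_itv/= => /andP[-> h] /=; apply: le_trans h _.
    by rewrite lerD2l lerN2 ler_pM2l// lef_pV2 ?posrE// ler_nat.
  - by move=> k; exact: measurable_funTS (measurable_phi r y).
  - by move=> k u _; rewrite lee_fin phi_ge0.
rewrite -(cvg_lim _ cv)//; apply: lime_le; first by apply/cvg_ex; eexists; exact: cv.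
apply: nearW => k; apply: int_phi_away => //.
  by rewrite ltrD2l ltrN2 ltr_pdivrMr// ltr_pMr// ltr1n.
by right; rewrite gtrBl divr_gt0.
Qed.

Lemma int_phi (R : realType) (r y a b : R) : 0 < r -> a <= b ->
  (\int[lebesgue_measure]_(u in `[a, b]) (phi r (u - y))%:E <= (6 * r)%:E)%E.
Proof.
move=> r0 ab.
pose M := `|a - y| + `|b - y| + 1.
have M0 : 0 < M by rewrite /M; have := normr_ge0 (a - y); have := normr_ge0 (b - y); lra.
apply: (@le_trans _ _ (\int[lebesgue_measure]_(u in `[(y - M)%R, y] `|` `[y, (y + M)%R])
    (phi r (u - y))%:E)%E).
  apply: ge0_subset_integral => //.
  - exact: measurableU.
  - exact: measurable_funTS (measurable_phi r y).
  - by move=> u _; rewrite lee_fin phi_ge0.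
  - move=> u /=; rewrite !in_itv/= => /andP[au ub].
    have h1 : - (a - y) <= `|a - y| by rewrite -normrN ler_norm.
    have h2 : b - y <= `|b - y| by rewrite ler_norm.
    have h3 := normr_ge0 (a - y); have h4 := normr_ge0 (b - y).
    rewrite /M; have [uy|yu] := leP u y; [left|right]; lra.
apply: (@le_trans _ _ (\int[lebesgue_measure]_(u in `[(y - M)%R, y]) (phi r (u - y))%:E +
   \int[lebesgue_measure]_(u in `[y, (y + M)%R]) (phi r (u - y))%:E)%E); last first.
  have -> : (6 * r)%:E = ((3 * r)%:E + (3 * r)%:E)%E by rewrite -EFinD; congr (_%:E); ring.
  by apply: leeD; [exact: int_phi_left|exact: int_phi_right].
rewrite -[X in (_ <= X + _)%E]integral_itv_bndo_bndc; last first.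
  exact: measurable_funTS (measurable_phi r y).
rewrite -ge0_integral_setU//=; last 3 first.
- exact: measurable_funTS (measurable_phi r y).
- by move=> u _; rewrite lee_fin phi_ge0.
- by apply/disj_setPS => u /=; rewrite !in_itv/= => -[/andP[_ h] /andP[h' _]]; lra.
apply: ge0_subset_integral => //; try exact: measurableU.
- exact: measurable_funTS (measurable_phi r y).
- by move=> u _; rewrite lee_fin phi_ge0.
- move=> u /=; rewrite !in_itv/= => h.
  by have [uy|yu] := ltP u y; [left|right]; lra.
Qed.

(** * The extended-valued kernel and its averages over segments *)

Lemma K_0 (R : realType) : K (0 : R) = +oo%E.
Proof. by rewrite /K tanh0 normr0 le0_lneNy. Qed.

Lemma K_kr (R : realType) (x : R) : x != 0 -> K x = (kr x)%:E.
Proof.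
move=> x0; rewrite /K lne_EFin// normr_gt0.
have : 0 < tanh `|x| by rewrite tanh_gt0// normr_gt0.
by case: (ger0P x) => _; rewrite ?tanhN ?oppr_gt0 => h; [rewrite gt_eqF|rewrite lt_eqF].
Qed.

Lemma KN (R : realType) (x : R) : K (- x) = K x.
Proof. by rewrite /K tanhN normrN. Qed.

Lemma K_subC (R : realType) (x y : R) : K (x - y) = K (y - x).
Proof. by rewrite -KN opprB. Qed.

Lemma K_ge0 (R : realType) (x : R) : (0 <= K x)%E.
Proof.
have [->|x0] := eqVneq x 0; first by rewrite K_0.
by rewrite K_kr// lee_fin kr_ge0.
Qed.

Lemma measurable_tanh (R : realType) : measurable_fun [set: R] (@tanh R).
Proof.
have -> : (@tanh R) = (fun x => (expR x - expR (- x)) * (expR x + expR (- x)) `^ (-1)).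
  by apply/funext => x; rewrite /tanh powR_inv1// ltW// expR_add_gt0.
have mN : measurable_fun [set: R] (fun x : R => expR (- x)).
  by apply: measurableT_comp => //; exact: measurable_expR.
apply: measurable_funM; first by apply: measurable_funB => //; exact: measurable_expR.
apply: (measurableT_comp (measurable_powR (-1))) => //.
by apply: measurable_funD => //; exact: measurable_expR.
Qed.

Lemma measurable_kr (R : realType) : measurable_fun [set: R] (@kr R).
Proof.
apply: measurableT_comp => //; apply: measurableT_comp => //.
by apply: measurableT_comp => //; exact: measurable_tanh.
Qed.

Lemma measurable_K (R : realType) : measurable_fun [set: R] (@K R).
Proof.
have -> : (@K R) = (fun x => if x == 0%R then +oo else (kr x)%:E)%E.
  by apply/funext => x; case: eqVneq => [->|x0]; [exact: K_0|exact: K_kr].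
apply: measurable_fun_ifT => //; last by apply/measurable_EFinP; exact: measurable_kr.
exact: measurable_fun_eqr.
Qed.

Lemma integral_cst_itv (R : realType) (a b c : R) : a < b ->
  (\int[lebesgue_measure]_(u in `[a, b]) c%:E)%E = (c * (b - a))%:E.
Proof.
move=> ab; rewrite integral_cst//= lebesgue_measure_itv/= lte_fin ab.
by rewrite -EFinD -EFinM.
Qed.

(** For r <= 1, (1 + 4 / v^2) r^2 <= 1 + (2r)^2 / v^2. The free scale r trades the mass of the
    singular part, of order r, against the constant - ln r. *)
Lemma K_le_phi (R : realType) (r v : R) : 0 < r <= 1 -> v != 0 ->
  kr v <= phi (2 * r) v - ln r.
Proof.
move=> /andP[r0 r1] v0; rewrite -kr_norm.
have n0 : 0 < `|v| by rewrite normr_gt0.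
have n2 : 0 < `|v| ^+ 2 by rewrite exprn_gt0.
apply: le_trans (kr_le_ln n0) _.
rewrite /phi -[v ^+ 2]real_normK ?num_real//.
have lr : ln (r ^+ 2) = 2 * ln r by rewrite lnXn// mulr_natl.
suff : ln (1 + 4 / `|v| ^+ 2) + ln (r ^+ 2) <= ln (1 + (2 * r) ^+ 2 / `|v| ^+ 2) by lra.
have p1 : 0 < 1 + 4 / `|v| ^+ 2 by rewrite ltr_pwDl// divr_ge0// ltW.
rewrite -lnM ?posrE ?exprn_gt0// ler_ln ?posrE; last 2 first.
- by rewrite mulr_gt0// exprn_gt0.
- by rewrite ltr_pwDl// divr_ge0 ?sqr_ge0// ltW.
have -> : (1 + 4 / `|v| ^+ 2) * r ^+ 2 = r ^+ 2 + (2 * r) ^+ 2 / `|v| ^+ 2.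
  by field; rewrite gt_eqF.
by rewrite lerD2r expr_le1// ltW.
Qed.

Lemma measurable_K_sub (R : realType) (y : R) :
  measurable_fun [set: R] (fun u : R => K (u - y)).
Proof.
apply: (measurableT_comp (@measurable_K R)) => //.
exact: measurable_funB.
Qed.

Lemma int_K_le (R : realType) (r y a b : R) : 0 < r <= 1 -> a < b ->
  (\int[lebesgue_measure]_(u in `[a, b]) K (u - y) <= (12 * r + (b - a) * (- ln r))%:E)%E.
Proof.
move=> /andP[r0 r1] ab.
have mab : measurable (`[a, b]%classic `\ y : set R) by apply: measurableD.
have mK := measurable_K_sub y; have mp := measurable_phi (2 * r) y.
(* Removing the null point y leaves only arguments where [K] is finite. *)
rewrite -(@integral_setD1 R _ y)//; last exact: measurable_funTS.
have lnr : 0 <= - ln r by rewrite oppr_ge0 ln_le0.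
apply: (@le_trans _ _ (\int[lebesgue_measure]_(u in `[a, b] `\ y)
    ((phi (2 * r) (u - y))%:E + (- ln r)%:E))%E).
  apply: ge0_le_integral => //.
  - by move=> u _; exact: K_ge0.
  - exact: measurable_funTS.
  - by apply: emeasurable_funD => //; exact: measurable_funTS.
  - move=> u [_ /eqP uy]; have uy0 : u - y != 0 by rewrite subr_eq0.
    by rewrite K_kr// -EFinD lee_fin K_le_phi ?r0.
apply: (@le_trans _ _ (\int[lebesgue_measure]_(u in `[a, b])
    ((phi (2 * r) (u - y))%:E + (- ln r)%:E))%E).
  apply: ge0_subset_integral => //.
  - by apply: emeasurable_funD => //; exact: measurable_funTS.
  - by move=> u _; rewrite -EFinD lee_fin addr_ge0// phi_ge0.
rewrite ge0_integralD//; last 2 first.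
- by move=> u _; rewrite lee_fin phi_ge0.
- exact: measurable_funTS.
rewrite EFinD; apply: leeD.
  have -> : 12 * r = 6 * (2 * r) by ring.
  by apply: int_phi; [lra|exact: ltW].
by rewrite integral_cst_itv// lee_fin mulrC.
Qed.

(** Here the scale in [int_K_le] is the length of the segment, which is sharp up to a constant for
    short segments; [avg_K_le_long] takes scale 1 and so admits every length. *)
Lemma avg_K_le (R : realType) (a b : R) (ab : a < b) (y : R) : b - a <= 1 ->
  (\int[uniform_prob ab]_u K (u - y) <= (12 - ln (b - a))%:E)%E.
Proof.
move=> ba1; have ba0 : 0 < b - a by rewrite subr_gt0.
rewrite integral_uniform//; last 2 first.
- exact: measurable_K_sub.
- by move=> u; exact: K_ge0.
apply: (@le_trans _ _ (((b - a)^-1)%:E * (12 * (b - a) + (b - a) * (- ln (b - a)))%:E)%E).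
  by rewrite lee_pmul2l ?lte_fin ?invr_gt0// int_K_le// ba0.
rewrite -EFinM lee_fin le_eqVlt; apply/orP; left; apply/eqP.
by field; rewrite gt_eqF.
Qed.

Lemma avg_K_le_long (R : realType) (a b : R) (ab : a < b) (y : R) :
  (\int[uniform_prob ab]_u K (u - y) <= (12 / (b - a))%:E)%E.
Proof.
have ba0 : 0 < b - a by rewrite subr_gt0.
rewrite integral_uniform//; last 2 first.
- exact: measurable_K_sub.
- by move=> u; exact: K_ge0.
rewrite mulrC EFinM lee_pmul2l ?lte_fin ?invr_gt0//.
apply: le_trans (@int_K_le R 1 y a b _ ab) _; first by rewrite ltr01/=.
by rewrite ln1 oppr0 mulr0 addr0 mulr1.
Qed.

(* The kernel with value ln (1 + r / sinh (2|z|)), singular like -ln |z| at 0;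
   its integrals against the equilibrium measure decay geometrically as r is
   halved. *)
Definition gam {R : realType} (r z : R) : \bar R :=
  if z == 0 then +oo%E else (ln (1 + r * kap `|z|))%:E.

Lemma gamE (R : realType) (r z : R) : z != 0 -> gam r z = (ln (1 + r * kap `|z|))%:E.
Proof. by rewrite /gam => /negbTE ->. Qed.

Lemma gam0 (R : realType) (r : R) : gam r 0 = +oo%E.
Proof. by rewrite /gam eqxx. Qed.

Lemma gam_ge0 (R : realType) (r z : R) : 0 <= r -> (0 <= gam r z)%E.
Proof.
move=> r0; have [->|z0] := eqVneq z 0; first by rewrite /gam eqxx.
rewrite gamE// lee_fin ln_ge0// lerDl mulr_ge0// ltW// kap_gt0//.
by rewrite normr_gt0.
Qed.

Lemma gam_le_K (R : realType) (r z : R) : 0 <= r <= 1 -> (gam r z <= K z)%E.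
Proof.
move=> /andP[r0 r1]; have [->|z0] := eqVneq z 0; first by rewrite K_0 leey.
have n0 : 0 < `|z| by rewrite normr_gt0.
have k0 := kap_gt0 n0.
rewrite gamE// K_kr// lee_fin -kr_norm; apply: le_trans (kr_ge_ln n0).
rewrite ler_ln ?posrE; try nra.
Qed.

Lemma K_kr_shift_gam (R : realType) (d z : R) : 0 <= d <= 1 / 2 ->
  (K z <= (kr (`|z| + d))%:E + gam (4 * d) z)%E.
Proof.
move=> dd; have [->|z0] := eqVneq z 0; first by rewrite /gam eqxx addey// leey.
have n0 : 0 < `|z| by rewrite normr_gt0.
rewrite gamE// K_kr// -EFinD lee_fin -kr_norm addrC -lerBlDr.
exact: kr_shift.
Qed.

Lemma measurable_kap (R : realType) : measurable_fun [set: R] (fun z : R => kap `|z|).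
Proof.
have -> : (fun z : R => kap `|z|) =
    (fun z => 2 * (expR (2 * `|z|) - expR (- (2 * `|z|))) `^ (-1)).
  apply/funext => z; rewrite /kap powR_inv1// subr_ge0 ler_expR.
apply: measurable_funM => //; apply: (measurableT_comp (measurable_powR (-1))) => //.
have m2 : measurable_fun [set: R] (fun z : R => 2 * `|z|).
  by apply: measurable_funM => //; exact: measurableT_comp.
apply: measurable_funB; apply: measurableT_comp => //; try exact: measurable_expR.
exact: measurableT_comp.
Qed.

Lemma measurable_gam (R : realType) (r : R) : measurable_fun [set: R] (@gam R r).
Proof.
apply: measurable_fun_ifT => //; first exact: measurable_fun_eqr.
apply/measurable_EFinP; apply: measurableT_comp => //.
apply: measurable_funD => //; apply: measurable_funM => //.
exact: measurable_kap.
Qed.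

Lemma ln1D_le (R : realType) (x : R) : 0 <= x -> ln (1 + x) <= x.
Proof. by move=> x0; apply: le_ln1Dx; lra. Qed.

Lemma ln1D_ge (R : realType) (x : R) : 0 <= x -> x / (1 + x) <= ln (1 + x).
Proof.
move=> x0; have p : 0 < 1 + x by lra.
have := @le_ln1Dx R ((1 + x)^-1 - 1).
rewrite subrKC lnV ?posrE// => h.
have : - ln (1 + x) <= (1 + x)^-1 - 1 by apply: h; rewrite ltrBrDl subrr invr_gt0.
have -> : x / (1 + x) = 1 - (1 + x)^-1 by field; rewrite gt_eqF.
lra.
Qed.

(** Halving t lowers ln (1 + t) by ln (1 + t / (2 + t)) >= 1/14, while ln (1 + t) - ln t = ln (1 + 1
    / t) <= 6. The cost is therefore at most c (6 + 12) <= 18/300 < 1/14; this fixes the size of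
    c. *)
Lemma gam_step_near (R : realType) (c t : R) : 0 < c <= 1 / 300 -> 1 / 6 <= t ->
  ln (1 + t / 2) <= (1 - c) * ln (1 + t) + c * (ln t - 12).
Proof.
move=> /andP[c0 c1] t6; have t0 : 0 < t by lra.
have e1 : ln (1 + t) = ln t + ln (1 + t^-1).
  by rewrite -lnM ?posrE//; [rewrite mulrDr mulr1 divff ?gt_eqF// addrC|rewrite addr_gt0// invr_gt0].
have l1 : ln (1 + t^-1) <= 6.
  apply: le_trans (@ln1D_le _ t^-1 _) _; first by rewrite invr_ge0 ltW.
  by rewrite -div1r ler_pdivrMr//; lra.
have e2 : ln (1 + t) = ln (1 + t / 2) + ln (1 + t / (2 + t)).
  rewrite -lnM ?posrE//; last 2 first.
  - by lra.
  - by rewrite ltr_pwDl// divr_ge0//; lra.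
  by congr ln; field; rewrite gt_eqF//; lra.
have l2 : 1 / 14 <= ln (1 + t / (2 + t)).
  have h : 1 / 13 <= t / (2 + t) by rewrite ler_pdivlMr; lra.
  apply: (@le_trans _ _ (ln (1 + 1 / 13))); last by rewrite ler_ln ?posrE; lra.
  apply: le_trans (@ln1D_ge R (1 / 13) _); last by lra.
  by rewrite ler_pdivlMr; lra.
have : c * (ln (1 + t^-1) + 12) <= c * 18 by rewrite ler_pM2l//; lra.
have -> : ln (1 + t / 2) = ln t + ln (1 + t^-1) - ln (1 + t / (2 + t)) by lra.
rewrite e1; lra.
Qed.

(** For small t both logarithms are linear: t / 2 against at least 2t / 3. The margin t / 6 pays for
    6ct, the possible rise of the kernel over the segment. *)
Lemma gam_step_far (R : realType) (c t : R) : 0 < c <= 1 / 300 -> 0 <= t <= 1 / 2 ->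
  ln (1 + t / 2) + c * (6 * t) <= (1 - c) * ln (1 + t).
Proof.
move=> /andP[c0 c1] /andP[t0 t1].
have h1 : ln (1 + t / 2) <= t / 2 by apply: ln1D_le; lra.
have h2 : t * (2 / 3) <= ln (1 + t).
  apply: le_trans (ln1D_ge t0); rewrite ler_wpM2l//.
  by rewrite -[leRHS]div1r ler_pdivlMr; lra.
have h3 : (1 - c) * (t * (2 / 3)) <= (1 - c) * ln (1 + t) by rewrite ler_pM2l//; lra.
have : c * t <= (1 / 300) * t by rewrite ler_wpM2r.
lra.
Qed.

Lemma avg_K_le_away (R : realType) (a b : R) (ab : a < b) (y w : R) : 0 < w ->
  (forall u, a <= u <= b -> w <= `|u - y|) ->
  (\int[uniform_prob ab]_u K (u - y) <= (kr w)%:E)%E.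
Proof.
move=> w0 H; have ba0 : 0 < b - a by rewrite subr_gt0.
rewrite integral_uniform//; last 2 first.
- exact: measurable_K_sub.
- by move=> u; exact: K_ge0.
apply: (@le_trans _ _ (((b - a)^-1)%:E * \int[lebesgue_measure]_(u in `[a, b]) (kr w)%:E)%E).
  rewrite lee_pmul2l ?lte_fin ?invr_gt0//; apply: ge0_le_integral => //.
  - by move=> u _; exact: K_ge0.
  - exact: measurable_funTS (measurable_K_sub y).
  - move=> u /=; rewrite in_itv/= => /H wu.
    have n0 : 0 < `|u - y| by exact: lt_le_trans wu.
    by rewrite K_kr -?normr_gt0// lee_fin -kr_norm kr_nincr.
rewrite integral_cst_itv// -EFinM lee_fin mulrCA mulVf ?mulr1// gt_eqF//.
Qed.

(** With t = (b - a) kap |x - y|, two regimes occur. If y is within twice the length of x, then t >=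
    1/6, the average of [K] is at most 12 - ln (b - a) and [K (x - y)] at least ln t - ln (b - a):
    this is [gam_step_near]. Farther away [K] rises by at most 6t over the segment: this is
    [gam_step_far]. Taking x as an end point later allows segments that stay inside the support. *)
Lemma gam_half_avg (R : realType) (a b : R) (ab : a < b) (c x y : R) :
  0 < c <= 1 / 300 -> b - a <= 1 / 8 -> x = a \/ x = b ->
  (gam ((b - a) / 2) (x - y) + c%:E * \int[uniform_prob ab]_u K (u - y) <=
   (1 - c)%:E * gam (b - a) (x - y) + c%:E * K (x - y))%E.
Proof.
move=> c300 r8 xab; have r0 : 0 < b - a by rewrite subr_gt0.
have c0 : 0 < c by case/andP: c300.
have c1 : 0 < 1 - c by lra.
have xu u : a <= u <= b -> `|u - x| <= b - a.
  by move=> /andP[au ub]; rewrite ler_norml; case: xab => ->; apply/andP; split; lra.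
set r := b - a in r8 r0 xu *.
have [->|z0] := eqVneq (x - y) 0.
  have h1 : ((1 - c)%:E * +oo = +oo :> \bar R)%E by rewrite gt0_muley// lte_fin.
  have h2 : (c%:E * +oo = +oo :> \bar R)%E by rewrite gt0_muley// lte_fin.
  by rewrite K_0 !gam0 h1 h2 [leRHS]addye ?leey.
have n0 : 0 < `|x - y| by rewrite normr_gt0.
have k0 := kap_gt0 n0.
pose t := r * kap `|x - y|.
have t0 : 0 < t by rewrite mulr_gt0.
rewrite !gamE// K_kr// -kr_norm mulrAC -/t.
have kt : ln t - ln r <= kr `|x - y|.
  apply: le_trans (kr_ge_ln n0).
  rewrite -ln_div ?posrE//.
  have -> : t / r = kap `|x - y| by rewrite /t mulrAC divff ?gt_eqF// mul1r.
  by rewrite ler_ln ?posrE; lra.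
have [zr|zr] := leP `|x - y| (2 * r).
  have t6 : 1 / 6 <= t.
    have h := kap_ge_near n0 zr r8.
    apply: le_trans (ler_wpM2l (ltW r0) h).
    by rewrite le_eqVlt; apply/orP; left; apply/eqP; field; rewrite gt_eqF.
  have h := gam_step_near c300 t6.
  apply: (@le_trans _ _ ((ln (1 + t / 2))%:E + c%:E * (12 - ln r)%:E)%E).
    by rewrite leeD2l// lee_pmul2l ?lte_fin// avg_K_le// -/r; lra.
  rewrite -!EFinM -!EFinD lee_fin; nra.
have w0 : 0 < `|x - y| - r by lra.
apply: (@le_trans _ _ ((ln (1 + t / 2))%:E + c%:E * (kr (`|x - y| - r))%:E)%E).
  rewrite leeD2l// lee_pmul2l ?lte_fin// avg_K_le_away// => u /xu ux.
  have := ler_normD (x - u) (u - y); rewrite subrKA (distrC x u); lra.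
have t2 : t <= 1 / 2.
  have h := kap_le_inv n0.
  apply: le_trans (ler_wpM2l (ltW r0) h) _.
  by rewrite ler_pdivrMr//; lra.
(* The slope of the kernel at the nearest possible distance is 2 kap, and [kap_shift] compares this
   with its value at |x - y| at the cost of a factor 3. *)
have hk : kr (`|x - y| - r) <= kr `|x - y| + 6 * t.
  have h1 := kr_tangent w0 n0.
  have h2 := @kap_shift R (`|x - y| - r) r r0 ltac:(lra) r8.
  rewrite subrK in h2.
  rewrite subKr in h1.
  rewrite /t; nra.
have h := @gam_step_far R c t c300 ltac:(lra).
rewrite -!EFinM -!EFinD lee_fin; nra.
Qed.

(** * Integral inequalities and probability measures given through their integrals *)

Lemma exists_le_integral (R : realType) (p : probability (measurableTypeR R) R)
  (f : R -> \bar R) (c e : R) : measurable_fun [set: R] f -> (forall x, 0 <= f x)%E ->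
  (\int[p]_x f x <= c%:E)%E -> 0 < e -> exists x, (f x <= (c + e)%:E)%E.
Proof.
move=> mf f0 fc e0; apply: contrapT => /forallNP H.
have c0 : 0 <= c by rewrite -lee_fin; apply: le_trans fc; apply: integral_ge0.
have : ((c + e)%:E <= \int[p]_x f x)%E.
  have -> : (c + e)%:E = (\int[p]_x (c + e)%:E)%E.
    by rewrite (integral_cst p)//= probability_setT mule1.
  apply: ge0_le_integral => //; first by move=> x _; rewrite lee_fin addr_ge0// ltW.
  by move=> x _; have /negP := H x; rewrite -ltNge => /ltW.
by move=> /le_trans/(_ fc); rewrite lee_fin; lra.
Qed.

Lemma integral_gt0 (R : realType) (p : probability (measurableTypeR R) R)
  (f : R -> \bar R) (N : set R) : measurable N -> p N = 0%E ->
  measurable_fun [set: R] f -> (forall x, 0 <= f x)%E ->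
  (forall x, ~ N x -> 0 < f x)%E -> (0 < \int[p]_x f x)%E.
Proof.
move=> mN N0 mf f0 fN; rewrite lt_neqAle integral_ge0// andbT.
apply/eqP => /esym i0.
have : (\int[p]_x `|f x| = 0)%E.
  by rewrite -i0; apply: eq_integral => x _; rewrite gee0_abs.
move/(ae_eq_integral_abs p measurableT mf) => [M [mM M0 sM]].
have : (p [set: R] <= p (N `|` M))%E.
  apply: le_measure; rewrite ?inE//; first exact: measurableU.
  move=> x _; have [Nx|Nx] := pselect (N x); [by left|right].
  apply: sM => /= /(_ I) fx0; have := fN x Nx.
  by rewrite fx0 ltxx.
have pNM : (p (N `|` M) <= p N + p M)%E by exact: measureU2.
rewrite probability_setT => /le_trans /(_ pNM).
by rewrite [X in (_ <= X + _)%E]N0 [X in (_ <= _ + X)%E]M0 add0e lee_fin ler10.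
Qed.

(** Normalising a measure of mass 1 leaves its values unchanged and supplies the type [probability];
    the uniform measure is the default of [mnormalize] for masses 0 and oo. *)
Lemma probability_of_measure (R : realType)
  (m : {measure set (measurableTypeR R) -> \bar R}) : m [set: R] = 1%E ->
  exists q : probability (measurableTypeR R) R, forall f : R -> \bar R,
    (\int[q]_x f x = \int[m]_x f x)%E.
Proof.
move=> m1; have ab : (0 : R) < 1 by [].
have m1' : m setT = 1%:E by exact: m1.
exists (mnormalize m (uniform_prob ab)) => f.
apply: eq_measure_integral => A mA _.
change (mnormalize m (uniform_prob ab) A = m A).
by rewrite /mnormalize m1' eqe oner_eq0/= invr1 mule1.
Qed.

Lemma probability_mix (R : realType) (p nu : probability (measurableTypeR R) R) (t : R) :
  0 <= t <= 1 -> exists q : probability (measurableTypeR R) R,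
  forall f : R -> \bar R, measurable_fun [set: R] f -> (forall x, 0 <= f x)%E ->
    (\int[q]_x f x = (1 - t)%:E * \int[p]_x f x + t%:E * \int[nu]_x f x)%E.
Proof.
move=> /andP[t0 t1]; have t1' : 0 <= 1 - t by rewrite subr_ge0.
pose m := measure_add (mscale (NngNum t1') p) (mscale (NngNum t0) nu).
have [|q Hq] := @probability_of_measure R m.
  transitivity (mscale (NngNum t1') p setT + mscale (NngNum t0) nu setT)%E; first exact: measure_addE.
  by rewrite /mscale/= !probability_setT !mule1 -EFinD subrK.
exists q => f mf f0; rewrite Hq ge0_integral_measure_add//.
by rewrite !ge0_integral_mscale.
Qed.

Lemma probability_empirical (R : realType) (n : nat) (a : 'I_n.+1 -> R) :
  exists q : probability (measurableTypeR R) R,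
  forall f : R -> \bar R, measurable_fun [set: R] f -> (forall x, 0 <= f x)%E ->
    (\int[q]_x f x = (n.+1%:R^-1)%:E * \sum_(i < n.+1) f (a i))%E.
Proof.
have n0 : (0 : R) <= n.+1%:R^-1 by [].
pose d (k : nat) : {measure set (measurableTypeR R) -> \bar R} :=
  dirac (a (inord k) : measurableTypeR R).
pose m := mscale (NngNum n0) (msum d n.+1).
have [|q Hq] := @probability_of_measure R m.
  rewrite /m/= /mscale/= /msum.
  under eq_bigr do rewrite /d/= diracT.
  by rewrite sumEFin -EFinM sumr_const card_ord mulVf.
exists q => f mf f0; rewrite Hq ge0_integral_mscale//= ge0_integral_measure_sum//.
congr (_ * _)%E; apply: eq_bigr => i _.
by rewrite integral_dirac// diracT mul1e inord_val.
Qed.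

Lemma probability_pushforward (R : realType) (p : probability (measurableTypeR R) R)
  (g : R -> R) : measurable_fun [set: R] g ->
  exists q : probability (measurableTypeR R) R,
  forall f : R -> \bar R, measurable_fun [set: R] f -> (forall x, 0 <= f x)%E ->
    (\int[q]_x f x = \int[p]_x f (g x))%E.
Proof.
move=> mg.
have mg' : measurable_fun setT (g : measurableTypeR R -> measurableTypeR R) by [].
pose X : {mfun measurableTypeR R >-> measurableTypeR R} :=
  HB.pack (g : measurableTypeR R -> measurableTypeR R) (isMeasurableFun.Build _ _ _ _ _ mg').
exists (distribution p X) => f mf f0.
by rewrite ge0_integral_pushforward.
Qed.

(** * Potentials and the Euler-Lagrange conditions *)

Lemma measurable_K2 (R : realType) :
  measurable_fun setT (fun z : measurableTypeR R * measurableTypeR R => K (z.1 - z.2)).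
Proof.
apply: (measurableT_comp (@measurable_K R)) => //.
exact: measurable_funB.
Qed.

Definition pot {R : realType} (p : probability (measurableTypeR R) R) (x : R) : \bar R :=
  (\int[p]_y K (x - y))%E.

Lemma pot_ge0 (R : realType) (p : probability (measurableTypeR R) R) (x : R) :
  (0 <= pot p x)%E.
Proof. by apply: integral_ge0 => y _; exact: K_ge0. Qed.

Lemma measurable_pot (R : realType) (p : probability (measurableTypeR R) R) :
  measurable_fun [set: R] (pot p).
Proof.
apply: (measurable_fun_fubini_tonelli_F
  (fun z : measurableTypeR R * measurableTypeR R => K (z.1 - z.2))).
- exact: measurable_K2.
- by move=> z; exact: K_ge0.
Qed.

Lemma measurable_K_subr (R : realType) (x : R) :
  measurable_fun [set: R] (fun y : R => K (x - y)).
Proof.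
apply: (measurableT_comp (@measurable_K R)) => //.
exact: measurable_funB.
Qed.

Lemma pot_tonelli (R : realType) (p nu : probability (measurableTypeR R) R) :
  (\int[nu]_x pot p x = \int[p]_x pot nu x)%E.
Proof.
rewrite /pot (fubini_tonelli (m1 := nu) (m2 := p)
  (fun z : measurableTypeR R * measurableTypeR R => K (z.1 - z.2))); last 2 first.
- exact: measurable_K2.
- by move=> z; exact: K_ge0.
by apply: eq_integral => x _; apply: eq_integral => y _; exact: K_subC.
Qed.

(* The scale-free continuum energy: I_n^C (n p) = n^2 * energy Q (beta / n) p. *)
Definition energy {R : realType} (Q : R -> R) (b : R)
    (p : probability (measurableTypeR R) R) : \bar R :=
  (\int[p]_x pot p x + (2 * b)%:E * \int[p]_x (Q x)%:E)%E.

Definition energy_minimizer {R : realType} (Q : R -> R) (b : R)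
    (p : probability (measurableTypeR R) R) : Prop :=
  forall nu : probability (measurableTypeR R) R, (energy Q b p <= energy Q b nu)%E.

(** Minimality against the mixture (1 - t) p + t nu, divided by 2t, gives the inequality up to t ((W
    + W') / 2 - X), which vanishes with t. Only [nu] of finite energy are allowed, so point masses
    are excluded. *)
Lemma first_variation (R : realType) (Q : R -> R) (b : R)
    (p nu : probability (measurableTypeR R) R) (W q W' q' X : R) :
  measurable_fun [set: R] Q -> (forall x, 0 <= Q x) -> 0 < b ->
  energy_minimizer Q b p ->
  (\int[p]_x pot p x = W%:E)%E -> (\int[p]_x (Q x)%:E = q%:E)%E ->
  (\int[nu]_x pot nu x = W'%:E)%E -> (\int[nu]_x (Q x)%:E = q'%:E)%E ->
  (\int[nu]_x pot p x = X%:E)%E ->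
  W + b * q <= X + b * q'.
Proof.
move=> mQ Q0 b0 pmin pW pq nW nq pX.
have nX : (\int[p]_x pot nu x = X%:E)%E by rewrite pot_tonelli.
have mQE : measurable_fun [set: R] (EFin \o Q) by apply/measurable_EFinP.
have key (t : R) : 0 < t -> t <= 1 -> W + b * q <= X + b * q' + t * ((W + W') / 2 - X).
  move=> t0 t1; have t01 : 0 <= t <= 1 by rewrite ltW.
  have [r Hr] := probability_mix p nu t01.
  have e1 x : (pot r x = (1 - t)%:E * pot p x + t%:E * pot nu x)%E.
    rewrite /pot Hr//; first exact: measurable_K_subr.
    by move=> y; exact: K_ge0.
  have e2 : (\int[r]_x pot r x = ((1 - t) * ((1 - t) * W + t * X) + t * ((1 - t) * X + t * W'))%:E)%E.
    rewrite Hr; [|exact: measurable_pot|by move=> x; exact: pot_ge0].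
    have eq_mix (m : probability (measurableTypeR R) R) : (\int[m]_x pot r x =
       (1 - t)%:E * \int[m]_x pot p x + t%:E * \int[m]_x pot nu x)%E.
      under eq_integral do rewrite e1.
      rewrite ge0_integralD//; last 4 first.
      - by move=> x _; rewrite mule_ge0 ?pot_ge0// lee_fin subr_ge0.
      - by apply: measurable_funeM; exact: measurable_pot.
      - by move=> x _; rewrite mule_ge0 ?pot_ge0// lee_fin ltW.
      - by apply: measurable_funeM; exact: measurable_pot.
      rewrite !ge0_integralZl//; try exact: measurable_pot.
      - by move=> x _; exact: pot_ge0.
      - by rewrite lee_fin ltW.
      - by move=> x _; exact: pot_ge0.
      - by rewrite lee_fin subr_ge0.
    by rewrite (eq_mix p) (eq_mix nu) pW nX pX nW !(EFinD, EFinM).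
  have := pmin r; rewrite /energy pW pq e2 Hr//.
  rewrite pq nq -!(EFinM, EFinD) lee_fin => h.
  have : 0 <= t * (X + b * q' + t * ((W + W') / 2 - X) - (W + b * q)) by lra.
  by rewrite pmulr_rge0// subr_ge0.
rewrite leNgt; apply/negP => lt.
set D := (W + W') / 2 - X in key.
set g := W + b * q - (X + b * q').
have g0 : 0 < g by rewrite /g; lra.
(* This makes t |D| at most g / 2, whereas [key] would require g <= t D. *)
pose t := g / (g + `|D| + 1) / 2.
have d0 : 0 < g + `|D| + 1 by have := normr_ge0 D; lra.
have t0 : 0 < t by rewrite !divr_gt0.
have tg : t * (g + `|D| + 1) = g / 2 by rewrite /t; field; rewrite gt_eqF.
have nD := normr_ge0 D; have Dn := ler_norm D.
have t1 : t <= 1 by nra.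
have := key t t0 t1; rewrite -/g.
have : t * D <= t * `|D| by rewrite ler_pM2l.
rewrite /g in tg *; nra.
Qed.

Definition gpot {R : realType} (r : R) (p : probability (measurableTypeR R) R) (x : R) : \bar R :=
  (\int[p]_y gam r (x - y))%E.

Lemma measurable_gam_subr (R : realType) (r x : R) :
  measurable_fun [set: R] (fun y : R => gam r (x - y)).
Proof.
apply: (measurableT_comp (@measurable_gam R r)) => //.
exact: measurable_funB.
Qed.

Lemma gpot_ge0 (R : realType) (r : R) (p : probability (measurableTypeR R) R) (x : R) :
  0 <= r -> (0 <= gpot r p x)%E.
Proof. by move=> r0; apply: integral_ge0 => y _; exact: gam_ge0. Qed.

Lemma gpot_le_pot (R : realType) (r : R) (p : probability (measurableTypeR R) R) (x : R) :
  0 <= r <= 1 -> (gpot r p x <= pot p x)%E.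
Proof.
move=> r01; have r0 : 0 <= r by case/andP: r01.
apply: ge0_le_integral => //.
- by move=> y _; exact: gam_ge0.
- exact: measurable_gam_subr.
- exact: measurable_K_subr.
- by move=> y _; exact: gam_le_K.
Qed.

(** Dominated convergence under K (x - y). Its integrability also rules out an atom at x, the only
    point where the kernels [gam] stay infinite. *)
Lemma gpot_cvg0 (R : realType) (p : probability (measurableTypeR R) R) (x : R) :
  (pot p x < +oo)%E -> gpot (k.+1%:R^-1) p x @[k --> \oo] --> 0%E.
Proof.
move=> px.
have mK := measurable_K_subr x.
have ig : p.-integrable [set: R] (fun y => K (x - y)).
  apply/integrableP; split; first exact: mK.
  by under eq_integral do rewrite (gee0_abs (K_ge0 _)).
have r01 (k : nat) : 0 <= (k.+1%:R^-1 : R) <= 1.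
  by rewrite invr_ge0 ler0n/= invf_le1// ler1n.
have f_f : {ae p, forall y, [set: R] y ->
    (fun k : nat => gam k.+1%:R^-1 (x - y)) @ \oo --> (cst 0%E : R -> \bar R) y}.
  apply: filterS (integrable_ae measurableT ig) => y /(_ I) Kf _.
  have xy : x - y != 0 by apply: contraTneq Kf => ->; rewrite K_0.
  have -> : (fun k : nat => gam k.+1%:R^-1 (x - y)) =
      (fun k : nat => (ln (1 + k.+1%:R^-1 * kap `|x - y|))%:E).
    by apply/funext => k; rewrite gamE.
  apply: cvg_EFin; first exact: nearW.
  have -> : (fine \o (fun k : nat => (ln (1 + k.+1%:R^-1 * kap `|x - y|))%:E)) =
     (@ln R) \o (fun k : nat => 1 + k.+1%:R^-1 * kap `|x - y|) by [].
  rewrite -(@ln1 R); apply: (@cvg_comp _ _ _ _ _ _ (nbhs (1 : R))); last first.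
    exact: continuous_ln.
  have h : (fun k : nat => 1 + k.+1%:R^-1 * kap `|x - y|) @ \oo --> 1 + 0 * kap `|x - y|.
    by apply: cvgD; [exact: cvg_cst|apply: cvgMl; exact: cvg_harmonic].
  by rewrite mul0r addr0 in h.
have f_g : {ae p, forall y (k : nat), [set: R] y -> (`|gam k.+1%:R^-1 (x - y)| <= K (x - y))%E}.
  apply: nearW => y k _; rewrite gee0_abs.
    exact: gam_le_K.
  by apply: gam_ge0; case/andP: (r01 k).
have [_ _] := @dominated_convergence _ _ R p [set: R] measurableT
  (fun k y => gam k.+1%:R^-1 (x - y)) (cst 0%E) (fun y => K (x - y))
  (fun k => measurable_gam_subr _ x) (measurable_cst _) f_f ig f_g.
by rewrite integral0.
Qed.

(** The pointwise inequality [gam_half_avg] integrated against p; Tonelli turns the averaged kernel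
    into the average of [pot p], on which the first variation has a hold. *)
Lemma gpot_step (R : realType) (p : probability (measurableTypeR R) R) (a b : R) (ab : a < b)
    (c x : R) : 0 < c <= 1 / 300 -> b - a <= 1 / 8 -> x = a \/ x = b ->
  (gpot ((b - a) / 2) p x + c%:E * \int[uniform_prob ab]_u pot p u <=
   (1 - c)%:E * gpot (b - a) p x + c%:E * pot p x)%E.
Proof.
move=> c300 ba8 xab; have r0 : 0 < b - a by rewrite subr_gt0.
have c0 : 0 < c by case/andP: c300.
have c1 : 0 < 1 - c by lra.
have mpu : measurable_fun [set: R] (pot (uniform_prob ab)) by exact: measurable_pot.
have puE y : (pot (uniform_prob ab) y = \int[uniform_prob ab]_u K (u - y))%E.
  by apply: eq_integral => u _; exact: K_subC.
rewrite pot_tonelli /gpot /pot -/(pot _ _).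
rewrite -!ge0_integralZl//; last first.
all: try exact: measurable_gam_subr.
all: try exact: measurable_K_subr.
all: try (by move=> y _; exact: K_ge0).
all: try (by move=> y _; apply: gam_ge0; rewrite ?ltW ?divr_gt0).
all: try (by rewrite lee_fin ltW).
all: try (by move=> y _; exact: pot_ge0).
have mg1 := measurable_gam_subr ((b - a) / 2) x.
have mg2 := measurable_gam_subr (b - a) x.
have mK := measurable_K_subr x.
have h1 y : (0 <= gam ((b - a) / 2) (x - y))%E by apply: gam_ge0; rewrite ltW// divr_gt0.
have h2 y : (0 <= gam (b - a) (x - y))%E by apply: gam_ge0; rewrite ltW.
rewrite -!ge0_integralD//; last first.
all: try (by apply: measurable_funeM).
all: try (by move=> y _; rewrite mule_ge0 ?K_ge0 ?pot_ge0// lee_fin ltW).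
apply: ge0_le_integral => //.
- by move=> y _; rewrite adde_ge0// mule_ge0 ?pot_ge0// lee_fin ltW.
- by apply: emeasurable_funD => //; exact: measurable_funeM.
- by apply: emeasurable_funD => //; exact: measurable_funeM.
- by move=> y _; have := gam_half_avg ab y c300 ba8 xab; rewrite -puE.
Qed.

Lemma uniform_prob_cst (R : realType) (a b : R) (ab : a < b) (Q : R -> R) (m : R) :
  measurable_fun [set: R] Q -> (forall x, 0 <= Q x) ->
  (forall u, a <= u <= b -> Q u <= m) ->
  (\int[uniform_prob ab]_u (Q u)%:E <= m%:E)%E.
Proof.
move=> mQ Q0 Qm; have ba0 : 0 < b - a by rewrite subr_gt0.
have mQE : measurable_fun [set: R] (EFin \o Q) by apply/measurable_EFinP.
rewrite integral_uniform//.
apply: (@le_trans _ _ (((b - a)^-1)%:E * \int[lebesgue_measure]_(u in `[a, b]) m%:E)%E).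
  rewrite lee_pmul2l ?lte_fin ?invr_gt0//; apply: ge0_le_integral => //.
  all: try exact: measurable_funTS.
  by move=> u _; rewrite lee_fin.
by rewrite integral_cst_itv// -EFinM lee_fin mulrCA mulVf ?mulr1// gt_eqF.
Qed.

Lemma pot_uniform_le (R : realType) (a b : R) (ab : a < b) (y : R) :
  (pot (uniform_prob ab) y <= (12 / (b - a))%:E)%E.
Proof.
have -> : pot (uniform_prob ab) y = (\int[uniform_prob ab]_u K (u - y))%E.
  by apply: eq_integral => u _; exact: K_subC.
exact: avg_K_le_long.
Qed.

Lemma integral_le_cst (R : realType) (p : probability (measurableTypeR R) R)
  (f : R -> \bar R) (c : R) : measurable_fun [set: R] f -> (forall x, 0 <= f x)%E ->
  (forall x, f x <= c%:E)%E -> (\int[p]_x f x <= c%:E)%E.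
Proof.
move=> mf f0 fc.
have -> : c%:E = (\int[p]_x c%:E)%E.
  by rewrite (integral_cst p)//= probability_setT mule1.
by apply: ge0_le_integral => //; move=> x _; exact: le_trans (f0 x) (fc x).
Qed.

Lemma ge0_fin (R : realType) (x : \bar R) (c : R) : (0 <= x)%E -> (x <= c%:E)%E ->
  exists y : R, [/\ x = y%:E, 0 <= y & y <= c].
Proof.
move=> x0 xc; have xf : x \is a fin_num.
  by rewrite ge0_fin_numE// (le_lt_trans xc)// ltry.
by exists (fine x); rewrite -!lee_fin fineK.
Qed.

Lemma energy_fin (R : realType) (Q : R -> R) (b : R)
    (p : probability (measurableTypeR R) R) (E : R) :
  (forall x, 0 <= Q x) -> 0 < b -> (energy Q b p <= E%:E)%E ->
  exists W q : R, [/\ (\int[p]_x pot p x = W%:E)%E, (\int[p]_x (Q x)%:E = q%:E)%E,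
    0 <= W, 0 <= q & W + 2 * b * q <= E].
Proof.
move=> Q0 b0; rewrite /energy => h.
have h1 : (0 <= \int[p]_x pot p x)%E by apply: integral_ge0 => x _; exact: pot_ge0.
have h2 : (0 <= \int[p]_x (Q x)%:E)%E by apply: integral_ge0 => x _; rewrite lee_fin.
have b20 : 0 < 2 * b by lra.
have h3 : (0 <= (2 * b)%:E * \int[p]_x (Q x)%:E)%E by rewrite mule_ge0// lee_fin ltW.
have [W [eW W0 _]] := ge0_fin h1 (le_trans (leeDl _ h3) h).
have [v [ev v0 _]] := ge0_fin h3 (le_trans (leeDr _ h1) h).
have hq : (\int[p]_x (Q x)%:E <= (v / (2 * b))%:E)%E.
  by rewrite EFinM lee_pdivlMr// muleC ev.
have [q [eq q0 _]] := ge0_fin h2 hq.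
exists W, q; split=> //.
by rewrite eW eq -EFinM -EFinD lee_fin in h.
Qed.

(** The first variation against the uniform measure of the segment, whose potential is bounded, so
    that all the energies involved are finite. *)
Lemma avg_pot_ge (R : realType) (Q : R -> R) (b : R)
    (p : probability (measurableTypeR R) R) (W q : R) (u v : R) (uv : u < v) (m : R) :
  measurable_fun [set: R] Q -> (forall x, 0 <= Q x) -> 0 < b ->
  energy_minimizer Q b p ->
  (\int[p]_x pot p x = W%:E)%E -> (\int[p]_x (Q x)%:E = q%:E)%E ->
  (forall z, u <= z <= v -> Q z <= m) ->
  ((W + b * q - b * m)%:E <= \int[uniform_prob uv]_x pot p x)%E.
Proof.
move=> mQ Q0 b0 pmin pW pq Qm.
pose c := 12 / (v - u).
have [W' [eW' _ _]] : exists y : R, [/\ (\int[uniform_prob uv]_x pot (uniform_prob uv) x)%E = y%:E, 0 <= y & y <= c].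
  apply: ge0_fin; first by apply: integral_ge0 => x _; exact: pot_ge0.
  apply: integral_le_cst; [exact: measurable_pot|exact: pot_ge0|exact: pot_uniform_le].
have [X [eX _ _]] : exists y : R, [/\ (\int[uniform_prob uv]_x pot p x)%E = y%:E, 0 <= y & y <= c].
  apply: ge0_fin; first by apply: integral_ge0 => x _; exact: pot_ge0.
  rewrite pot_tonelli.
  apply: integral_le_cst; [exact: measurable_pot|exact: pot_ge0|exact: pot_uniform_le].
have [q' [eq' _ q'm]] : exists y : R, [/\ (\int[uniform_prob uv]_x (Q x)%:E)%E = y%:E, 0 <= y & y <= m].
  apply: ge0_fin; first by apply: integral_ge0 => x _; rewrite lee_fin.
  exact: uniform_prob_cst.
have h := first_variation mQ Q0 b0 pmin pW pq eW' eq' eX.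
rewrite eX lee_fin; have : b * q' <= b * m by rewrite ler_pM2l.
lra.
Qed.

Lemma gpot_step_le (R : realType) (Q : R -> R) (b : R)
    (p : probability (measurableTypeR R) R) (W q : R) (u v : R) (c x m V G : R) :
  measurable_fun [set: R] Q -> (forall x, 0 <= Q x) -> 0 < b ->
  energy_minimizer Q b p ->
  (\int[p]_x pot p x = W%:E)%E -> (\int[p]_x (Q x)%:E = q%:E)%E ->
  u < v -> 0 < c <= 1 / 300 -> v - u <= 1 / 8 -> x = u \/ x = v ->
  (forall z, u <= z <= v -> Q z <= m) ->
  (pot p x <= V%:E)%E -> (gpot (v - u) p x <= G%:E)%E ->
  (gpot ((v - u) / 2) p x <= ((1 - c) * G + c * (V - (W + b * q) + b * m))%:E)%E.
Proof.
move=> mQ Q0 b0 pmin pW pq uv c300 vu8 xuv Qm pV gG.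
have c0 : 0 < c by case/andP: c300.
have c1 : 0 < 1 - c by lra.
have h := gpot_step p uv c300 vu8 xuv.
have h2 := avg_pot_ge uv mQ Q0 b0 pmin pW pq Qm.
have h3 : ((1 - c)%:E * gpot (v - u) p x + c%:E * pot p x <= ((1 - c) * G + c * V)%:E)%E.
  by rewrite [leRHS]EFinD [((1 - c) * G)%:E]EFinM [(c * V)%:E]EFinM; apply: leeD; rewrite lee_pmul2l// lte_fin.
have h4 : (gpot ((v - u) / 2) p x + (c * (W + b * q - b * m))%:E <= ((1 - c) * G + c * V)%:E)%E.
  apply: le_trans h3; apply: le_trans h; rewrite leeD2l// EFinM lee_pmul2l//.
have -> : (1 - c) * G + c * (V - (W + b * q) + b * m) = (1 - c) * G + c * V - c * (W + b * q - b * m) by ring.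
by rewrite EFinB leeBrDr.
Qed.

(* The first variation only gives this inequality on average over intervals;
   the vanishing of gpot at small scales makes it pointwise. *)
Lemma euler_lagrange_ge (R : realType) (Q : R -> R) (b : R)
    (p : probability (measurableTypeR R) R) (W q : R) (x : R) :
  continuous Q -> (forall x, 0 <= Q x) -> 0 < b ->
  energy_minimizer Q b p ->
  (\int[p]_x pot p x = W%:E)%E -> (\int[p]_x (Q x)%:E = q%:E)%E ->
  ((W + b * q)%:E <= pot p x + (b * Q x)%:E)%E.
Proof.
move=> cQ Q0 b0 pmin pW pq.
have mQ : measurable_fun [set: R] Q by exact: continuous_measurable_fun.
have [xoo|xoo] := eqVneq (pot p x) +oo%E; first by rewrite xoo addye// leey.
have pxf : pot p x \is a fin_num by rewrite ge0_fin_numE ?pot_ge0// lt_neqAle xoo leey.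
rewrite -(fineK pxf) -EFinD lee_fin; set V := fine _.
apply/ler_addgt0Pr => e e0.
have [c c300] : exists c : R, 0 < c <= 1 / 300 by exists (1 / 300); apply/andP; split; lra.
have cp : 0 < c by case/andP: c300.
have gc := gpot_cvg0 (le_lt_trans (le_refl _) (eq_ind_r (fun z => (z < +oo)%E) (ltry V) (esym (fineK pxf)))).
have e2 : 0 < c * (e / 2) by rewrite mulr_gt0// divr_gt0.
have e3 : 0 < e / 2 / b by rewrite !divr_gt0.
have /cvgrPdist_le/(_ _ e3)[d d0 Hd] := cQ x.
(* The factor c is needed because the resulting inequality is divided by c at the end; the other e /
   2 pays for the oscillation of b Q. *)
have gsmall : \forall k \near \oo, (gpot (k.+1%:R^-1) p x < (c * (e / 2))%:E)%E.
  have : nbhs 0%E [set z : \bar R | z < (c * (e / 2))%:E]%E.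
    by apply: open_nbhs_nbhs; split; [exact: open_ereal_lt_ereal|rewrite /= lte_fin].
  by move=> nb; exact: (gc _ nb).
have rsmall : \forall k \near \oo, (k.+1%:R^-1 : R) < d.
  have := @cvg_harmonic R; move=> /cvgrPdist_lt/(_ _ d0).
  by apply: filterS => k; rewrite /= sub0r normrN ger0_norm// invr_ge0.
have r8 : \forall k \near \oo, (k.+1%:R^-1 : R) < 1 / 8.
  have := @cvg_harmonic R; move=> /cvgrPdist_lt/(_ (1 / 8) ltac:(by rewrite divr_gt0)).
  by apply: filterS => k; rewrite /= sub0r normrN ger0_norm// invr_ge0.
have [k [gk rk rk8]] : exists k : nat, [/\ (gpot (k.+1%:R^-1) p x < (c * (e / 2))%:E)%E,
    (k.+1%:R^-1 : R) < d & (k.+1%:R^-1 : R) < 1 / 8].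
  near \oo => k; exists k; split; near: k; [exact: gsmall|exact: rsmall|exact: r8].
set r : R := k.+1%:R^-1 in gk rk rk8.
have r0 : 0 < r by rewrite invr_gt0.
have xr : x < x + r by rewrite ltrDl.
have xrE : x + r - x = r by ring.
have Qm z : x <= z <= x + r -> Q z <= Q x + e / 2 / b.
  move=> /andP[xz zr]; have : `|Q x - Q z| <= e / 2 / b.
    by apply: Hd; rewrite /ball_/= distrC; clear -xz zr rk; rewrite ger0_norm; lra.
  by rewrite ler_norml => /andP[]; clear; lra.
have := @gpot_step_le R Q b p W q x (x + r) c x (Q x + e / 2 / b) V (c * (e / 2))
  mQ Q0 b0 pmin pW pq xr c300.
rewrite xrE => /(_ (ltW rk8) (or_introl erefl) Qm).
rewrite fineK// => /(_ (le_refl _) (ltW gk)) h.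
have : (0 <= (1 - c) * (c * (e / 2)) + c * (V - (W + b * q) + b * (Q x + e / 2 / b))).
  by rewrite -lee_fin; apply: le_trans h; apply: gpot_ge0; rewrite ltW// divr_gt0.
have -> : b * (Q x + e / 2 / b) = b * Q x + e / 2 by field; rewrite gt_eqF.
have -> : (1 - c) * (c * (e / 2)) + c * (V - (W + b * q) + (b * Q x + e / 2)) =
  c * ((1 - c) * (e / 2) + (V - (W + b * q) + (b * Q x + e / 2))) by ring.
rewrite pmulr_rge0//; have : c * e >= 0 by rewrite mulr_ge0// ltW.
clear; lra.
Unshelve. all: by end_near. Qed.

(** The function pot p + b Q - (W + b q) is nonnegative by [euler_lagrange_ge] and its p-integral is
    0. *)
Lemma euler_lagrange_ae (R : realType) (Q : R -> R) (b : R)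
    (p : probability (measurableTypeR R) R) (W q : R) :
  continuous Q -> (forall x, 0 <= Q x) -> 0 < b ->
  energy_minimizer Q b p ->
  (\int[p]_x pot p x = W%:E)%E -> (\int[p]_x (Q x)%:E = q%:E)%E ->
  exists N : set R, [/\ measurable N, p N = 0%E &
    forall x, ~ N x -> (pot p x + (b * Q x)%:E = (W + b * q)%:E)%E].
Proof.
move=> cQ Q0 b0 pmin pW pq.
have mQ : measurable_fun [set: R] Q by exact: continuous_measurable_fun.
have mbQ : measurable_fun [set: R] (EFin \o (fun x => b * Q x)).
  by apply/measurable_EFinP; exact: measurable_funM.
pose f x := (pot p x + (b * Q x)%:E - (W + b * q)%:E)%E.
have mh : measurable_fun [set: R] (fun x => pot p x + (b * Q x)%:E)%E.
  by apply: emeasurable_funD => //; exact: measurable_pot.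
have mf : measurable_fun [set: R] f by apply: emeasurable_funB.
have h0 x := euler_lagrange_ge x cQ Q0 b0 pmin pW pq.
have f0 x : (0 <= f x)%E by rewrite /f sube_ge0.
have bQ0 x : (0 <= (b * Q x)%:E)%E by rewrite lee_fin mulr_ge0// ltW.
have ih : (\int[p]_x (pot p x + (b * Q x)%:E) = (W + b * q)%:E)%E.
  rewrite ge0_integralD//; [|by move=> x _; exact: pot_ge0|exact: measurable_pot].
  have mQE : measurable_fun [set: R] (EFin \o Q) by apply/measurable_EFinP.
  have -> : (\int[p]_x (b * Q x)%:E = b%:E * \int[p]_x (Q x)%:E)%E.
    under eq_integral do rewrite EFinM.
    apply: ge0_integralZl => //; last by rewrite lee_fin ltW.
    by move=> x _; rewrite lee_fin.
  by rewrite pW pq -EFinM -EFinD.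
have l0 : 0 <= W + b * q.
  by rewrite -lee_fin -ih; apply: integral_ge0 => x _; rewrite adde_ge0// pot_ge0.
have : (\int[p]_x f x + (W + b * q)%:E = (W + b * q)%:E)%E.
  have {1}-> : (W + b * q)%:E = (\int[p]_x (W + b * q)%:E)%E.
    by rewrite (integral_cst p)//= probability_setT mule1.
  rewrite -ge0_integralD//.
  by rewrite -ih; apply: eq_integral => x _; rewrite /f ih subeK.
move=> fi; have f00 : (\int[p]_x f x = 0)%E.
  have : (0 <= \int[p]_x f x)%E by apply: integral_ge0.
  case: (\int[p]_x f x)%E fi => [r||]//=; rewrite -EFinD => -[h] _.
  by congr (_%:E); lra.
have : (\int[p]_x `|f x| = 0)%E.
  by rewrite -f00; apply: eq_integral => x _; rewrite gee0_abs.
move/(ae_eq_integral_abs p measurableT mf) => [N [mN N0 sN]].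
exists N; split => // x Nx.
have fx0 : f x = 0%E by apply: contrapT => fx; apply: Nx; apply: sN => /= /(_ I).
by rewrite -[LHS](@subeK _ _ (W + b * q)%:E)// -/(f x) fx0 add0e.
Qed.

Lemma kr_unbounded (R : realType) (A : R) :
  exists2 d : R, 0 < d & forall x, 0 < x -> x <= d -> A <= kr x.
Proof.
exists (Num.min (1 / 4) (expR (- A) / 3)).
  by rewrite lt_min !divr_gt0 ?expR_gt0.
move=> x x0; rewrite le_min => /andP[x4 xA].
apply: le_trans (kr_ge_ln x0).
have k1 : (3 * x)^-1 <= kap x.
  have := @kap_ge_near R x (x / 2) x0 ltac:(lra) ltac:(lra).
  by have -> : 6 * (x / 2) = 3 * x by field.
have e0 := expR_gt0 A.
have k2 : expR A <= (3 * x)^-1.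
  rewrite expRN in xA; rewrite -[leLHS]invrK lef_pV2 ?posrE ?invr_gt0//; last by lra.
  by lra.
rewrite -[leLHS]expRK ler_ln ?posrE//; last by have := kap_gt0 x0; lra.
lra.
Qed.

(* A bounded Lipschitz lower bound of K; K - kd d is at most gam (4 * d). *)
Definition kd {R : realType} (d z : R) : R := kr (`|z| + d).

Lemma kd_ge0 (R : realType) (d z : R) : 0 <= kd d z.
Proof. exact: kr_ge0. Qed.

Lemma kd_le_K (R : realType) (d z : R) : 0 < d -> ((kd d z)%:E <= K z)%E.
Proof.
move=> d0; have [->|z0] := eqVneq z 0; first by rewrite K_0 leey.
have n0 : 0 < `|z| by rewrite normr_gt0.
by rewrite K_kr// lee_fin -[leRHS]kr_norm kr_nincr// lerDl ltW.
Qed.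

Lemma kd_le (R : realType) (d z : R) : 0 < d -> kd d z <= kr d.
Proof. by move=> d0; rewrite kr_nincr// lerDr. Qed.

Lemma kd_lip (R : realType) (d z z' : R) : 0 < d ->
  kd d z <= kd d z' + 2 * kap d * `|z - z'|.
Proof.
move=> d0; have zd : 0 < `|z| + d by have := normr_ge0 z; lra.
have zd' : 0 < `|z'| + d by have := normr_ge0 z'; lra.
have h := kr_tangent zd zd'; rewrite -/(kd d z) -/(kd d z') in h.
have k1 := kap_gt0 zd; have k2 : kap (`|z| + d) <= kap d by rewrite kap_nincr// lerDr.
have n : `|z'| - `|z| <= `|z - z'|.
  have := ler_dist_dist z' z; rewrite (distrC z' z) => /ler_normlP[]; lra.
have nn := normr_ge0 (z - z').
have e : `|z'| + d - (`|z| + d) = `|z'| - `|z| by ring.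
rewrite e in h.
have : kap (`|z| + d) * (`|z'| - `|z|) <= kap d * `|z - z'|.
  apply: (@le_trans _ _ (kap (`|z| + d) * `|z - z'|)).
    by rewrite ler_pM2l.
  by rewrite ler_wpM2r.
lra.
Qed.

Lemma kdN (R : realType) (d z : R) : kd d (- z) = kd d z.
Proof. by rewrite /kd normrN. Qed.

Lemma measurable_kd (R : realType) (d : R) : measurable_fun [set: R] (@kd R d).
Proof.
apply: (measurableT_comp (@measurable_kr R)) => //.
by apply: measurable_funD => //; exact: measurableT_comp.
Qed.

Lemma measurable_kd_subr (R : realType) (d x : R) :
  measurable_fun [set: R] (EFin \o (fun y : R => kd d (x - y))).
Proof.
apply/measurable_EFinP; apply: (measurableT_comp (@measurable_kd R d)) => //.
exact: measurable_funB.
Qed.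

(** Monotone convergence: [kd d z] increases to [K z] as d decreases to 0, also at z = 0 where the
    limit is infinite. *)
Lemma pot_le_kd (R : realType) (p : probability (measurableTypeR R) R) (x c : R) :
  (forall d : R, 0 < d -> d <= 1 -> (\int[p]_y (kd d (x - y))%:E <= c%:E)%E) ->
  (pot p x <= c%:E)%E.
Proof.
move=> H.
have r0 (k : nat) : 0 < (k.+1%:R^-1 : R) by rewrite invr_gt0.
have r1 (k : nat) : (k.+1%:R^-1 : R) <= 1 by rewrite invf_le1// ler1n.
have cv (z : R) : (fun k : nat => (kd (k.+1%:R^-1) z)%:E) @ \oo --> K z.
  have [->|z0] := eqVneq z 0.
    rewrite K_0; apply/cvgeryP/cvgryPge => A.
    have [d d0 Hd] := kr_unbounded A.
    have := @cvg_harmonic R; move=> /cvgrPdist_lt/(_ _ d0).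
    apply: filterS => k; rewrite /= sub0r normrN ger0_norm; last exact: ltW (r0 k).
    move=> kd'.
    rewrite /kd normr0 add0r; apply: Hd; [exact: r0|exact: ltW].
  rewrite K_kr//; apply: cvg_EFin; first exact: nearW.
  apply/cvgrPdist_le => e e0.
  have n0 : 0 < `|z| by rewrite normr_gt0.
  have k0 := kap_gt0 n0.
  have e1 : 0 < e / (2 * kap `|z|) by rewrite divr_gt0// mulr_gt0.
  have := @cvg_harmonic R; move=> /cvgrPdist_lt/(_ _ e1).
  apply: filterS => k; rewrite /= sub0r normrN ger0_norm; last exact: ltW (r0 k).
  rewrite ltr_pdivlMr; last by lra.
  move=> kd'.
  have kp := r0 k; have h1 : kd k.+1%:R^-1 z <= kr `|z| by rewrite kr_nincr// lerDl ltW.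
  have h2 : kr `|z| - 2 * kap `|z| * (`|z| + k.+1%:R^-1 - `|z|) <= kd k.+1%:R^-1 z.
    by apply: kr_tangent => //; rewrite addr_gt0.
  rewrite addrAC subrr add0r in h2.
  rewrite mulrC in kd'.
  rewrite -(kr_norm z).
  move: h1 h2 kd'; move: (kd _ z) (2 * kap `|z| / _) => u w h1 h2 wu.
  by rewrite ler_norml; apply/andP; split; lra.
have -> : pot p x = limn (fun k : nat => \int[p]_y (kd (k.+1%:R^-1) (x - y))%:E)%E.
  rewrite -monotone_convergence//.
  - by apply: eq_integral => y _; apply/esym/cvg_lim => //; exact: cv.
  - by move=> k; exact: measurable_kd_subr.
  - by move=> k y _; rewrite lee_fin kd_ge0.
  - move=> y _; apply/nondecreasing_seqP => k; rewrite lee_fin; apply: kr_nincr.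
      by rewrite ltr_wpDl.
    by rewrite lerD2l lef_pV2 ?posrE// ler_nat.
apply: lime_le; last by apply: nearW => k; exact: H.
apply: ereal_nondecreasing_is_cvgn; apply/nondecreasing_seqP => k.
apply: ge0_le_integral => //.
- by move=> y _; rewrite lee_fin kd_ge0.
- exact: measurable_kd_subr.
- exact: measurable_kd_subr.
- move=> y _; rewrite lee_fin; apply: kr_nincr; first by rewrite ltr_wpDl.
  by rewrite lerD2l lef_pV2 ?posrE// ler_nat.
Qed.

Lemma supp_dense (R : realType) (p : probability (measurableTypeR R) R) (N : set R) (x e : R) :
  measurable N -> p N = 0%E -> supp p x -> 0 < e ->
  exists z, `|x - z| < e /\ ~ N z.
Proof.
move=> mN N0 sx e0; apply: contrapT => /forallNP H.
have := sx (ball x e) (ball_open x e) (ballxx x e0).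
have : (p (ball x e) <= p N)%E.
  apply: le_measure; rewrite ?inE//; first exact: measurable_ball.
  by move=> z xz; apply: contrapT => Nz; apply: (H z); split.
by move=> h /lt_le_trans/(_ h); rewrite [X in (_ < X)%E]N0 ltxx.
Qed.

(** The equality known almost everywhere holds at points z arbitrarily close to x. The potential is
    only lower semicontinuous, which is enough for an upper bound: the Lipschitz kernels [kd d]
    transport it from z to x. *)
Lemma euler_lagrange_supp (R : realType) (Q : R -> R) (b : R)
    (p : probability (measurableTypeR R) R) (W q x : R) :
  continuous Q -> (forall x, 0 <= Q x) -> 0 < b ->
  energy_minimizer Q b p ->
  (\int[p]_x pot p x = W%:E)%E -> (\int[p]_x (Q x)%:E = q%:E)%E ->
  supp p x -> (pot p x <= (W + b * q - b * Q x)%:E)%E.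
Proof.
move=> cQ Q0 b0 pmin pW pq sx.
have [N [mN N0 EN]] := euler_lagrange_ae cQ Q0 b0 pmin pW pq.
apply: pot_le_kd => d d0 d1.
apply/lee_addgt0Pr => e e0.
have k0 := kap_gt0 d0.
have e1 : 0 < e / 2 / b by rewrite !divr_gt0.
have /cvgrPdist_le/(_ _ e1)[r r0 Hr] := cQ x.
have e2 : 0 < Num.min r (e / 2 / (2 * kap d)).
  by rewrite lt_min r0 !divr_gt0// mulr_gt0.
have [z [xz Nz]] := supp_dense mN N0 sx e2.
move: xz; rewrite lt_min => /andP[xz1 xz2].
have Qz : `|Q x - Q z| <= e / 2 / b by apply: Hr.
have pz := EN z Nz.
apply: (@le_trans _ _ (\int[p]_y (K (z - y) + (e / 2)%:E))%E).
  apply: ge0_le_integral => //.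
  - by move=> y _; rewrite lee_fin kd_ge0.
  - exact: measurable_kd_subr.
  - by apply: emeasurable_funD => //; exact: measurable_K_subr.
  - move=> y _; apply: (@le_trans _ _ ((kd d (z - y))%:E + (e / 2)%:E)%E); last first.
      by rewrite leeD2r// kd_le_K.
    rewrite -EFinD lee_fin; apply: le_trans (kd_lip (x - y) (z - y) d0) _.
    rewrite lerD2l; have -> : x - y - (z - y) = x - z by ring.
    have k2 : 0 < 2 * kap d by lra.
    by have := ltW xz2; rewrite ler_pdivlMr// mulrC.
have mKz := measurable_K_subr z.
have e20 : 0 <= e / 2 by lra.
rewrite ge0_integralD//; try by move=> y _; rewrite ?lee_fin// K_ge0.
have -> : (\int[p]_y (e / 2)%:E = (e / 2)%:E)%E.
  by rewrite (integral_cst p)//= probability_setT mule1.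
rewrite -/(pot p z).
have -> : pot p z = (W + b * q - b * Q z)%:E.
  by rewrite EFinB -pz addeK.
rewrite -!EFinD lee_fin.
move: Qz; rewrite ler_norml => /andP[_].
rewrite ler_pdivlMr// => h; lra.
Qed.

(** * The support of the equilibrium measure *)

Lemma measure_bigcup0 (R : realType) (p : probability (measurableTypeR R) R)
  (F : nat -> set R) (A : set R) : (forall k, measurable (F k)) -> measurable A ->
  (forall k, p (F k) = 0%E) -> A `<=` \bigcup_k F k -> p A = 0%E.
Proof.
move=> mF mA F0 AF; apply/eqP; rewrite -measure_le0.
apply: (le_trans (@measure_sigma_subadditive _ _ _ p _ _ mF mA AF)).
by rewrite eseries0// => k _ _; exact: F0.
Qed.

(** The first point of the support to the right of c, obtained as the supremum of the t for which
    [c, t[ is null. *)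
Lemma supp_right (R : realType) (p : probability (measurableTypeR R) R) (c : R) :
  (0 < p `[c, +oo[%classic)%E ->
  exists s, [/\ c <= s, supp p s & p `[c, s[%classic = 0%E].
Proof.
move=> pc.
pose A := [set t | c <= t /\ p `[c, t[%classic = 0%E].
have Ac : A c by split => //; rewrite set_itvco0.
have mono u v : u <= v -> p `[c, v[%classic = 0%E -> p `[c, u[%classic = 0%E.
  move=> uv pv; apply/eqP; rewrite -measure_le0 -pv; apply: le_measure; rewrite ?inE//.
  by move=> z /=; rewrite !in_itv/= => /andP[-> zu]; exact: lt_le_trans uv.
have [k Hk] : exists k : nat, p `[c, c + k%:R[%classic != 0%E.
  apply: contrapT => /forallNP H; move: pc.
  rewrite (@measure_bigcup0 R p (fun k : nat => `[c, c + k%:R[%classic))// ?ltxx//.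
  - by move=> k; apply/eqP; rewrite -[_ == _]negbK; apply/negP/H.
  - move=> z /=; rewrite in_itv/= andbT => cz.
    exists (Num.trunc (z - c)).+1 => //=; rewrite in_itv/= cz/= -ltrBlDl.
    exact: truncnS_gt.
have Aub : ubound A (c + k%:R).
  move=> t [ct pt]; rewrite leNgt; apply/negP => kt.
  by move/eqP : Hk; apply; exact: mono (ltW kt) pt.
have Asup : has_sup A by split; [exists c|exists (c + k%:R)].
pose s := sup A.
have cs : c <= s by exact: ub_le_sup Asup.2 _ Ac.
exists s; split => //.
- move=> U oU Us.
  have [e e0 He] : exists2 e, 0 < e & ball s e `<=` U.
    by have /nbhs_ballP[e e0 He] := oU _ Us; exists e.
  rewrite lt_neqAle measure_ge0 andbT; apply/eqP => /esym pU.
  have mU : measurable U by exact: open_measurable.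
  have [t [ct pt] st] := sup_adherent e0 Asup.
  (* If U were null, [c, s + e / 2[ would be covered by a null [c, t[ and U, against the choice of
     s. *)
  have : A (s + e / 2).
    split; first by lra.
    apply/eqP; rewrite -measure_le0.
    apply: (@le_trans _ _ (p `[c, t[%classic + p U)%E); last by rewrite pt pU adde0.
    apply: le_trans (measureU2 _ _ _) => //.
    apply: le_measure; rewrite ?inE//; first exact: measurableU.
    move=> z /=; rewrite !in_itv/= => /andP[cz zs].
    have [zt|tz] := ltP (z : R) t; first by left; apply/andP; split.
    right; apply: He; rewrite /ball/= ltr_norml; apply/andP; split; rewrite -/s in st; lra.
  by move=> /(ub_le_sup Asup.2); rewrite -/s; lra.
- apply: (@measure_bigcup0 R p (fun k : nat => `[c, s - k.+1%:R^-1[%classic)) => //.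
  + move=> j; have j0 : 0 < (j.+1%:R^-1 : R) by rewrite invr_gt0.
    have [t [ct pt] st] := sup_adherent j0 Asup.
    by apply: mono pt; exact: ltW.
  + move=> z /=; rewrite in_itv/= => /andP[cz zs].
    exists (Num.trunc ((s - z)^-1)) => //=; rewrite in_itv/= cz/= ltrBrDl -ltrBrDr.
    rewrite invf_plt ?posrE ?subr_gt0// truncnS_gt//.
Qed.

(** [supp_right] for the image of p under x -> -x. *)
Lemma supp_left (R : realType) (p : probability (measurableTypeR R) R) (c : R) :
  (0 < p `]-oo, c]%classic)%E ->
  exists s, [/\ s <= c, supp p s & p `]s, c]%classic = 0%E].
Proof.
move=> pc.
have mN : measurable_fun [set: R] (-%R : R -> R) by [].
have mN' : measurable_fun setT (-%R : measurableTypeR R -> measurableTypeR R) by [].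
pose X : {mfun measurableTypeR R >-> measurableTypeR R} :=
  HB.pack (-%R : measurableTypeR R -> measurableTypeR R) (isMeasurableFun.Build _ _ _ _ _ mN').
pose q : probability (measurableTypeR R) R := distribution p X.
have qE A : q A = p [set x | A (- x)] by [].
have [s [cs ss qs]] : exists s, [/\ - c <= s, supp q s & q `[- c, s[%classic = 0%E].
  apply: supp_right; rewrite qE; move: pc; congr (_ < p _)%E.
  by apply/seteqP; split => x /=; rewrite !in_itv/= ?andbT lerN2.
exists (- s); split; first by lra.
- move=> U oU Us.
  have oN : open [set x : R | U (- x)].
    by apply: (open_comp _ oU) => x _; exact: opp_continuous.
  have := ss _ oN; rewrite /= qE => /(_ Us); congr (_ < p _)%E.
  by apply/seteqP; split => x /=; rewrite opprK.
- move: qs; rewrite qE => <-; congr (p _).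
  by apply/seteqP; split => x /=; rewrite !in_itv/= => /andP[h1 h2]; apply/andP; split; lra.
Qed.

(** On the support only the upper bound is recorded; the clause before it supplies the reverse
    inequality. *)
Definition euler_lagrange {R : realType} (Q : R -> R) (b : R)
    (p : probability (measurableTypeR R) R) (lam : R) : Prop :=
  [/\ continuous Q, forall x, 0 <= Q x, 0 < b,
      forall x, (lam%:E <= pot p x + (b * Q x)%:E)%E &
      forall x, supp p x -> (pot p x <= (lam - b * Q x)%:E)%E].

(** Midpoint convexity with an explicit gain: using the tangent at d - h / 2 in place of the one at
    d on the way to d - h brings in the strict decrease of [kap]. *)
Lemma kr_gap (R : realType) (d h : R) : 0 < h -> h < d ->
  kr d + h / 2 * (kap (d - h / 2) - kap d) <= 2^-1 * kr (d - h) + 2^-1 * kr (d + h).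
Proof.
move=> h0 hd.
have d0 : 0 < d by lra. have d1 : 0 < d - h / 2 by lra.
have d2 : 0 < d - h by lra. have d3 : 0 < d + h by lra.
have t1 := kr_tangent d0 d3; have t2 := kr_tangent d1 d2; have t3 := kr_tangent d0 d1.
have e1 : d + h - d = h by ring.
have e2 : d - h - (d - h / 2) = - (h / 2) by field.
have e3 : d - h / 2 - d = - (h / 2) by ring.
rewrite e1 in t1; rewrite e2 in t2; rewrite e3 in t3.
lra.
Qed.

Lemma K_gap (R : realType) (d h : R) : 0 < h -> h <= `|d| ->
  (K d + (h / 2 * (kap `| `|d| - h / 2 | - kap `|d|))%:E <=
   2^-1%:E * K (d - h) + 2^-1%:E * K (d + h))%E.
Proof.
move=> h0 hd.
have i2 : (0 < (2^-1 : R)%:E)%E by rewrite lte_fin.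
have [eh|] := eqVneq `|d| h.
  have : d = h \/ d = - h by case: (ger0P d) eh => _ <-; [left|right; rewrite opprK].
  case=> ->.
    by rewrite subrr K_0 gt0_muley// addye ?leey// gt_eqF// (lt_le_trans ltNy0)// mule_ge0// K_ge0.
  by rewrite addNr K_0 gt0_muley// addey ?leey// gt_eqF// (lt_le_trans ltNy0)// mule_ge0// K_ge0.
move=> hne; have hd' : h < `|d| by rewrite lt_neqAle eq_sym hne.
have d0 : d != 0 by rewrite -normr_gt0 (lt_trans h0).
have key : kr d + h / 2 * (kap `| `|d| - h / 2 | - kap `|d|) <=
    2^-1 * kr (d - h) + 2^-1 * kr (d + h).
  rewrite [ `| _ - _ |]ger0_norm; last by lra.
  apply: le_trans (_ : _ <= 2^-1 * kr (`|d| - h) + 2^-1 * kr (`|d| + h)) _.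
    by rewrite -(kr_norm d); exact: kr_gap.
  case: (ger0P d) => _; first by [].
  rewrite addrC -(krN (- d - h)) -(krN (- d + h)) !opprD !opprK.
  by rewrite (addrC _ (2^-1 * _)) lexx.
rewrite !K_kr//.
- apply: contraTneq hd' => /eqP; rewrite addr_eq0 => /eqP ->.
  by rewrite normrN gtr0_norm// ltxx.
- apply: contraTneq hd' => /eqP; rewrite subr_eq0 => /eqP ->.
  by rewrite gtr0_norm// ltxx.
Qed.

(** At the midpoint m of a gap the kernel is strictly convex as seen from all the mass, so pot p m
    lies strictly below the mean of the potentials at u and v. With Q midpoint convex, the
    Euler-Lagrange bounds at u and v then contradict the one at m. *)
Lemma supp_no_gap (R : realType) (Q : R -> R) (b : R)
    (p : probability (measurableTypeR R) R) (lam u v : R) :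
  euler_lagrange Q b p lam ->
  (forall x y, Q ((x + y) / 2) <= (Q x + Q y) / 2) ->
  u < v -> supp p u -> supp p v -> p `]u, v[%classic = 0%E -> False.
Proof.
move=> [cQ Q0 b0 EL1 EL2] Qc uv su sv puv.
pose m := (u + v) / 2; pose h := (v - u) / 2.
have h0 : 0 < h by rewrite /h; lra.
(* The gain of [K_gap], set to 0 in the null gap where that lemma does not apply. The inner absolute
   value changes nothing for |m - y| >= h and gives the form covered by [measurable_kap]. *)
pose s y := if `|m - y| < h then 0 else
  h / 2 * (kap `| `|m - y| - h / 2 | - kap `|m - y|).
have s_gt0 y : h <= `|m - y| -> 0 < s y.
  move=> hy; rewrite /s ifF; last by apply/negbTE; rewrite -leNgt.
  apply: mulr_gt0; first by lra.
  rewrite subr_gt0 [ `| `|_| - _ |]ger0_norm; last by lra.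
  by apply: kap_decr; lra.
have s_ge0 y : 0 <= s y.
  have [/s_gt0/ltW//|hy] := leP h `|m - y|.
  by rewrite /s hy.
have mmy : measurable_fun [set: R] (fun y : R => `|m - y|).
  by apply: measurableT_comp => //; exact: measurable_funB.
have ms : measurable_fun [set: R] (EFin \o s).
  apply/measurable_EFinP; apply: measurable_fun_ifT.
  - exact: measurable_fun_ltr.
  - exact: measurable_cst.
  - apply: measurable_funM => //; apply: measurable_funB.
      apply: (measurableT_comp (@measurable_kap R)) => //.
      exact: measurable_funB.
    have -> : (fun y : R => kap `|m - y|) = (fun z : R => kap `|z|) \o (fun y => m - y) by [].
    apply: (measurableT_comp (@measurable_kap R)) => //.
    exact: measurable_funB.
have Vu := EL2 u su; have Vv := EL2 v sv; have Vm := EL1 m.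
have i2 : (0 <= (2^-1 : R)%:E)%E by rewrite lee_fin.
have mKu := measurable_K_subr u; have mKv := measurable_K_subr v.
have mKm := measurable_K_subr m.
have ineq : (\int[p]_y (K (m - y) + (s y)%:E) <=
   \int[p]_y (2^-1%:E * K (u - y) + 2^-1%:E * K (v - y)))%E.
  apply: ae_ge0_le_integral => //.
  - by move=> y _; rewrite adde_ge0 ?K_ge0// lee_fin.
  - by apply: emeasurable_funD.
  - by move=> y _; rewrite adde_ge0// mule_ge0// K_ge0.
  - by apply: emeasurable_funD; exact: measurable_funeM.
  - exists `]u, v[%classic; split => // y /= /not_implyP[_]; apply: contra_notP.
    rewrite in_itv/= => /negP; rewrite negb_and -!leNgt => hy.
    have hmy : h <= `|m - y|.
      by rewrite /h /m; clear -uv hy; case/orP: hy => hy; [rewrite ger0_norm|rewrite ler0_norm]; lra.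
    have := K_gap h0 hmy.
    have -> : m - y - h = u - y by rewrite /m /h; field.
    have -> : m - y + h = v - y by rewrite /m /h; field.
    by rewrite /s ifF//; apply/negbTE; rewrite -leNgt.
have K0u y : (0 <= 2^-1%:E * K (u - y))%E by rewrite mule_ge0// K_ge0.
have K0v y : (0 <= 2^-1%:E * K (v - y))%E by rewrite mule_ge0// K_ge0.
rewrite ge0_integralD// in ineq; try (by move=> y _; rewrite ?lee_fin// K_ge0).
rewrite [leRHS]ge0_integralD// in ineq; try exact: measurable_funeM.
rewrite !ge0_integralZl// in ineq; try by move=> y _; exact: K_ge0.
rewrite -/(pot p u) -/(pot p v) -/(pot p m) in ineq.
have s0 : (0 < \int[p]_y (s y)%:E)%E.
  apply: (@integral_gt0 _ p (EFin \o s) `]u, v[%classic) => //.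
  move=> y; rewrite /= in_itv/= => /negP; rewrite negb_and -!leNgt => hy.
  rewrite lte_fin; apply: s_gt0.
  by rewrite /h /m; clear -uv hy; case/orP: hy => hy; [rewrite ger0_norm|rewrite ler0_norm]; lra.
have ub : (2^-1%:E * pot p u + 2^-1%:E * pot p v <= (lam - b * Q m)%:E)%E.
  apply: (@le_trans _ _ (2^-1%:E * (lam - b * Q u)%:E + 2^-1%:E * (lam - b * Q v)%:E)%E).
    by apply: leeD; apply: lee_wpmul2l.
  rewrite -!EFinM -EFinD lee_fin.
  have : b * Q m <= b * ((Q u + Q v) / 2) by rewrite ler_pM2l// Qc.
  lra.
have [V [eV _ _]] := ge0_fin (pot_ge0 p m) (le_trans (leeDl _ (ltW s0)) (le_trans ineq ub)).
rewrite eV -EFinD lee_fin in Vm.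
have := le_trans ineq ub; rewrite eV.
move: s0; case: (\int[p]_y (s y)%:E)%E => [r||] //=; rewrite lte_fin => r0.
rewrite -EFinD lee_fin; lra.
Qed.

(** The extreme points of the support are reached by starting [supp_right] and [supp_left] just
    outside [- M, M]. *)
Lemma supp_interval (R : realType) (Q : R -> R) (b : R)
    (p : probability (measurableTypeR R) R) (lam M : R) :
  euler_lagrange Q b p lam ->
  (forall x y, Q ((x + y) / 2) <= (Q x + Q y) / 2) ->
  p (~` `[- M, M]%classic) = 0%E ->
  exists s1 s2, [/\ s1 <= s2, (forall x, supp p x <-> s1 <= x <= s2) &
    p (~` `[s1, s2]%classic) = 0%E].
Proof.
move=> EL Qc pM.
have sub0 (A B : set R) : measurable A -> measurable B -> A `<=` B -> p B = 0%E -> p A = 0%E.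
  move=> mA mB AB pB; apply/eqP; rewrite -measure_le0 -pB.
  by apply: le_measure; rewrite ?inE.
have sub0U (A B C : set R) : measurable A -> measurable B -> measurable C ->
    A `<=` B `|` C -> p B = 0%E -> p C = 0%E -> p A = 0%E.
  move=> mA mB mC AB pB pC; apply: (sub0 _ (B `|` C)) => //; first exact: measurableU.
  apply/eqP; rewrite -measure_le0.
  have h : (p (B `|` C) <= p B + p C)%E by exact: measureU2.
  by apply: le_trans h _; rewrite [X in (X + _)%E]pB [X in (_ + X)%E]pC adde0.
have mC : measurable (~` `[- M, M]%classic : set R) by apply: measurableC.
have pos (A : set R) : measurable A -> `[- M, M]%classic `<=` A -> (0 < p A)%E.
  move=> mA MA; rewrite lt_neqAle measure_ge0 andbT; apply/eqP => /esym pA.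
  have : p [set: R] = 0%E.
    apply: (sub0U _ A (~` `[- M, M]%classic)) => // x _.
    by have [xM|xM] := pselect (`[- M, M]%classic x); [left; apply: MA|right].
  by rewrite probability_setT => /eqP; rewrite onee_eq0.
have [s1 [Ms1 ss1 ps1]] : exists s, [/\ - M - 1 <= s, supp p s & p `[- M - 1, s[%classic = 0%E].
  by apply: supp_right; apply: pos => // x /=; rewrite !in_itv/= andbT => /andP[h _]; lra.
have [s2 [Ms2 ss2 ps2]] : exists s, [/\ s <= M + 1, supp p s & p `]s, M + 1]%classic = 0%E].
  by apply: supp_left; apply: pos => // x /=; rewrite !in_itv/= => /andP[_ h]; lra.
have pl : p `]-oo, s1[%classic = 0%E.
  apply: (sub0U _ (~` `[- M, M]%classic) `[- M - 1, s1[%classic) => // x /=.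
  rewrite !in_itv/= => xs; have [h|h] := leP (- M - 1) (x : R); first by right; rewrite xs.
  by left; apply/negP; rewrite negb_and -!ltNge; apply/orP; left; lra.
have pr : p `]s2, +oo[%classic = 0%E.
  apply: (sub0U _ (~` `[- M, M]%classic) `]s2, M + 1]%classic) => // x /=.
  rewrite !in_itv/= andbT => xs; have [h|h] := leP (x : R) (M + 1); first by right; rewrite xs.
  by left; apply/negP; rewrite negb_and -!ltNge; apply/orP; right; lra.
have sle x : supp p x -> s1 <= x <= s2.
  move=> sx; apply/andP; split; rewrite leNgt; apply/negP => xs.
  - have := sx `]-oo, s1[%classic (@lray_open _ _ s1).
    by rewrite /= in_itv/= => /(_ xs); rewrite [X in (_ < X)%E]pl ltxx.
  - have := sx `]s2, +oo[%classic (@rray_open _ _ s2).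
    by rewrite /= in_itv/= andbT => /(_ xs); rewrite [X in (_ < X)%E]pr ltxx.
have s12 : s1 <= s2 by case/andP: (sle _ ss2).
exists s1, s2; split => //; last first.
  apply: (sub0U _ `]-oo, s1[%classic `]s2, +oo[%classic) => //; first exact: measurableC.
  move=> x /=; rewrite !in_itv/= andbT => /negP; rewrite negb_and -!ltNge.
  by case/orP; [left|right].
move=> x; split; first exact: sle.
move=> /andP[s1x xs2]; apply: contrapT => nsx.
have xs1 : s1 < x by rewrite lt_neqAle s1x andbT; apply: contra_notN nsx => /eqP <-.
have xs2' : x < s2 by rewrite lt_neqAle xs2 andbT; apply: contra_notN nsx => /eqP ->.
(* The support points nearest to x on either side bound a null gap, which [supp_no_gap] excludes. *)
have [v [xv sv pv]] : exists s, [/\ x <= s, supp p s & p `[x, s[%classic = 0%E].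
  apply: supp_right.
  have := ss2 `]x, +oo[%classic (@rray_open _ _ x).
  rewrite /= in_itv/= andbT => /(_ xs2') h; apply: lt_le_trans h _.
  apply: le_measure; rewrite ?inE//= => y /=; rewrite !in_itv/= !andbT; exact: ltW.
have [u [ux su pu]] : exists s, [/\ s <= x, supp p s & p `]s, x]%classic = 0%E].
  apply: supp_left.
  have := ss1 `]-oo, x[%classic (@lray_open _ _ x).
  rewrite /= in_itv/= => /(_ xs1) h; apply: lt_le_trans h _.
  apply: le_measure; rewrite ?inE//= => y /=; rewrite !in_itv/=; exact: ltW.
have xu' : u < x by rewrite lt_neqAle ux andbT; apply: contra_notN nsx => /eqP <-.
apply: (@supp_no_gap _ Q b p lam u v) => //; first exact: lt_le_trans xv.
apply: (sub0U _ `]u, x]%classic `[x, v[%classic) => // y /=; rewrite !in_itv/= => /andP[uy yv].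
by have [h|h] := leP (y : R) x; [left; rewrite uy|right; rewrite yv andbT ltW].
Qed.

(** All the mass is within l of s1, so the potential there is at least kr l. Read backwards, a bound
    on [lam] prevents the support from being short. *)
Lemma supp_length (R : realType) (Q : R -> R) (b : R)
    (p : probability (measurableTypeR R) R) (lam s1 s2 l : R) :
  euler_lagrange Q b p lam -> supp p s1 -> p (~` `[s1, s2]%classic) = 0%E ->
  0 < l -> s2 - s1 <= l -> kr l <= lam.
Proof.
move=> [cQ Q0 b0 EL1 EL2] ss1 ps l0 sl.
have : ((kr l)%:E <= pot p s1)%E.
  have -> : (kr l)%:E = (\int[p]_y (kr l)%:E)%E.
    by rewrite (integral_cst p)//= probability_setT mule1.
  apply: ae_ge0_le_integral => //.
  - by move=> y _; rewrite lee_fin kr_ge0.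
  - by move=> y _; exact: K_ge0.
  - exact: measurable_K_subr.
  - exists (~` `[s1, s2]%classic); split => //; first exact: measurableC.
    move=> y /= /not_implyP[_]; apply: contra_not.
    rewrite in_itv/= => /andP[h1 h2].
    have [e|ne] := eqVneq (s1 - y) 0; first by rewrite e K_0 leey.
    rewrite K_kr// lee_fin -(kr_norm (s1 - y)) kr_nincr ?normr_gt0//.
    by rewrite distrC ger0_norm; lra.
move=> h; have := le_trans h (EL2 _ ss1); rewrite lee_fin.
have : 0 <= b * Q s1 by rewrite mulr_ge0// ltW.
lra.
Qed.

(** If the support misses 0, its end point z nearest to 0 is closer than 0 to all the mass, so lam
    <= pot p 0 <= pot p z <= lam - b Q z and Q z = 0. *)
Lemma supp_meets_zero (R : realType) (Q : R -> R) (b : R)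
    (p : probability (measurableTypeR R) R) (lam s1 s2 : R) :
  euler_lagrange Q b p lam -> Q 0 = 0 -> s1 <= s2 ->
  (forall x, supp p x <-> s1 <= x <= s2) -> p (~` `[s1, s2]%classic) = 0%E ->
  exists2 z, s1 <= z <= s2 & Q z = 0.
Proof.
move=> [cQ Q0 b0 EL1 EL2] Q00 s12 sE ps.
have [z0|] := boolP (s1 <= 0 <= s2); first by exists 0.
have main z : s1 <= z <= s2 -> (forall y, s1 <= y <= s2 -> `|z - y| <= `|0 - y|) -> Q z = 0.
  move=> /[dup] /sE sz hz H; apply/eqP; rewrite eq_le Q0 andbT.
  have h : (pot p 0 <= pot p z)%E.
    apply: ae_ge0_le_integral => //.
    - by move=> y _; exact: K_ge0.
    - exact: measurable_K_subr.
    - by move=> y _; exact: K_ge0.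
    - exact: measurable_K_subr.
    - exists (~` `[s1, s2]%classic); split => //; first exact: measurableC.
      move=> y /= /not_implyP[_]; apply: contra_not.
      rewrite in_itv/= => hy.
      have [e|ne] := eqVneq (z - y) 0; first by rewrite e K_0 leey.
      have n1 : 0 < `|z - y| by rewrite normr_gt0.
      have n2 : 0 < `|0 - y| by apply: lt_le_trans n1 (H _ hy).
      by rewrite !K_kr -?normr_gt0// lee_fin -(kr_norm (z - y)) -(kr_norm (0 - y)) kr_nincr// H.
  have := le_trans h (EL2 z sz) => h'.
  have [V [eV _ _]] := ge0_fin (pot_ge0 p 0) h'.
  have := EL1 0; rewrite eV Q00 mulr0 adde0 lee_fin => h1.
  rewrite eV lee_fin in h'.
  have : b * Q z <= 0 by lra.
  by rewrite pmulr_rle0.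
rewrite negb_and -!ltNge => /orP[h|h].
- exists s1; first by rewrite lexx.
  apply: main; first by rewrite lexx.
  by move=> y /andP[y1 y2]; rewrite !ler0_norm; lra.
- exists s2; first by rewrite lexx s12.
  apply: main; first by rewrite lexx s12.
  by move=> y /andP[y1 y2]; rewrite !ger0_norm; lra.
Qed.

(** * Decay of the potential at small scales *)

Lemma avg_pot_ge_el (R : realType) (Q : R -> R) (b : R)
    (p : probability (measurableTypeR R) R) (lam u v m : R) (uv : u < v) :
  euler_lagrange Q b p lam -> (forall z, u <= z <= v -> Q z <= m) ->
  ((lam - b * m)%:E <= \int[uniform_prob uv]_x pot p x)%E.
Proof.
move=> [cQ Q0 b0 EL1 EL2] Qm.
have vu0 : 0 < v - u by rewrite subr_gt0.
have [h|h] := leP (lam - b * m) 0.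
  by apply: (@le_trans _ _ 0%E); [rewrite lee_fin|apply: integral_ge0 => x _; exact: pot_ge0].
rewrite integral_uniform//; [|exact: measurable_pot|by move=> x; exact: pot_ge0].
apply: (@le_trans _ _ (((v - u)^-1)%:E * \int[lebesgue_measure]_(x in `[u, v]) (lam - b * m)%:E)%E).
  by rewrite integral_cst_itv// -EFinM lee_fin mulrCA mulVf ?mulr1// gt_eqF.
rewrite lee_pmul2l ?lte_fin ?invr_gt0//; apply: ge0_le_integral => //.
- by move=> x _; rewrite lee_fin ltW.
- exact: measurable_funTS (measurable_pot p).
- move=> x /=; rewrite in_itv/= => /Qm Qx.
  rewrite EFinB leeBlDr//; apply: le_trans (EL1 x) _.
  by rewrite leeD2l// lee_fin ler_pM2l.
Qed.

(** Iteration of [gpot_step] with the Euler-Lagrange bounds inserted; each halving contributes an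
    error c b L r / 2^l from the variation of Q. The subtracted term strengthens the induction
    hypothesis so that it absorbs these errors. *)
Lemma gpot_decay_supp (R : realType) (Q : R -> R) (b : R)
    (p : probability (measurableTypeR R) R) (lam s1 s2 L c r x : R) (l : nat) :
  euler_lagrange Q b p lam -> (forall z, supp p z <-> s1 <= z <= s2) ->
  (forall y z, s1 <= y <= s2 -> s1 <= z <= s2 -> Q z <= Q y + L * `|y - z|) ->
  0 <= L -> 0 < c <= 1 / 300 -> 0 < r <= 1 / 8 -> 2 * r <= s2 - s1 -> s1 <= x <= s2 ->
  (gpot (r / 2 ^+ l) p x <= ((1 - c) ^+ l * (lam + b * L * r) - b * L * r / 2 ^+ l)%:E)%E.
Proof.
move=> EL sE QL L0 c300 /andP[r0 r8] rs xs.
have [cQ Q0 b0 EL1 EL2] := EL.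
have /andP[c0 c1] := c300.
have c4 : c <= 1 / 4 by apply: le_trans c1 _; lra.
have px := EL2 x ((sE x).2 xs).
have px0 : (pot p x <= lam%:E)%E.
  by apply: le_trans px _; rewrite lee_fin gerBl mulr_ge0// ltW.
have bL0 : 0 <= b * L * r by rewrite !mulr_ge0// ltW.
elim: l => [|l IH].
  rewrite expr0 !divr1 expr0 mul1r addrK; apply: le_trans px0.
  by apply: gpot_le_pot; lra.
set t := r / 2 ^+ l in IH *.
have p2 : 0 < (2 : R) ^+ l by rewrite exprn_gt0.
have t0 : 0 < t by rewrite divr_gt0.
have p1 : 1 <= (2 : R) ^+ l by rewrite exprn_ege1// ler1n.
have tr : t <= r by rewrite /t ler_pdivrMr//; nra.
(* Since 2r is at most the length of the support, one side of x has room for a segment on which the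
   Lipschitz bound of Q is known. *)
have [u [v [uv vu xuv us vs]]] : exists u v, [/\ u < v, v - u = t, x = u \/ x = v,
    s1 <= u & v <= s2].
  have /andP[x1 x2] := xs.
  have [h|h] := leP (x + t) s2.
    by clear -x1 x2 h t0 tr rs; exists x, (x + t); split; [lra|ring|left|lra|lra].
  by clear -x1 x2 h t0 tr rs; exists (x - t), x; split; [lra|ring|right|lra|lra].
have Qm z : u <= z <= v -> Q z <= Q x + L * t.
  move=> /andP[uz zv]; apply: le_trans (QL x z xs _) _.
    by rewrite (le_trans us)// (le_trans zv).
  rewrite lerD2l ler_wpM2l//.
  by rewrite ler_norml; clear -xuv uz zv vu; case: xuv => e; apply/andP; split; lra.
have t8 : v - u <= 1 / 8 by rewrite vu; lra.
have h := gpot_step p uv c300 t8 xuv.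
have h2 := avg_pot_ge_el uv EL Qm.
rewrite vu in h.
have -> : r / 2 ^+ l.+1 = t / 2 by rewrite /t exprS; field; rewrite gt_eqF.
set G := _ - _ in IH.
have h3 : ((1 - c)%:E * gpot t p x + c%:E * pot p x <= ((1 - c) * G + c * (lam - b * Q x))%:E)%E.
  rewrite [leRHS]EFinD [((1 - c) * G)%:E]EFinM [(c * (lam - b * Q x))%:E]EFinM.
  by apply: leeD; apply: lee_wpmul2l => //; rewrite lee_fin; clear -c0 c4; lra.
have h4 : (gpot (t / 2) p x + (c * (lam - b * (Q x + L * t)))%:E <=
    ((1 - c) * G + c * (lam - b * Q x))%:E)%E.
  apply: le_trans h3; apply: le_trans h; rewrite leeD2l// EFinM.
  by apply: lee_wpmul2l => //; rewrite lee_fin ltW.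
rewrite -leeBrDr// -EFinB in h4; apply: le_trans h4 _; rewrite lee_fin.
have e1 : b * L * r / 2 ^+ l.+1 = b * L * t / 2 by rewrite /t exprS; field; rewrite gt_eqF.
have e2 : b * L * r / 2 ^+ l = b * L * t by rewrite /t mulrA.
rewrite e1 exprS /G e2.
have bLt : 0 <= b * L * t by rewrite !mulr_ge0// ltW.
(* The correction left is (1 - 2c) b L t, and c <= 1/4 makes it at least the next one, b L t / 2. *)
have : (1 / 2 - 2 * c) * (b * L * t) >= 0 by rewrite mulr_ge0//; clear -c4; lra.
set A := (1 - c) ^+ l; set B := lam + b * L * r; clear -c0; lra.
Qed.

(** Outside the support, moving x to the nearer end point brings it closer to all the mass and
    increases [gpot]. This generality is needed because the points of the discrete minimizer may lie
    off the support. *)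
Lemma gpot_decay (R : realType) (Q : R -> R) (b : R)
    (p : probability (measurableTypeR R) R) (lam s1 s2 L c r x : R) (l : nat) :
  euler_lagrange Q b p lam -> (forall z, supp p z <-> s1 <= z <= s2) ->
  p (~` `[s1, s2]%classic) = 0%E ->
  (forall y z, s1 <= y <= s2 -> s1 <= z <= s2 -> Q z <= Q y + L * `|y - z|) ->
  0 <= L -> 0 < c <= 1 / 300 -> 0 < r <= 1 / 8 -> 2 * r <= s2 - s1 ->
  (gpot (r / 2 ^+ l) p x <= ((1 - c) ^+ l * (lam + b * L * r))%:E)%E.
Proof.
move=> EL sE ps QL L0 c300 rr rs.
have [cQ Q0 b0 EL1 EL2] := EL.
have /andP[r0 r8] := rr.
have bL0 : 0 <= b * L * r by rewrite !mulr_ge0// ltW.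
have p2 : 0 < (2 : R) ^+ l by rewrite exprn_gt0.
have t0 : 0 < r / 2 ^+ l by rewrite divr_gt0.
have main z : s1 <= z <= s2 -> (gpot (r / 2 ^+ l) p z <= ((1 - c) ^+ l * (lam + b * L * r))%:E)%E.
  move=> zs; apply: le_trans (gpot_decay_supp l EL sE QL L0 c300 rr rs zs) _.
  by rewrite lee_fin gerBl divr_ge0// ltW.
have mono z : s1 <= z <= s2 -> (forall y, s1 <= y <= s2 -> `|z - y| <= `|x - y|) ->
    (gpot (r / 2 ^+ l) p x <= gpot (r / 2 ^+ l) p z)%E.
  move=> zs H; apply: ae_ge0_le_integral => //.
  - by move=> y _; apply: gam_ge0; exact: ltW.
  - exact: measurable_gam_subr.
  - by move=> y _; apply: gam_ge0; exact: ltW.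
  - exact: measurable_gam_subr.
  - exists (~` `[s1, s2]%classic); split => //; first exact: measurableC.
    move=> y /= /not_implyP[_]; apply: contra_not.
    rewrite in_itv/= => ys.
    have [e|ne] := eqVneq (z - y) 0; first by rewrite e gam0 leey.
    have n1 : 0 < `|z - y| by rewrite normr_gt0.
    have n2 : 0 < `|x - y| by apply: lt_le_trans n1 (H _ ys).
    have k1 := kap_gt0 n1; have k2 := kap_gt0 n2.
    have kk := kap_nincr n1 (H _ ys).
    rewrite !gamE -?normr_gt0// lee_fin ler_ln ?posrE.
    + by rewrite lerD2l ler_pM2l.
    + by rewrite addr_gt0// mulr_gt0.
    + by rewrite addr_gt0// mulr_gt0.
have s12 : s1 <= s2 by rewrite -subr_ge0; apply: le_trans rs; rewrite mulr_ge0// ltW.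
have [xs|xs] := leP x s1.
  apply: le_trans (mono s1 _ _) (main s1 _); try (by rewrite lexx).
  by clear -xs => y /andP[y1 y2]; rewrite !ler0_norm; lra.
have [sx|sx] := leP s2 x.
  apply: le_trans (mono s2 _ _) (main s2 _); try (by rewrite lexx andbT).
  by clear -sx => y /andP[y1 y2]; rewrite !ger0_norm; lra.
by apply: main; rewrite !ltW.
Qed.

(** The condition on the integral is the defining equation of alpha: it makes the confinement term
    of the uniform measure exactly 2 / a. *)
Lemma energy_uniform_le (R : realType) (Q : R -> R) (b a : R) (a0 : 0 < a) :
  continuous Q -> (forall x, 0 <= Q x) -> 0 < b ->
  (\int[lebesgue_measure]_(t in `[0%R, a]) (Q t)%:E = (b^-1)%:E)%E ->
  (energy Q b (uniform_prob a0) <= (14 / a)%:E)%E.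
Proof.
move=> cQ Q0 b0 iQ; rewrite /energy.
have mQ : measurable_fun [set: R] Q by exact: continuous_measurable_fun.
have mQE : measurable_fun [set: R] (EFin \o Q) by apply/measurable_EFinP.
have -> : 14 / a = 12 / (a - 0) + 2 * b * (a^-1 * b^-1).
  by rewrite subr0; field; rewrite !gt_eqF.
rewrite EFinD; apply: leeD.
  apply: integral_le_cst; [exact: measurable_pot|exact: pot_ge0|].
  by move=> x; exact: pot_uniform_le.
rewrite integral_uniform//.
by rewrite iQ subr0 -!EFinM lee_fin.
Qed.

Lemma supp_le (R : realType) (p : probability (measurableTypeR R) R) (M : R) :
  p (~` `[- M, M]%classic) = 0%E -> forall x, supp p x -> - M <= x <= M.
Proof.
move=> pM x sx; apply: contrapT => xM.
have := sx (~` `[- M, M]%classic) _; rewrite [X in (_ < X)%E]pM ltxx => H.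
suff : false by [].
apply: H; first by apply: closed_openC; exact: itv_closed.
by move=> /=; rewrite in_itv.
Qed.

Lemma euler_lagrange_bounded (R : realType) (Q : R -> R) (b : R)
    (p : probability (measurableTypeR R) R) (W q M : R) :
  continuous Q -> (forall x, 0 <= Q x) -> 0 < b ->
  energy_minimizer Q b p ->
  (\int[p]_x pot p x = W%:E)%E -> (\int[p]_x (Q x)%:E = q%:E)%E ->
  (forall x, b * Q x <= W + b * q -> - M <= x <= M) ->
  p (~` `[- M, M]%classic) = 0%E.
Proof.
move=> cQ Q0 b0 pmin pW pq QM.
have [N [mN N0 EN]] := euler_lagrange_ae cQ Q0 b0 pmin pW pq.
apply/eqP; rewrite -measure_le0 -N0; apply: le_measure; rewrite ?inE//.
  by apply: measurableC.
move=> x /= xM; apply: contrapT => Nx; apply: xM; rewrite in_itv/=; apply: QM.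
by rewrite -lee_fin -(EN x Nx) leeDr// pot_ge0.
Qed.

Lemma minimizer_euler_lagrange (R : realType) (Q : R -> R) (b : R)
    (p : probability (measurableTypeR R) R) (W q : R) :
  continuous Q -> (forall x, 0 <= Q x) -> 0 < b ->
  energy_minimizer Q b p ->
  (\int[p]_x pot p x = W%:E)%E -> (\int[p]_x (Q x)%:E = q%:E)%E ->
  euler_lagrange Q b p (W + b * q).
Proof.
move=> cQ Q0 b0 pmin pW pq; split => //.
- by move=> x; exact: euler_lagrange_ge.
- by move=> x; exact: euler_lagrange_supp.
Qed.

(** * Positive definiteness *)

Definition dint {R : realType} (k : R -> R) (p nu : probability (measurableTypeR R) R) : \bar R :=
  (\int[nu]_x \int[p]_y (k (x - y))%:E)%E.

(* [2 k(p, nu) <= s k(p, p) + k(nu, nu) / s] for the bilinear form of the kernel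
   [k]: the Cauchy-Schwarz inequality in a form stable under sums and limits. *)
Definition cs_kernel {R : realType} (k : R -> R) : Prop :=
  [/\ measurable_fun [set: R] k, forall z, 0 <= k z &
      forall (p nu : probability (measurableTypeR R) R) (s : R), 0 < s ->
      (2%:E * dint k p nu <= s%:E * dint k p p + (s^-1)%:E * dint k nu nu)%E].

(** A feature map for the exponential kernel: exp(-c |x - y|) = exp(-cx) exp(-cy) min(exp(2cx),
    exp(2cy)), and the minimum is the length of the common part of the layers ]0, exp(2cx)] and ]0,
    exp(2cy)]. *)
Definition exp_layer {R : realType} (c x t : R) : R :=
  if (0 < t) && (t <= expR (2 * c * x)) then expR (- (c * x)) else 0.

Lemma exp_layer_ge0 (R : realType) (c x t : R) : 0 <= exp_layer c x t.
Proof. by rewrite /exp_layer; case: ifP => // _; exact: expR_ge0. Qed.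

Lemma measurable_exp_layer (R : realType) (c : R) :
  measurable_fun setT (fun z : measurableTypeR R * measurableTypeR R => exp_layer c z.1 z.2).
Proof.
apply: measurable_fun_ifT => //.
- apply: measurable_and; first exact: measurable_fun_ltr.
  apply: measurable_fun_ler => //; apply: measurableT_comp => //.
  exact: measurable_funM.
- by apply: measurableT_comp => //; apply: measurableT_comp => //; exact: measurable_funM.
Qed.

Lemma exp_layerM (R : realType) (c x y : R) : 0 < c ->
  ((expR (- (c * `|x - y|)))%:E =
   \int[lebesgue_measure]_t (exp_layer c x t * exp_layer c y t)%:E)%E.
Proof.
move=> c0.
wlog xy : x y / x <= y.
  move=> H; have [xy|yx] := leP x y; first exact: H.
  rewrite distrC (H _ _ (ltW yx)); apply: eq_integral => t _.
  by rewrite (mulrC (exp_layer c y t)).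
have e0 := expR_gt0 (2 * c * x).
transitivity ((expR (- (c * x)) * expR (- (c * y)))%:E *
    \int[lebesgue_measure]_t (\1_(`]0, expR (2 * c * x)]%classic : set R) t)%:E)%E.
  rewrite (@integral_indic _ _ _ lebesgue_measure setT)// setIT.
  rewrite [X in (_ * X)%E](@lebesgue_measure_itv R `]0, expR (2 * c * x)]) /= lte_fin e0.
  rewrite -EFinB -EFinM subr0 -!expRD.
  congr (expR _)%:E; rewrite ler0_norm; [ring|lra].
rewrite -ge0_integralZl//; last by apply/measurable_EFinP; exact: measurable_indic.
apply: eq_integral => t _; rewrite -EFinM; congr EFin.
rewrite /exp_layer indicE; have [t0|t0] := ltP 0 t; last first.
  by rewrite mul0r memNset ?mulr0//= in_itv/= => /andP[]; rewrite ltNge t0.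
have [tx|tx] /= := leP t (expR (2 * c * x)).
  rewrite (le_trans tx) ?mem_set/= ?mulr1 ?in_itv/= ?t0//.
  by rewrite ler_expR ler_pM2l// mulr_gt0.
by rewrite mul0r memNset ?mulr0//= in_itv/= t0/= => h; move: tx; rewrite ltNge h.
Qed.

Definition layer_mass {R : realType} (c : R) (p : probability (measurableTypeR R) R) (t : R) : \bar R :=
  (\int[p]_x (exp_layer c x t)%:E)%E.

Lemma layer_mass_ge0 (R : realType) (c : R) (p : probability (measurableTypeR R) R) (t : R) :
  (0 <= layer_mass c p t)%E.
Proof. by apply: integral_ge0 => x _; rewrite lee_fin exp_layer_ge0. Qed.

Lemma measurable_layer_mass (R : realType) (c : R) (p : probability (measurableTypeR R) R) :
  measurable_fun [set: R] (layer_mass c p).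
Proof.
apply: (measurable_fun_fubini_tonelli_G (m1 := p)
  (fun z : measurableTypeR R * measurableTypeR R => (exp_layer c z.1 z.2)%:E)).
- by apply/measurable_EFinP; exact: measurable_exp_layer.
- by move=> z; rewrite lee_fin exp_layer_ge0.
Qed.

Lemma dint_exp (R : realType) (c : R) (p nu : probability (measurableTypeR R) R) : 0 < c ->
  (dint (fun z => expR (- (c * `|z|))) p nu =
   \int[lebesgue_measure]_t (layer_mass c p t * layer_mass c nu t))%E.
Proof.
move=> c0; rewrite /dint.
have m1 (x : R) : measurable_fun [set: R] (fun t : R => (exp_layer c x t)%:E).
  apply/measurable_EFinP.
  exact: (measurableT_comp (measurable_exp_layer c) (pair1_measurable (x : measurableTypeR R))).
have m2 (t : R) : measurable_fun [set: R] (fun x : R => (exp_layer c x t)%:E).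
  apply/measurable_EFinP.
  exact: (measurableT_comp (measurable_exp_layer c) (pair2_measurable (t : measurableTypeR R))).
transitivity (\int[nu]_x \int[lebesgue_measure]_t ((exp_layer c x t)%:E * layer_mass c p t))%E.
  apply: eq_integral => x _.
  under eq_integral do rewrite exp_layerM//.
  rewrite (fubini_tonelli (m1 := p) (m2 := lebesgue_measure)
    (fun z : measurableTypeR R * measurableTypeR R =>
       (exp_layer c x z.2 * exp_layer c z.1 z.2)%:E)); last 2 first.
  - apply/measurable_EFinP; apply: measurable_funM; last exact: measurable_exp_layer.
    have /measurable_EFinP h := m1 x.
    exact: (measurableT_comp h (@measurable_snd _ _ _ _)).
  - by move=> z; rewrite lee_fin mulr_ge0 ?exp_layer_ge0.
  apply: eq_integral => t _.
  rewrite /=; under eq_integral do rewrite EFinM.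
  rewrite ge0_integralZl// ?lee_fin ?exp_layer_ge0//; first exact: m2.
  by move=> y _; rewrite lee_fin exp_layer_ge0.
rewrite (fubini_tonelli (m1 := nu) (m2 := lebesgue_measure)
    (fun z : measurableTypeR R * measurableTypeR R =>
       ((exp_layer c z.1 z.2)%:E * layer_mass c p z.2)%E)); last 2 first.
- apply: emeasurable_funM; first by apply/measurable_EFinP; exact: measurable_exp_layer.
  exact: (measurableT_comp (measurable_layer_mass c p) (@measurable_snd _ _ _ _)).
- by move=> z; rewrite mule_ge0 ?layer_mass_ge0// lee_fin exp_layer_ge0.
apply: eq_integral => t _.
rewrite /= ge0_integralZr//; [by rewrite muleC|exact: m2| |exact: layer_mass_ge0].
by move=> y _; rewrite lee_fin exp_layer_ge0.
Qed.

(** On the layer, t <= exp(2cx) gives exp(-cx)^2 <= 1 / t. Finiteness lets [cs_kernel_exp] expand a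
    square of real numbers for each t. *)
Lemma layer_mass_fin (R : realType) (c : R) (p : probability (measurableTypeR R) R) (t : R) :
  exists g : R, 0 <= g /\ layer_mass c p t = g%:E.
Proof.
have [t0|t0] := leP t 0.
  exists 0; split => //; rewrite /layer_mass integral0_eq// => x _.
  by rewrite /exp_layer ltNge t0.
have t1 : 0 <= t^-1 by rewrite invr_ge0 ltW.
have bd x : exp_layer c x t <= 1 + t^-1.
  rewrite /exp_layer t0/=; case: ifPn => [tx|_]; last lra.
  have h : expR (- (c * x)) * expR (- (c * x)) <= t^-1.
    rewrite -expRD -[leRHS]invrK invrK -[leLHS]invrK lef_pV2 ?posrE ?invr_gt0 ?expR_gt0//.
    rewrite -expRN; apply: le_trans tx _; rewrite ler_expR; lra.
  by have := expR_gt0 (- (c * x)); set e := expR _ in h *; nra.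
have [|g [-> g0 _]] := @ge0_fin R (layer_mass c p t) (1 + t^-1) (layer_mass_ge0 _ _ _).
  apply: integral_le_cst => [|x|x]; rewrite ?lee_fin ?exp_layer_ge0//.
  apply/measurable_EFinP.
  exact: (measurableT_comp (measurable_exp_layer c) (pair2_measurable (t : measurableTypeR R))).
by exists g.
Qed.

Lemma cs_kernel_exp (R : realType) (c : R) : 0 < c ->
  cs_kernel (fun z : R => expR (- (c * `|z|))).
Proof.
move=> c0; split; [|by move=> z; exact: expR_ge0|].
  apply: measurableT_comp => //; apply: measurableT_comp => //.
  by apply: measurable_funM => //; exact: measurableT_comp.
move=> p nu s s0; rewrite !dint_exp//.
have mp := measurable_layer_mass c p; have mn := measurable_layer_mass c nu.
have p0 := @layer_mass_ge0 R c p; have n0 := @layer_mass_ge0 R c nu.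
rewrite -!ge0_integralZl//; try by
  [apply: emeasurable_funM|move=> t _; rewrite mule_ge0|rewrite lee_fin ?invr_ge0 ltW].
rewrite -ge0_integralD//; last 4 first.
- by move=> t _; rewrite !mule_ge0// lee_fin ltW.
- by apply: emeasurable_funM => //; exact: emeasurable_funM.
- by move=> t _; rewrite !mule_ge0// lee_fin invr_ge0 ltW.
- by apply: emeasurable_funM => //; exact: emeasurable_funM.
apply: ge0_le_integral => //.
- by move=> t _; rewrite !mule_ge0// lee_fin.
- by apply: emeasurable_funM => //; exact: emeasurable_funM.
- by apply: emeasurable_funD; apply: emeasurable_funM => //; exact: emeasurable_funM.
move=> t _; have [g [g0 ->]] := layer_mass_fin c p t; have [h [h0 ->]] := layer_mass_fin c nu t.
rewrite -!(EFinM, EFinD) lee_fin.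
have : 0 <= s * (g - s^-1 * h) ^+ 2 by rewrite mulr_ge0 ?sqr_ge0// ltW.
rewrite -subr_ge0; congr (0 <= _); by field; rewrite gt_eqF.
Qed.

Lemma measurable_kernel2 (R : realType) (k : R -> R) : measurable_fun [set: R] k ->
  measurable_fun setT (fun z : measurableTypeR R * measurableTypeR R => (k (z.1 - z.2))%:E).
Proof.
move=> mk; apply/measurable_EFinP; apply: (measurableT_comp mk) => //.
exact: measurable_funB.
Qed.

Lemma measurable_kernel_subr (R : realType) (k : R -> R) (x : R) :
  measurable_fun [set: R] k -> measurable_fun [set: R] (fun y : R => (k (x - y))%:E).
Proof.
move=> mk; apply/measurable_EFinP; apply: (measurableT_comp mk) => //.
exact: measurable_funB.
Qed.

Lemma measurable_kernel_pot (R : realType) (k : R -> R)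
    (p : probability (measurableTypeR R) R) :
  measurable_fun [set: R] k -> (forall z, 0 <= k z) ->
  measurable_fun [set: R] (fun x : R => \int[p]_y (k (x - y)%R)%:E)%E.
Proof.
move=> mk k0; apply: (measurable_fun_fubini_tonelli_F
  (fun z : measurableTypeR R * measurableTypeR R => (k (z.1 - z.2))%:E)).
- exact: measurable_kernel2.
- by move=> z; rewrite lee_fin.
Qed.

Lemma dintD (R : realType) (k l : R -> R) (p nu : probability (measurableTypeR R) R) :
  measurable_fun [set: R] k -> measurable_fun [set: R] l ->
  (forall z, 0 <= k z) -> (forall z, 0 <= l z) ->
  (dint (fun z : R => k z + l z)%R p nu = dint k p nu + dint l p nu)%E.
Proof.
move=> mk ml k0 l0; rewrite /dint -ge0_integralD//; last 4 first.
- by move=> x _; apply: integral_ge0 => y _; rewrite lee_fin.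
- exact: measurable_kernel_pot.
- by move=> x _; apply: integral_ge0 => y _; rewrite lee_fin.
- exact: measurable_kernel_pot.
apply: eq_integral => x _; rewrite -ge0_integralD//.
- by move=> y _; rewrite lee_fin.
- exact: measurable_kernel_subr.
- by move=> y _; rewrite lee_fin.
- exact: measurable_kernel_subr.
Qed.

Lemma dintZ (R : realType) (k : R -> R) (c : R) (p nu : probability (measurableTypeR R) R) :
  measurable_fun [set: R] k -> (forall z, 0 <= k z) -> 0 <= c ->
  (dint (fun z : R => c * k z)%R p nu = c%:E * dint k p nu)%E.
Proof.
move=> mk k0 c0; rewrite /dint -ge0_integralZl//; last 2 first.
- exact: measurable_kernel_pot.
- by move=> x _; apply: integral_ge0 => y _; rewrite lee_fin.
apply: eq_integral => x _; under eq_integral do rewrite EFinM.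
rewrite ge0_integralZl//; first exact: measurable_kernel_subr.
by move=> y _; rewrite lee_fin.
Qed.

Lemma dint_ge0 (R : realType) (k : R -> R) (p nu : probability (measurableTypeR R) R) :
  (forall z, 0 <= k z) -> (0 <= dint k p nu)%E.
Proof.
by move=> k0; apply: integral_ge0 => x _; apply: integral_ge0 => y _; rewrite lee_fin.
Qed.

Lemma le_dint (R : realType) (k l : R -> R) (p nu : probability (measurableTypeR R) R) :
  measurable_fun [set: R] k -> measurable_fun [set: R] l ->
  (forall z, 0 <= k z) -> (forall z, k z <= l z) -> (dint k p nu <= dint l p nu)%E.
Proof.
move=> mk ml k0 kl.
have l0 z : 0 <= l z by apply: le_trans (kl z).
apply: ge0_le_integral => //; [by move=> x _; apply: integral_ge0 => y _; rewrite lee_fin|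
  exact: measurable_kernel_pot|exact: measurable_kernel_pot|].
move=> x _; apply: ge0_le_integral => //; [by move=> y _; rewrite lee_fin|
  exact: measurable_kernel_subr|exact: measurable_kernel_subr|].
by move=> y _; rewrite lee_fin.
Qed.

Lemma dint_le_cst (R : realType) (k : R -> R) (c : R)
    (p nu : probability (measurableTypeR R) R) :
  measurable_fun [set: R] k -> (forall z, 0 <= k z) -> (forall z, k z <= c) ->
  (dint k p nu <= c%:E)%E.
Proof.
move=> mk k0 kc; apply: integral_le_cst; [exact: measurable_kernel_pot| |].
  by move=> x; apply: integral_ge0 => y _; rewrite lee_fin.
move=> x; apply: integral_le_cst; first exact: measurable_kernel_subr.
- by move=> y; rewrite lee_fin.
- by move=> y; rewrite lee_fin.
Qed.

Lemma cs_kernel0 (R : realType) : cs_kernel (fun=> 0 : R).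
Proof.
split=> // p nu s s0.
have d0 (q q' : probability (measurableTypeR R) R) : dint (fun=> 0 : R) q q' = 0%E.
  by apply: integral0_eq => x _; exact: integral0.
by rewrite !d0 !mule0 adde0.
Qed.

Lemma cs_kernelD (R : realType) (k l : R -> R) :
  cs_kernel k -> cs_kernel l -> cs_kernel (fun z => k z + l z).
Proof.
move=> [mk k0 ck] [ml l0 cl]; split.
- exact: measurable_funD.
- by move=> z; rewrite addr_ge0.
- move=> p nu s s0; rewrite !dintD//; move: (ck p nu s s0) (cl p nu s s0).
  move: (dint_ge0 p nu k0) (dint_ge0 p p k0) (dint_ge0 nu nu k0).
  move: (dint_ge0 p nu l0) (dint_ge0 p p l0) (dint_ge0 nu nu l0).
  move: (dint k p nu) (dint k p p) (dint k nu nu) (dint l p nu) (dint l p p) (dint l nu nu).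
  by move=> a1 a2 a3 a4 a5 a6 *; rewrite !ge0_muleDr// addeACA leeD.
Qed.

Lemma cs_kernelZ (R : realType) (k : R -> R) (c : R) : 0 <= c ->
  cs_kernel k -> cs_kernel (fun z => c * k z).
Proof.
move=> c0 [mk k0 ck]; split.
- exact: measurable_funM.
- by move=> z; rewrite mulr_ge0.
- move=> p nu s s0; rewrite !dintZ//.
  rewrite muleCA (muleCA s%:E) (muleCA (s^-1)%:E) -ge0_muleDr; last 2 first.
  + by rewrite mule_ge0 ?dint_ge0// lee_fin ltW.
  + by rewrite mule_ge0 ?dint_ge0// lee_fin invr_ge0 ltW.
  by rewrite lee_wpmul2l ?lee_fin ?ck.
Qed.

(** Boundedness makes the three forms finite. A uniform error changes k(p, nu) by at most itself,
    since the masses are 1, and the right-hand side only grows on passing from [l] to [k]. *)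
Lemma cs_kernel_lim (R : realType) (k : R -> R) (c : R) :
  measurable_fun [set: R] k -> (forall z, 0 <= k z) -> (forall z, k z <= c) ->
  (forall e, 0 < e -> exists2 l : R -> R, cs_kernel l &
     forall z, l z <= k z <= l z + e) -> cs_kernel k.
Proof.
move=> mk k0 kc H; split => // p nu s s0.
have fin q q' : exists g, dint k q q' = g%:E.
  have [|g [-> _ _]] := @ge0_fin R (dint k q q') c (dint_ge0 _ _ k0); last by exists g.
  exact: dint_le_cst.
have [X EX] := fin p p; have [Y EY] := fin p nu; have [Z EZ] := fin nu nu.
rewrite EX EY EZ -!(EFinM, EFinD) lee_fin; apply/ler_addgt0Pl => e e0.
have e2 : 0 < e / 2 by rewrite divr_gt0.
have [l [ml l0 cl] lk] := H _ e2.
have le q q' : (dint l q q' <= dint k q q')%E.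
  by apply: le_dint => // z; have /andP[] := lk z.
have YL : (dint k p nu <= dint l p nu + (e / 2)%:E)%E.
  apply: (@le_trans _ _ (dint (fun z => l z + e / 2) p nu)).
    apply: le_dint => //; first exact: measurable_funD.
    by move=> z; have /andP[] := lk z.
  rewrite dintD//; last by move=> z; exact: ltW.
  by rewrite leeD2l//; apply: dint_le_cst => // z; exact: ltW.
have {}cl := cl p nu s s0.
have h : (2%:E * dint k p nu <= e%:E + (s * X + s^-1 * Z)%:E)%E.
  apply: (@le_trans _ _ (2%:E * (dint l p nu + (e / 2)%:E))%E).
    by rewrite lee_wpmul2l// lee_fin.
  rewrite ge0_muleDr ?dint_ge0// ?lee_fin ?(ltW e2)// -EFinM mulrC divfK// addeC leeD2l//.
  apply: le_trans cl _; rewrite EFinD !EFinM -EX -EZ.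
  by apply: leeD; apply: lee_wpmul2l; rewrite ?le ?lee_fin ?invr_ge0 ?ltW.
by move: h; rewrite EY -!(EFinM, EFinD) lee_fin.
Qed.

(** * Expansion of the regularised kernel in decaying exponentials *)

Lemma is_derive_artanh_sum (R : realType) (N : nat) (v : R) :
  is_derive v 1 (fun v : R => \sum_(k < N) 2 / (2 * k + 1)%:R * v ^+ (2 * k + 1))
    (\sum_(k < N) 2 * v ^+ (2 * k)).
Proof.
elim: N => [|N IH].
  by rewrite big_ord0; under eq_fun do rewrite big_ord0; exact: is_derive_cst.
under eq_fun do rewrite big_ord_recr /=; rewrite big_ord_recr /=.
have n0 : (2 * N + 1)%:R != 0 :> R by rewrite pnatr_eq0 addn1.
have d : is_derive v 1 (fun v : R => 2 / (2 * N + 1)%:R * v ^+ (2 * N + 1)) (2 * v ^+ (2 * N)).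
  have h := @is_deriveX R R^o id (2 * N + 1) v 1 1 (is_derive_id _ _).
  have {}h := is_deriveZ (2 / (2 * N + 1)%:R) h.
  have e : (2 / (2 * N + 1)%:R : R) *: (((2 * N + 1)%:R * v ^+ (2 * N + 1).-1) *: (1 : R)) =
      2 * v ^+ (2 * N).
    rewrite addn1 /= -addn1 /GRing.scale /=; set c : R := (2 * N + 1)%:R in n0 *.
    by field.
  have -> : (fun v : R => 2 / (2 * N + 1)%:R * v ^+ (2 * N + 1)) =
      (2 / (2 * N + 1)%:R) \*: (id ^+ (2 * N + 1) : R -> R^o).
    by apply/funext => w; rewrite fctE; congr (_ *: _); elim: (2 * N + 1)%N => [|n IHn]; rewrite ?expr0// !exprS IHn.
  by apply: (is_derive_eq h).
exact: (is_deriveD IH d).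
Qed.

Lemma artanh_sum (R : realType) (N : nat) (v : R) :
  (1 - v ^+ 2) * \sum_(k < N) 2 * v ^+ (2 * k) = 2 - 2 * v ^+ (2 * N).
Proof.
elim: N => [|N IH]; first by rewrite big_ord0 mulr0 muln0 expr0 mulr1 subrr.
rewrite big_ord_recr /= mulrDr IH mulnS exprD; ring.
Qed.

(** The middle term is 2 artanh u. By the geometric sum, the derivative of the remainder is 2 v^(2N)
    / (1 - v^2), so one mean value step from 0 gives both bounds. *)
Lemma artanh_series (R : realType) (N : nat) (u : R) : 0 <= u < 1 ->
  \sum_(k < N) 2 / (2 * k + 1)%:R * u ^+ (2 * k + 1) <= ln (1 + u) - ln (1 - u) <=
  \sum_(k < N) 2 / (2 * k + 1)%:R * u ^+ (2 * k + 1) + 2 * u ^+ (2 * N) / (1 - u ^+ 2).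
Proof.
move=> /andP[u0 u1]; set S := \sum_(k < N) _.
pose f (v : R) := ln (1 + v) - ln (1 - v) - \sum_(k < N) 2 / (2 * k + 1)%:R * v ^+ (2 * k + 1).
have df (v : R) : 0 <= v < 1 -> is_derive v 1 f (2 * v ^+ (2 * N) / (1 - v ^+ 2)).
  move=> /andP[v0 v1].
  have p1 : 0 < 1 + v by lra.
  have p2 : 0 < 1 - v by lra.
  have d1 : is_derive v 1 (fun v : R => 1 + v) 1.
    by apply: is_derive_eq; ring.
  have d2 : is_derive v 1 (fun v : R => 1 - v) (- 1).
    by apply: is_derive_eq; ring.
  have e1 := @is_derive1_comp _ (@ln R) _ v _ _ (is_derive1_ln p1) d1.
  have e2 := @is_derive1_comp _ (@ln R) _ v _ _ (is_derive1_ln p2) d2.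
  have := is_deriveB (is_deriveB e1 e2) (is_derive_artanh_sum N v).
  move=> /is_derive_eq; apply.
  have v2p : 0 < 1 - v ^+ 2 by nra.
  have v2 : 1 - v ^+ 2 != 0 by rewrite gt_eqF.
  have -> : \sum_(k < N) 2 * v ^+ (2 * k) = (2 - 2 * v ^+ (2 * N)) / (1 - v ^+ 2).
    by rewrite -artanh_sum mulrAC mulfV// mul1r.
  by field; rewrite !gt_eqF.
have [||c] := @MVT_segment R f (fun v => 2 * v ^+ (2 * N) / (1 - v ^+ 2)) 0 u u0.
- by move=> x; rewrite in_itv/= => /andP[x0 xu]; apply: df; rewrite ltW//=; exact: lt_trans xu u1.
- apply: derivable_within_continuous => x; rewrite in_itv/= => /andP[x0 xu].
  by have [] := df x _; first by rewrite x0/=; exact: le_lt_trans xu u1.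
rewrite in_itv/= => /andP[c0 cu].
have -> : f 0 = 0.
  rewrite /f addr0 subr0 ln1 subrr sub0r big1 ?oppr0// => k _.
  by rewrite addn1 expr0n/= mulr0.
rewrite !subr0 /f -/S => e.
have p2 : 0 < 1 - c ^+ 2 by nra.
have p3 : 0 < 1 - u ^+ 2 by nra.
have cN : 0 <= c ^+ (2 * N) <= u ^+ (2 * N).
  by rewrite exprn_ge0// lerXn2r// ?nnegrE.
have X0 : 0 <= 2 * c ^+ (2 * N) / (1 - c ^+ 2).
  by case/andP: cN => cN0 _; apply: divr_ge0; [exact: mulr_ge0|exact: ltW].
have X1 : 2 * c ^+ (2 * N) / (1 - c ^+ 2) <= 2 * u ^+ (2 * N) / (1 - u ^+ 2).
  case/andP: cN => cN0 cN1; apply: ler_pM.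
  - exact: mulr_ge0.
  - by rewrite invr_ge0 ltW.
  - by rewrite ler_pM2l.
  by rewrite lef_pV2 ?posrE//; nra.
set X := 2 * c ^+ _ / _ in X0 X1 e; set Y := 2 * u ^+ _ / _ in X1 *.
apply/andP; split; nra.
Qed.

(** As tanh x = (1 - u) / (1 + u) with u = exp(-2x), the kernel is 2 artanh u: a power series in u
    with nonnegative coefficients, hence a positive combination of exponentials in x. *)
Lemma kr_artanh (R : realType) (x : R) : 0 < x ->
  kr x = ln (1 + expR (- (2 * x))) - ln (1 - expR (- (2 * x))).
Proof.
move=> x0; rewrite kr_lnB//.
have h1 := expR_sub_gt0 x0; have h2 := expR_add_gt0 x.
have e0 := expR_gt0 x; have uv := expR_mul_opp x.
have -> : expR (- (2 * x)) = expR (- x) * expR (- x) by rewrite -expRD; congr expR; ring.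
set a := expR x in h1 h2 e0 uv *; set b := expR (- x) in h1 h2 uv *.
have b0 : 0 < b by exact: expR_gt0.
have -> : 1 + b * b = b * (a + b) by rewrite -uv; ring.
have -> : 1 - b * b = b * (a - b) by rewrite -uv; ring.
by rewrite !lnM ?posrE//; ring.
Qed.

Lemma cs_kernel_exp_sum (R : realType) (d : R) (N : nat) :
  cs_kernel (fun z : R =>
    \sum_(k < N) 2 / (2 * k + 1)%:R * expR (- (2 * (`|z| + d))) ^+ (2 * k + 1)).
Proof.
elim: N => [|N IH].
  by under eq_fun do rewrite big_ord0; exact: cs_kernel0.
under eq_fun do rewrite big_ord_recr /=; apply: cs_kernelD; first exact: IH.
set m := (2 * N + 1)%N.
have m0 : 0 < m%:R :> R by rewrite ltr0n /m addn1.
have e (z : R) : 2 / m%:R * expR (- (2 * (`|z| + d))) ^+ m =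
    2 / m%:R * expR (- (2 * d)) ^+ m * expR (- (2 * m%:R * `|z|)).
  rewrite -!expRM_natl -[RHS]mulrA -expRD; congr (_ * expR _).
  by ring.
under eq_fun do rewrite e.
apply: cs_kernelZ; first by rewrite mulr_ge0 ?exprn_ge0 ?expR_ge0// divr_ge0// ltW.
by apply: cs_kernel_exp; rewrite mulr_gt0.
Qed.

Lemma expr_small (R : realType) (u e : R) : 0 <= u < 1 -> 0 < e ->
  exists N : nat, u ^+ (2 * N) <= e.
Proof.
move=> /andP[u0 u1] e0.
have /cvgrPdist_le /(_ _ e0) : (u ^+ n) @[n --> \oo] --> (0 : R).
  by apply: cvg_expr; rewrite ger0_norm.
case=> N _ H; exists N; have := H (2 * N)%N; rewrite /= mul2n -addnn leq_addr => /(_ isT).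
by rewrite sub0r normrN ger0_norm// exprn_ge0.
Qed.

(** The shift by d keeps u below exp(-2d) < 1, which makes the series converge uniformly in z, as
    [cs_kernel_lim] asks. *)
Lemma cs_kernel_kd (R : realType) (d : R) : 0 < d -> cs_kernel (@kd R d).
Proof.
move=> d0; apply: (@cs_kernel_lim R _ (kr d)).
- exact: measurable_kd.
- exact: kd_ge0.
- by move=> z; exact: kd_le.
move=> e e0; set u0 := expR (- (2 * d)).
have u01 : 0 <= u0 < 1.
  by rewrite expR_ge0/= /u0 -expR0 ltr_expR oppr_lt0 mulr_gt0.
have /andP[u0p u0l] := u01.
have p2 : 0 < 1 - u0 ^+ 2 by nra.
have [|N hN] := @expr_small R u0 (e * (1 - u0 ^+ 2) / 2) u01.
  by rewrite divr_gt0// mulr_gt0.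
exists (fun z : R => \sum_(k < N) 2 / (2 * k + 1)%:R * expR (- (2 * (`|z| + d))) ^+ (2 * k + 1)).
  exact: cs_kernel_exp_sum.
move=> z; have zd : 0 < `|z| + d by rewrite ltr_wpDl.
rewrite /kd kr_artanh//; set u := expR (- (2 * (`|z| + d))).
have uu : 0 <= u <= u0.
  by rewrite expR_ge0/= ler_expR lerN2 ler_pM2l// lerDr.
have /andP[up ul] := uu.
have u1 : 0 <= u < 1 by rewrite up (le_lt_trans ul).
have /andP[-> h]/= := artanh_series N u1; apply: le_trans h _; rewrite lerD2l.
have q2 : 0 < 1 - u ^+ 2 by nra.
rewrite ler_pdivrMr//.
have : u ^+ (2 * N) <= u0 ^+ (2 * N) by rewrite lerXn2r// nnegrE.
have : 1 - u0 ^+ 2 <= 1 - u ^+ 2 by nra.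
nra.
Qed.

(** * Regularity on the support and dilations *)

(** An essential supremum ignores null sets, but by continuity a larger value at x would persist on
    a segment of positive length in [s1, s2]. The bound M also shows that the norm is finite, so
    [fine] does not replace it by 0. *)
Lemma Linfty_ge (R : realType) (A : set R) (f : R -> R) (s1 s2 : R) : s1 < s2 ->
  continuous f -> (forall x, A x <-> s1 <= x <= s2) ->
  forall x, s1 <= x <= s2 -> `|f x| <= Linfty A f.
Proof.
move=> s12 cf AE.
have [M HM] : exists M : R, forall x : R, s1 <= x <= s2 -> `|f x| <= M.
  have cn : {within `[s1, s2], continuous (fun x => `|f x|)}.
    apply: continuous_subspaceT => x; apply: continuous_comp; first exact: cf.
    exact: norm_continuous.
  have [c _ H] := EVT_max (ltW s12) cn.
  by exists `|f c| => x xs; apply: H; rewrite in_itv.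
have M0 : 0 <= M by apply: le_trans (HM s1 _); rewrite ?normr_ge0// lexx ltW.
have mT : (0 < lebesgue_measure [set: R])%E.
  apply: (@lt_le_trans _ _ (lebesgue_measure (`[0, 1]%classic : set R))).
    by rewrite lebesgue_measure_itv/= lte_fin ltr01 -EFinB subr0 lte_fin.
  by apply: le_measure; rewrite ?inE.
rewrite /Linfty unlock mT.
set E := ess_sup _ _.
have E1 : (E <= M%:E)%E.
  apply/ess_supP; apply: nearW => x /=; rewrite lee_fin indicE.
  have [/set_mem/AE xs|_] := boolP (x \in A); last by rewrite mul0r normr0.
  by rewrite mul1r HM.
have E0 : (0 <= E)%E by apply: ess_sup_gee => //; apply: nearW => x; exact: abse_ge0.
have [S [ES S0 _]] := ge0_fin E0 E1.
rewrite ES /= => x xs; rewrite leNgt; apply/negP => Sx.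
have [N [mN N0 HN]] := @ess_sup_ge _ _ _ (@lebesgue_measure R) (abse \o (fun x => (\1_A x * f x)%:E)).
rewrite -/E ES in HN.
have cn : `|f z| @[z --> x] --> `|f x|.
  by apply: continuous_comp; [exact: cf|exact: norm_continuous].
have [d /= d0 Hd] := cvgr_gt _ cn _ Sx.
(* The segment is taken on the side of x that contains the midpoint, so that it also fits when x is
   an end point. *)
have [u [v [uv us vs uvx]]] : exists u v : R, [/\ u < v, s1 <= u, v <= s2 &
    forall z, u <= z <= v -> `|x - z| < d].
  have /andP[x1 x2] := xs.
  have [h|h] := leP ((s1 + s2) / 2) x.
    exists (Num.max s1 (x - d / 2)), x; split => //.
    - by rewrite gt_max; apply/andP; split; lra.
    - by rewrite le_max lexx.
    - by move=> z; rewrite ge_max => /andP[/andP[a1 a2] a3]; clear -a2 a3 d0; rewrite ger0_norm; lra.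
  exists x, (Num.min s2 (x + d / 2)); split => //.
  - by rewrite lt_min; apply/andP; split; lra.
  - by rewrite ge_min lexx.
  - by move=> z; rewrite le_min => /andP[a1 /andP[a2 a3]]; clear -a1 a3 d0; rewrite ler0_norm; lra.
have : (lebesgue_measure (`[u, v]%classic : set R) <= lebesgue_measure N)%E.
  apply: le_measure; rewrite ?inE// => z /=; rewrite in_itv/= => zuv.
  apply: HN => /=; rewrite lee_fin indicE mem_set ?mul1r; last first.
    by apply/AE; case/andP: zuv => z1 z2; rewrite (le_trans us)// (le_trans z2).
  by apply/negP; rewrite -ltNge; apply: Hd; exact: uvx.
by rewrite [X in (_ <= X)%E]N0 lebesgue_measure_itv/= lte_fin uv -EFinB lee_fin leNgt subr_gt0 uv.
Qed.

Lemma C4_derive (R : realType) (Q : R -> R) : C4 Q ->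
  [/\ forall x : R, is_derive x 1 Q (derive1n 1 Q x),
      forall x : R, is_derive x 1 (derive1n 1 Q) (derive1n 2 Q x),
      continuous Q & continuous (derive1n 2 Q)].
Proof.
move=> [dQ _].
have D k (k4 : (k < 4)%N) (x : R) : is_derive x 1 (derive1n k Q) (derive1n k.+1 Q x).
  by rewrite derive1nS derive1E; apply: derivableP; exact: dQ.
have Cn k (k4 : (k < 4)%N) : continuous (derive1n k Q).
  by move=> x; apply: differentiable_continuous; apply/derivable1_diffP; exact: dQ.
split; [exact: (D 0%N)|exact: (D 1%N)|exact: (Cn 0%N)|exact: (Cn 2%N)].
Qed.

Lemma MVT_between (R : realType) (f df : R -> R) (x y : R) :
  (forall x : R, is_derive x 1 f (df x)) ->
  exists2 c, Num.min x y <= c <= Num.max x y & f y - f x = df c * (y - x).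
Proof.
move=> d.
have cf (a b : R) : {within `[a, b], continuous f}.
  by apply: derivable_within_continuous => z _; have [] := d z.
have [xy|yx] := leP x y.
  have [c ci e] := MVT_segment xy (fun z _ => d z) (cf x y).
  by exists c.
have [c ci e] := MVT_segment (ltW yx) (fun z _ => d z) (cf y x).
by exists c => //; rewrite -opprB e; ring.
Qed.

Lemma derive_at_zero (R : realType) (Q dQ : R -> R) (z : R) :
  (forall x : R, is_derive x 1 Q (dQ x)) -> (forall x, 0 <= Q x) -> Q z = 0 -> dQ z = 0.
Proof.
move=> d Q0 Qz.
have h : is_derive z 1 Q 0.
  apply: (@derive1_at_min R Q (z - 1) (z + 1)).
  - lra.
  - by move=> t _; have [] := d t.
  - by rewrite in_itv/=; apply/andP; split; lra.
  - by move=> t _; rewrite Qz.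
have h1 := @derive_val _ _ _ _ _ _ _ h.
by rewrite -(@derive_val _ _ _ _ _ _ _ (d z)) h1.
Qed.

(** Q is minimal at its zero z, so dQ z = 0 and the mean value theorem from z bounds dQ by ddQ. It
    is for this that the support must meet the zero set of Q. *)
Lemma derive_bound (R : realType) (Q dQ ddQ : R -> R) (s1 s2 z S : R) :
  (forall x : R, is_derive x 1 Q (dQ x)) -> (forall x : R, is_derive x 1 dQ (ddQ x)) ->
  (forall x, 0 <= Q x) -> Q z = 0 -> s1 <= z <= s2 ->
  (forall x, s1 <= x <= s2 -> `|ddQ x| <= S) ->
  forall x, s1 <= x <= s2 -> `|dQ x| <= S * (s2 - s1).
Proof.
move=> d1 d2 Q0 Qz /andP[z1 z2] HS x /andP[x1 x2].
have [c /andP[c1 c2] e] := MVT_between z x d2.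
rewrite (derive_at_zero d1 Q0 Qz) subr0 in e; rewrite e normrM.
have cs : s1 <= c <= s2.
  apply/andP; split; first by apply: le_trans c1; rewrite le_min z1.
  by apply: le_trans c2 _; rewrite ge_max z2.
by apply: ler_pM => //; [exact: HS|rewrite ler_norml; apply/andP; split; lra].
Qed.

Lemma lipschitz_between (R : realType) (Q dQ : R -> R) (s1 s2 L : R) :
  (forall x : R, is_derive x 1 Q (dQ x)) ->
  (forall x, s1 <= x <= s2 -> `|dQ x| <= L) ->
  forall y z, s1 <= y <= s2 -> s1 <= z <= s2 -> Q z <= Q y + L * `|y - z|.
Proof.
move=> d HL y z /andP[y1 y2] /andP[z1 z2].
have [c /andP[c1 c2] e] := MVT_between y z d.
have cs : s1 <= c <= s2.
  apply/andP; split; first by apply: le_trans c1; rewrite le_min y1.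
  by apply: le_trans c2 _; rewrite ge_max y2.
rewrite -lerBlDl e; apply: le_trans (ler_norm _) _.
by rewrite normrM distrC; apply: ler_pM => //; exact: HL.
Qed.

(** The tangent at (1 + e)|z| gains 2 e |z| kap((1 + e)|z|), and kap v >= exp(-2v) / (2v) cancels
    |z|; e <= 1 gives the factor 1/2 and the exponent 4. *)
Lemma K_dilation (R : realType) (e z : R) : 0 < e <= 1 ->
  (K ((1 + e) * z) + (e / 2 * expR (- (4 * `|z|)))%:E <= K z)%E.
Proof.
move=> /andP[e0 e1].
have [->|z0] := eqVneq z 0; first by rewrite K_0 leey.
have e10 : 0 < 1 + e by lra.
rewrite !K_kr//; last by rewrite mulf_neq0// gt_eqF.
rewrite -EFinD lee_fin -(kr_norm z) -(kr_norm (_ * z)) normrM (gtr0_norm e10).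
have {}z0 : 0 < `|z| by rewrite normr_gt0.
set w := `|z| in z0 *.
have w0 : 0 < (1 + e) * w by rewrite mulr_gt0.
have := kr_tangent w0 z0; have := kap_ge_exp w0.
set k := kap _; set a := kr _; set b := kr w => h1 h2.
have h3 : expR (- (4 * w)) <= expR (- (2 * ((1 + e) * w))) by rewrite ler_expR; nra.
have h4 : expR (- (4 * w)) / (2 * ((1 + e) * w)) <= k.
  by apply: le_trans h1; rewrite ler_wpM2r// invr_ge0 ltW// mulr_gt0.
rewrite ler_pdivrMr ?mulr_gt0// in h4.
have E0 := expR_gt0 (- (4 * w)).
have k0 : 0 < k by exact: kap_gt0.
set E := expR (- (4 * w)) in h4 E0 *.
have kw : 0 <= k * w by apply: mulr_ge0; exact: ltW.
have h5 : E <= 4 * (k * w) by nra.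
have h6 : e * E <= e * (4 * (k * w)) by rewrite ler_pM2l.
lra.
Qed.

(* A dilation by 1 + e decreases the interaction energy by at least e / 2 times
   the left-hand side, so it must increase the confinement energy accordingly. *)
Lemma dilation_energy (R : realType) (Q dQ ddQ : R -> R) (b : R)
    (p : probability (measurableTypeR R) R) (W q s1 s2 M L : R) :
  (forall x : R, is_derive x 1 Q (dQ x)) -> (forall x : R, is_derive x 1 dQ (ddQ x)) ->
  continuous Q -> continuous ddQ -> (forall x, 0 <= Q x) -> 0 < b ->
  energy_minimizer Q b p ->
  (\int[p]_x pot p x = W%:E)%E -> (\int[p]_x (Q x)%:E = q%:E)%E ->
  p (~` `[s1, s2]%classic) = 0%E -> - M <= s1 -> s1 <= s2 -> s2 <= M -> 0 < M ->
  (forall x, s1 <= x <= s2 -> `|dQ x| <= L) ->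
  (dint (fun z => expR (- (4 * `|z|))) p p <= (4 * b * M * L)%:E)%E.
Proof.
move=> d1 d2 cQ cdd Q0 b0 pmin pW pq ps Ms1 s12 s2M M0 HL.
have [mk k0' kcs] := @cs_kernel_exp R 4 ltac:(lra).
have mQ : measurable_fun [set: R] Q by exact: continuous_measurable_fun.
(* Dilated points stay in [-2M, 2M] because e <= 1. The bound S enters only at second order in e and
   disappears in the limit. *)
have [S HS] : exists S : R, forall x : R, - (2 * M) <= x <= 2 * M -> `|ddQ x| <= S.
  have cn : {within `[- (2 * M), 2 * M], continuous (fun x => `|ddQ x|)}.
    apply: continuous_subspaceT => x; apply: continuous_comp; first exact: cdd.
    exact: norm_continuous.
  have [|c _ H] := EVT_max _ cn; first lra.
  by exists `|ddQ c| => x xs; apply: H; rewrite in_itv.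
have S0 : 0 <= S by apply: le_trans (HS 0 _); rewrite ?normr_ge0//; apply/andP; split; lra.
set k := fun z => _ in mk kcs *.
have k0 z : 0 <= k z by exact: k0'.
have [|E [EE E0 _]] := @ge0_fin R (dint k p p) 1 (dint_ge0 _ _ k0).
  by apply: dint_le_cst => // z; rewrite /k -expR0 ler_expR oppr_le0 mulr_ge0.
rewrite EE lee_fin.
have main (e : R) : 0 < e <= 1 -> E <= 4 * b * M * (L + S * (e * M)).
  move=> /andP[e0 e1].
  have [|pe Hpe] := @probability_pushforward R p (fun x => (1 + e) * x).
    exact: measurable_funM.
  have We : (\int[pe]_x pot pe x + (e / 2 * E)%:E <= W%:E)%E.
    rewrite Hpe; [|exact: measurable_pot|exact: pot_ge0].
    have me : measurable_fun [set: R] (fun x : R => pot pe ((1 + e) * x)).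
      apply: (measurableT_comp (measurable_pot pe)); exact: measurable_funM.
    have mK (x : R) : measurable_fun [set: R] (fun y : R => K ((1 + e) * x - (1 + e) * y)).
      apply: (measurableT_comp (measurable_K_subr _)); exact: measurable_funM.
    have e20 : 0 <= e / 2 by lra.
    rewrite EFinM -EE -pW /dint -ge0_integralZl//; last 2 first.
    - exact: measurable_kernel_pot.
    - by move=> x _; apply: integral_ge0 => y _; rewrite lee_fin.
    rewrite -ge0_integralD//; last 3 first.
    - by move=> x _; exact: pot_ge0.
    - by move=> x _; apply: mule_ge0 => //; apply: integral_ge0 => y _; rewrite lee_fin.
    - by apply: emeasurable_funM => //; exact: measurable_kernel_pot.
    apply: ge0_le_integral => //.
    - move=> x _; apply: adde_ge0; first exact: pot_ge0.
      by apply: mule_ge0 => //; apply: integral_ge0 => y _; rewrite lee_fin.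
    - apply: emeasurable_funD => //.
      by apply: emeasurable_funM => //; exact: measurable_kernel_pot.
    - exact: measurable_pot.
    move=> x _; rewrite /pot Hpe; [|exact: measurable_K_subr|by move=> y; exact: K_ge0].
    rewrite -ge0_integralZl//; last 2 first.
    - exact: measurable_kernel_subr.
    - by move=> y _; rewrite lee_fin.
    rewrite -ge0_integralD//; last 4 first.
    - by move=> y _; exact: K_ge0.
    - exact: mK.
    - by move=> y _; apply: mule_ge0 => //; rewrite lee_fin.
    - by apply: emeasurable_funM => //; exact: measurable_kernel_subr.
    apply: ge0_le_integral => //.
    - by move=> y _; apply: adde_ge0; [exact: K_ge0|apply: mule_ge0 => //; rewrite lee_fin].
    - apply: emeasurable_funD; first exact: mK.
      by apply: emeasurable_funM => //; exact: measurable_kernel_subr.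
    - exact: measurable_K_subr.
    by move=> y _; rewrite -mulrBr -EFinM; apply: K_dilation; rewrite e0.
  have Qe : (\int[pe]_x (Q x)%:E <= (q + e * M * (L + S * (e * M)))%:E)%E.
    rewrite Hpe; [|by apply/measurable_EFinP|by move=> x; rewrite lee_fin].
    have L0 : 0 <= L by apply: le_trans (HL s1 _); rewrite ?normr_ge0// lexx.
    have c0 : 0 <= e * M * (L + S * (e * M)).
      by rewrite !(mulr_ge0, addr_ge0)// ltW.
    rewrite EFinD -pq -[X in (_ + X)%E](mule1) -(probability_setT p) -integral_cst//.
    rewrite -ge0_integralD//; [|by move=> x _; rewrite lee_fin|by apply/measurable_EFinP].
    apply: ae_ge0_le_integral => //.
    - by move=> x _; rewrite lee_fin.
    - apply/measurable_EFinP; apply: (measurableT_comp mQ); exact: measurable_funM.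
    - by move=> x _; rewrite adde_ge0// lee_fin.
    - by apply: emeasurable_funD => //; apply/measurable_EFinP.
    exists (~` `[s1, s2]%classic); split => //; first exact: measurableC.
    move=> x /= /not_implyP[_]; apply: contra_not.
    rewrite in_itv/= => xs; have /andP[xs1 xs2] := xs.
    rewrite -EFinD lee_fin -lerBlDl.
    have [c /andP[c1 c2] ->] := MVT_between x ((1 + e) * x) d1.
    have xM : `|x| <= M by rewrite ler_norml; apply/andP; split; lra.
    have cx : `|c - x| <= e * M.
      have h : e * `|x| <= e * M by rewrite ler_pM2l.
      apply: le_trans h; have [x0|x0] := leP 0 x.
        rewrite min_l in c1; last by nra.
        rewrite max_r in c2; last by nra.
        by clear -c1 c2 x0; rewrite !ger0_norm; lra.
      rewrite min_r in c1; last by nra.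
      rewrite max_l in c2; last by nra.
      by clear -c1 c2 x0; rewrite ler0_norm ?ltr0_norm//; lra.
    have eM : e * M <= M by rewrite ler_piMl// ltW.
    have [f /andP[f1 f2] ef] := MVT_between x c d2.
    have fS : `|ddQ f| <= S.
      apply: HS; move: xM cx; rewrite !ler_norml => /andP[x1 x2] /andP[cx1 cx2].
      apply/andP; split.
        by apply: le_trans f1; rewrite le_min; clear -x1 cx1 eM M0; apply/andP; split; lra.
      by apply: le_trans f2 _; rewrite ge_max; clear -x2 cx2 eM M0; apply/andP; split; lra.
    have dc : `|dQ c| <= L + S * (e * M).
      have -> : dQ c = dQ x + ddQ f * (c - x) by rewrite -ef; ring.
      apply: le_trans (ler_normD _ _) _; apply: lerD; first exact: HL.
      by rewrite normrM; exact: ler_pM.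
    apply: le_trans (ler_norm _) _; rewrite normrM mulrC; apply: ler_pM => //.
    have -> : (1 + e) * x - x = e * x by ring.
    by rewrite normrM gtr0_norm// ler_pM2l.
  have {Qe}[qe [Eqe qe0 qeq]] : exists x, [/\ (\int[pe]_x (Q x)%:E)%E = x%:E, 0 <= x & x <= q + e * M * (L + S * (e * M))].
    by apply: ge0_fin => //; apply: integral_ge0 => x _; rewrite lee_fin.
  have [we [Ewe we0 wew]] : exists x, [/\ (\int[pe]_x pot pe x)%E = x%:E, 0 <= x & x <= W].
    apply: ge0_fin; first by apply: integral_ge0 => x _; exact: pot_ge0.
    by apply: le_trans We; rewrite leeDl// lee_fin mulr_ge0//; lra.
  have := pmin pe; rewrite /energy pW pq Ewe Eqe -!(EFinM, EFinD) lee_fin.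
  move: We; rewrite Ewe -EFinD lee_fin => We h.
  have h2 : e / 2 * E <= 2 * b * (e * M * (L + S * (e * M))).
    have : 2 * b * qe <= 2 * b * (q + e * M * (L + S * (e * M))) by rewrite ler_pM2l// mulr_gt0.
    clear -h We; lra.
  rewrite -(ler_pM2l (_ : 0 < e / 2)); last lra.
  by apply: le_trans h2 _; rewrite le_eqVlt; apply/orP; left; apply/eqP; field.
apply/ler_addgt0Pl => t t0.
set A := 4 * b * M * (S * M).
have A0 : 0 <= A by rewrite !mulr_ge0// ltW.
have e01 : 0 < Num.min 1 (t / (1 + A)) <= 1.
  by rewrite lt_min ltr01 divr_gt0 ?ge_min ?lexx//; lra.
apply: le_trans (main _ e01) _; set e := Num.min _ _ in e01 *.
have : e * (1 + A) <= t by rewrite -ler_pdivlMr ?ge_min ?lexx ?orbT//; lra.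
case/andP: e01 => e0 _.
have -> : 4 * b * M * (L + S * (e * M)) = 4 * b * M * L + e * A by rewrite /A; ring.
lra.
Qed.

Lemma exp_le_K (R : realType) (z : R) : ((expR (- (4 * `|z|)))%:E <= K z)%E.
Proof.
have [->|z0] := eqVneq z 0; first by rewrite K_0 leey.
rewrite K_kr// lee_fin -kr_norm.
have {}z0 : 0 < `|z| by rewrite normr_gt0.
rewrite kr_artanh//; set w := `|z| in z0 *.
have u0 := expR_gt0 (- (2 * w)).
have u1 : expR (- (2 * w)) < 1 by rewrite -expR0 ltr_expR oppr_lt0 mulr_gt0.
have -> : expR (- (4 * w)) = expR (- (2 * w)) * expR (- (2 * w)) by rewrite -expRD; congr expR; ring.
set u := expR _ in u0 u1 *.
have h : 0 <= u < 1 by rewrite ltW.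
have /andP[+ _] := artanh_series 1 h.
rewrite big_ord1 muln0 add0n divr1 expr1; nra.
Qed.

(** Cauchy-Schwarz against the uniform measure on [- M, M]: its self-energy is at most 6 / M, and
    every x in [- M, M] has a segment of length m within distance 1 inside it, which bounds the
    mixed energy below by exp(-4) m / (2M). *)
Lemma exp_energy_ge (R : realType) (p : probability (measurableTypeR R) R) (M m : R) :
  p (~` `[- M, M]%classic) = 0%E -> 0 < m <= 1 -> m <= M ->
  ((expR (- 8) * m ^+ 2 / (24 * M))%:E <= dint (fun z => expR (- (4 * `|z|))) p p)%E.
Proof.
move=> pM /andP[m0 m1] mM.
have M0 : 0 < M by lra.
have MM : - M < M by lra.
have [mk k0' kcs] := @cs_kernel_exp R 4 ltac:(lra).
set k := fun z => _ in mk kcs *.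
have k0 z : 0 <= k z by exact: k0'.
have k1 z : k z <= 1 by rewrite /k -expR0 ler_expR oppr_le0 mulr_ge0.
pose nu : probability (measurableTypeR R) R := uniform_prob MM.
have [|X [EX X0 _]] := @ge0_fin R (dint k p p) 1 (dint_ge0 _ _ k0); first exact: dint_le_cst.
have [|Y [EY Y0 _]] := @ge0_fin R (dint k nu p) 1 (dint_ge0 _ _ k0); first exact: dint_le_cst.
have [|Z [EZ Z0 ZM]] := @ge0_fin R (dint k nu nu) (6 / M) (dint_ge0 _ _ k0).
  rewrite /dint; apply: integral_le_cst; first exact: measurable_kernel_pot.
    by move=> x; apply: integral_ge0 => y _; rewrite lee_fin.
  move=> x; have -> : 6 / M = 12 / (M - - M) by rewrite opprK -mulr2n -mulr_natl; field; rewrite gt_eqF.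
  apply: le_trans (avg_K_le_long MM x); apply: ge0_le_integral => //.
  - by move=> y _; rewrite lee_fin.
  - exact: measurable_kernel_subr.
  - exact: measurable_K_sub.
  - by move=> y _; rewrite K_subC; exact: exp_le_K.
set y := expR (- 4) * m / 2.
have y0 : 0 < y by rewrite divr_gt0// mulr_gt0// expR_gt0.
have YM : y / M <= Y.
  rewrite -lee_fin -EY /dint -[leLHS]mule1 -(probability_setT p) -integral_cst//.
  have yM : 0 <= y / M by rewrite divr_ge0 ?ltW.
  apply: ae_ge0_le_integral => //.
  - by move=> x _; apply: integral_ge0 => z _; rewrite lee_fin.
  - exact: measurable_kernel_pot.
  exists (~` `[- M, M]%classic); split => //; first exact: measurableC.
  move=> x /= /not_implyP[_]; apply: contra_not.
  rewrite in_itv/= => /andP[x1 x2].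
  rewrite integral_uniform//; [|exact: measurable_kernel_subr|by move=> z; rewrite lee_fin].
  have -> : y / M = (M - - M)^-1 * (expR (- 4) * m) by rewrite /y opprK -mulr2n -mulr_natl; field; rewrite gt_eqF.
  rewrite EFinM; apply: lee_wpmul2l; first by rewrite lee_fin invr_ge0; lra.
  have [u [v [uv vu uM vM Huv]]] : exists u v : R, [/\ u < v, v - u = m, - M <= u, v <= M &
      forall z, u <= z <= v -> `|x - z| <= 1].
    have [h|h] := leP (x + m) M.
      exists x, (x + m); split; [lra|ring|lra|lra|move=> z /andP[z1 z2]].
      by rewrite ler0_norm; lra.
    exists (x - m), x; split; [lra|ring|lra|lra|move=> z /andP[z1 z2]].
    by rewrite ger0_norm; lra.
  apply: (@le_trans _ _ (\int[lebesgue_measure]_(z in `[u, v]) (k (x - z))%:E)%E); last first.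
    apply: ge0_subset_integral => //.
    - exact: measurable_funTS (measurable_kernel_subr _ _).
    - by move=> z _; rewrite lee_fin.
    - by apply: subset_itv; rewrite bnd_simp.
  rewrite -vu -integral_cst_itv//; apply: ge0_le_integral => //.
  - exact: measurable_funTS (measurable_kernel_subr _ _).
  - move=> z /=; rewrite in_itv/= => /Huv h; rewrite lee_fin /k ler_expR; lra.
(* The optimal parameter for these bounds: the ratio of y / M to 6 / M. *)
have s0 : 0 < y / 6 by lra.
have := kcs nu p (y / 6) s0; rewrite EX EY EZ -!(EFinM, EFinD) !lee_fin => h.
have -> : expR (- 8) * m ^+ 2 / (24 * M) = y * (y / M) / 6.
  rewrite /y; have -> : expR (- 8 : R) = expR (- 4) * expR (- 4) by rewrite -expRD; congr expR; ring.
  by field; rewrite gt_eqF.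
have h1 : (y / 6) * (2 * Y) <= (y / 6) ^+ 2 * Z + X.
  rewrite -(ler_pM2l s0) in h; apply: le_trans h _.
  by rewrite le_eqVlt; apply/orP; left; apply/eqP; field; rewrite gt_eqF.
have h2 : (y / 6) ^+ 2 * Z <= (y / 6) ^+ 2 * (6 / M) by rewrite ler_wpM2l// sqr_ge0.
have h3 : (y / 6) * (2 * (y / M)) <= (y / 6) * (2 * Y) by rewrite !ler_pM2l.
have e1 : (y / 6) ^+ 2 * (6 / M) = y * (y / M) / 6 by field; rewrite gt_eqF.
have e2 : (y / 6) * (2 * (y / M)) = 2 * (y * (y / M) / 6) by field; rewrite gt_eqF.
rewrite e1 in h2; rewrite e2 in h3; lra.
Qed.

(** * The discrete problem *)

Definition Dsum {R : realType} (n : nat) (a : 'I_n -> R) : \bar R :=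
  (\sum_(i < n) \sum_(j < n | j != i) K (a i - a j))%E.

Lemma Dsum_ge0 (R : realType) (n : nat) (a : 'I_n -> R) : (0 <= Dsum a)%E.
Proof. by apply: sume_ge0 => i _; apply: sume_ge0 => j _; exact: K_ge0. Qed.

Lemma big_ord_neq (R : realType) (n : nat) (i : 'I_n.+1) (f : 'I_n.+1 -> \bar R) :
  (\sum_(j < n.+1 | j != i) f j = \sum_(k < n) f (lift i k))%E.
Proof.
rewrite big_mkcond (bigD1_ord i)//= eqxx/= add0e.
by apply: eq_bigr => k _; rewrite eq_sym neq_lift.
Qed.

Lemma big_ord_neq_lift (R : realType) (n : nat) (i : 'I_n.+1) (k : 'I_n)
    (f : 'I_n.+1 -> \bar R) :
  (\sum_(j < n.+1 | j != lift i k) f j = f i + \sum_(l < n | l != k) f (lift i l))%E.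
Proof.
rewrite big_mkcond (bigD1_ord i)//= neq_lift [in RHS]big_mkcond; congr (_ + _)%E.
by apply: eq_bigr => l _; rewrite (inj_eq (@lift_inj _ i)).
Qed.

Lemma Dsum_lift (R : realType) (n : nat) (i : 'I_n.+1) (a : 'I_n.+1 -> R) :
  Dsum a = (2%:E * \sum_(k < n) K (a i - a (lift i k)) + Dsum (fun k => a (lift i k)))%E.
Proof.
rewrite /Dsum (bigD1_ord i)//= big_ord_neq.
under [X in (_ + X)%E]eq_bigr do rewrite big_ord_neq_lift.
rewrite big_split /= addeA; congr (_ + _)%E.
have -> : (2%:E = 1%:E + 1%:E :> \bar R)%E by rewrite -EFinD.
rewrite ge0_muleDl// ?mul1e//.
by congr (_ + _)%E; apply: eq_bigr => k _; rewrite K_subC.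
Qed.

Lemma IDE (R : realType) (Q : R -> R) (n : nat) (beta : R) (a : 'I_n -> R) :
  ID Q beta a = ((n%:R / (n%:R - 1))%:E * Dsum a + (2 * beta * \sum_(i < n) Q (a i))%:E)%E.
Proof. by []. Qed.

Lemma ID_perm (R : realType) (Q : R -> R) (n : nat) (beta : R) (a : 'I_n -> R)
    (s : 'I_n -> 'I_n) : injective s -> ID Q beta (a \o s) = ID Q beta a.
Proof.
move=> si; rewrite !IDE; congr (_ * _ + _)%E.
  rewrite /Dsum [RHS](reindex_inj si); apply: eq_bigr => i _ /=.
  rewrite [RHS](reindex_inj si) /=; apply: eq_bigl => j.
  by rewrite (inj_eq si).
by congr (_ * _)%:E; rewrite [RHS](reindex_inj si).
Qed.

Lemma sorting_perm (R : realType) (n : nat) (a : 'I_n -> R) : injective a ->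
  exists2 s : 'I_n -> 'I_n, injective s & ordered (a \o s).
Proof.
move=> ai; case: n a ai => [|n] a ai; first by exists id => // -[].
pose r := relpre a <=%R.
have tot : total r by move=> x y; exact: le_total.
have tr : transitive r by move=> x y z; exact: le_trans.
pose s := sort r (enum 'I_n.+1).
have ss : size s = n.+1 by rewrite size_sort size_enum_ord.
have su : uniq s by rewrite sort_uniq enum_uniq.
exists (fun i : 'I_n.+1 => nth ord0 s i).
  by move=> i j /eqP; rewrite nth_uniq ?ss// => /eqP /val_inj.
move=> i j ij /=; rewrite lt_neqAle; apply/andP; split.
  by rewrite (inj_eq ai) nth_uniq ?ss// ltn_eqF.
have so : sorted r s by exact: sort_sorted.
by apply: (sorted_ltn_nth tr ord0 so) => //; rewrite inE ss.
Qed.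

(** Distinct points can be sorted without changing the energy, and coinciding points have infinite
    energy. Hence competitors may be sampled, or have a point moved, regardless of order. *)
Lemma ID_minimizer_any (R : realType) (Q : R -> R) (n : nat) (beta : R)
    (a b : 'I_n -> R) : (1 < n)%N -> ID_minimizer Q beta a -> (ID Q beta a <= ID Q beta b)%E.
Proof.
move=> n1 [_ amin]; have [bi|bi] := pselect (injective b).
  have [s si so] := sorting_perm bi.
  by rewrite -(ID_perm Q beta b si); exact: amin.
have [i [j [bij ij]]] : exists i j, b i = b j /\ i != j.
  apply: contrapT => H; apply: bi => i j e; apply: contrapT => ij.
  by apply: H; exists i, j; split => //; apply/eqP.
case: n n1 {amin} a b bi i j bij ij => // n n1 a b _ i j bij ij.
suff -> : ID Q beta b = +oo%E by exact: leey.
rewrite IDE (Dsum_lift i).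
have [k ek] : exists k, j = lift i k by case: (unlift_some ij) => k ek _; exists k.
have -> : (\sum_(l < n) K (b i - b (lift i l)) = +oo)%E.
  apply/eqP; rewrite esum_eqy => [|l _]; last by rewrite gt_eqF// (lt_le_trans _ (K_ge0 _))// ltNy0.
  by apply/existsP; exists k; rewrite -ek bij subrr K_0 eqxx.
rewrite gt0_muley ?lte_fin//.
rewrite addye; last by rewrite gt_eqF// (lt_le_trans _ (Dsum_ge0 _))// ltNy0.
rewrite gt0_muley ?addye// lte_fin divr_gt0 ?ltr0n//.
by rewrite subr_gt0 ltr1n.
Qed.

Lemma pmul_fin (R : realType) (r c : R) (x : \bar R) : 0 < r -> (0 <= x)%E ->
  (r%:E * x <= c%:E)%E -> exists v : R, x = v%:E /\ 0 <= v.
Proof.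
move=> r0 x0; rewrite -lee_pdivlMl// -EFinM => h.
by have [v [-> v0 _]] := ge0_fin x0 h; exists v.
Qed.

(* Points are drawn one at a time: the left-hand side is the expected energy
   once k points are fixed and m further points remain to be drawn from p. *)
Lemma energy_sampling (R : realType) (p : probability (measurableTypeR R) R) (Q : R -> R)
    (W q c d e : R) (k : nat) : measurable_fun [set: R] Q -> (forall x, 0 <= Q x) ->
  (\int[p]_x pot p x = W%:E)%E -> (\int[p]_x (Q x)%:E = q%:E)%E ->
  0 < c -> 0 <= d -> 0 < e ->
  forall m : nat, exists a : 'I_k -> R,
  ((c / 2)%:E * Dsum a + (c * m%:R)%:E * \sum_(i < k) pot p (a i) +
     (d * \sum_(i < k) Q (a i))%:E <=
   (c * (k%:R * (k%:R - 1) / 2) * W + c * m%:R * k%:R * W + d * k%:R * q + e * k%:R)%:E)%E.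
Proof.
move=> mQ Q0 pW pq c0 d0 e0; elim: k => [|k IH] m.
  exists (fun=> 0); rewrite /Dsum !big_ord0 !mule0 !mulr0 !mul0r !mulr0 !adde0.
  by rewrite lee_fin; lra.
(* The point about to be fixed still counts among those to be drawn in the induction hypothesis. *)
have [a Ha] := IH m.+1.
have cm0 (l : nat) : (0 <= (c * l%:R)%:E)%E by rewrite lee_fin mulr_ge0// ltW.
have c2 : (0 <= (c / 2)%:E)%E by rewrite lee_fin; lra.
have sV0 : (0 <= \sum_(i < k) pot p (a i))%E by apply: sume_ge0 => i _; exact: pot_ge0.
have sQ0 : 0 <= \sum_(i < k) Q (a i) by apply: sumr_ge0.
have dQ0 : (0 <= (d * \sum_(i < k) Q (a i))%:E)%E by rewrite lee_fin mulr_ge0.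
have D0' := Dsum_ge0 a.
have [v [Ev v0]] : exists v : R, (\sum_(i < k) pot p (a i))%E = v%:E /\ 0 <= v.
  apply: (@pmul_fin _ (c * m.+1%:R)) => //; first by rewrite mulr_gt0.
  apply: le_trans Ha; apply: (@le_trans _ _ ((c / 2)%:E * Dsum a + (c * m.+1%:R)%:E * \sum_(i < k) pot p (a i))%E).
    by rewrite leeDr// mule_ge0.
  by rewrite leeDl.
have [D [ED D0]] : exists D : R, Dsum a = D%:E /\ 0 <= D.
  apply: (@pmul_fin _ (c / 2)) => //; first lra.
  apply: le_trans Ha; apply: (@le_trans _ _ ((c / 2)%:E * Dsum a + (c * m.+1%:R)%:E * \sum_(i < k) pot p (a i))%E).
    by rewrite leeDl// mule_ge0.
  by rewrite leeDl.
have [x Hx] : exists x, (c%:E * \sum_(i < k) K (x - a i) + (c * m%:R)%:E * pot p x +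
    (d * Q x)%:E <= (c * v + c * m%:R * W + d * q + e)%:E)%E.
  apply: (@exists_le_integral _ p) => //.
  - apply: emeasurable_funD; last by apply/measurable_EFinP; exact: measurable_funM.
    apply: emeasurable_funD; last by apply: emeasurable_funM => //; exact: measurable_pot.
    apply: emeasurable_funM => //; apply: emeasurable_sum => i; exact: measurable_K_sub.
  - move=> y; rewrite !adde_ge0//.
    + rewrite mule_ge0//; first by rewrite lee_fin ltW.
      by apply: sume_ge0 => i _; exact: K_ge0.
    + by rewrite mule_ge0// pot_ge0.
    + by rewrite lee_fin mulr_ge0.
  have mS : measurable_fun [set: R] (fun y : R => \sum_(i < k) K (y - a i))%E.
    by apply: emeasurable_sum => i; exact: measurable_K_sub.
  have S0 (y : R) : (0 <= \sum_(i < k) K (y - a i))%E by apply: sume_ge0 => i _; exact: K_ge0.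
  have mP := measurable_pot p.
  have P0 := pot_ge0 p.
  have mdQ : measurable_fun [set: R] (fun y : R => (d * Q y)%:E).
    by apply/measurable_EFinP; exact: measurable_funM.
  have c0' : (0 <= c%:E)%E by rewrite lee_fin ltW.
  rewrite ge0_integralD//; last 3 first.
  - by move=> y _; rewrite adde_ge0// mule_ge0.
  - by apply: emeasurable_funD; apply: emeasurable_funM.
  - by move=> y _; rewrite lee_fin mulr_ge0.
  rewrite ge0_integralD//; last 4 first.
  - by move=> y _; rewrite mule_ge0.
  - exact: emeasurable_funM.
  - by move=> y _; rewrite mule_ge0.
  - exact: emeasurable_funM.
  rewrite !ge0_integralZl//.
  rewrite ge0_integral_sum//; last 2 first.
  - by move=> i; exact: measurable_K_sub.
  - by move=> i y _; exact: K_ge0.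
  have -> : (\sum_(i < k) \int[p]_y K (y - a i) = v%:E)%E.
    by rewrite -Ev; apply: eq_bigr => i _; apply: eq_integral => y _; exact: K_subC.
  under [X in (_ + X)%E]eq_integral do rewrite EFinM.
  rewrite ge0_integralZl//; [|by apply/measurable_EFinP|by move=> y _; rewrite lee_fin].
  by rewrite pW pq -!(EFinM, EFinD).
exists (fun i => if unlift ord0 i is Some j then a j else x).
rewrite (Dsum_lift ord0) !(bigD1_ord ord0)//= unlift_none.
under eq_bigr do rewrite liftK.
have -> : Dsum (fun j : 'I_k => if unlift ord0 (lift ord0 j) is Some j then a j else x) = Dsum a.
  by congr Dsum; apply/funext => j; rewrite liftK.
under [X in (_ + _ * (_ + X))%E]eq_bigr do rewrite liftK.
under [X in (d * (_ + X))%R]eq_bigr do rewrite liftK.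
rewrite ED Ev in Ha *.
set S := (\sum_(i < k) K (x - a i))%E in Hx *; set P := pot p x in Hx *.
have S0 : (0 <= S)%E by apply: sume_ge0 => i _; exact: K_ge0.
have P0 : (0 <= P)%E by exact: pot_ge0.
have -> : ((c / 2)%:E * (2%:E * S + D%:E) = c%:E * S + (c / 2 * D)%:E)%E.
  by rewrite ge0_muleDr ?mule_ge0 ?lee_fin// muleA -!EFinM divfK.
have -> : ((c * m%:R)%:E * (P + v%:E) = (c * m%:R)%:E * P + (c * m%:R * v)%:E)%E.
  by rewrite ge0_muleDr ?lee_fin// -EFinM.
rewrite mulrDr EFinD.
rewrite (addeACA (c%:E * S)%E) (addeACA (c%:E * S + (c * m%:R)%:E * P)%E).
apply: (le_trans (leeD Hx (lexx _))).
rewrite -!EFinD lee_fin; rewrite -!(EFinM, EFinD) lee_fin in Ha.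
have nS (l : nat) : l.+1%:R = l%:R + 1 :> R by rewrite natr1.
rewrite nS in Ha; rewrite nS.
set M : R := m%:R in Ha *; set N : R := k%:R in Ha *.
clear -Ha; lra.
Qed.

Lemma ordered_neq (R : realType) (n : nat) (a : 'I_n -> R) (i j : 'I_n) :
  ordered a -> j != i -> a i - a j != 0.
Proof.
move=> ao ji; rewrite subr_eq0.
case: (ltngtP i j) => [/ao h|/ao h|/val_inj e]; [by rewrite lt_eqF|by rewrite gt_eqF|].
by rewrite e eqxx in ji.
Qed.

Lemma Dsum_ordered (R : realType) (n : nat) (a : 'I_n -> R) : ordered a ->
  Dsum a = (\sum_(i < n) \sum_(j < n | j != i) kr (a i - a j))%:E.
Proof.
move=> ao; rewrite /Dsum -sumEFin; apply: eq_bigr => i _.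
by rewrite -sumEFin; apply: eq_bigr => j ji; rewrite K_kr//; exact: ordered_neq.
Qed.

(** Each point in turn is moved to x and the resulting inequalities are summed. Every K (x - a j)
    occurs in all replacements but one, and this count cancels the denominator of the prefactor n /
    (n - 1). *)
Lemma discrete_euler_lagrange (R : realType) (Q : R -> R) (n : nat) (beta : R)
    (a : 'I_n.+2 -> R) (x D : R) : ID_minimizer Q beta a -> Dsum a = D%:E ->
  ((n.+2%:R / (n.+2%:R - 1) * D + beta * \sum_(i < n.+2) Q (a i))%:E <=
   n.+2%:R%:E * \sum_(j < n.+2) K (x - a j) + (n.+2%:R * beta * Q x)%:E)%E.
Proof.
move=> amin aD.
have [[j xj]|xa] := pselect (exists j, x = a j).
  have -> : (\sum_(j < n.+2) K (x - a j) = +oo)%E.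
    apply/eqP; rewrite esum_eqy => [|l _]; last by rewrite gt_eqF// (lt_le_trans _ (K_ge0 _))// ltNy0.
    by apply/existsP; exists j; rewrite -xj subrr K_0 eqxx.
  by rewrite gt0_muley ?addye ?leey// lte_fin.
have ao := amin.1.
pose s j := kr (x - a j).
have sE j : K (x - a j) = (s j)%:E.
  by rewrite K_kr// subr_eq0; apply/eqP => e; apply: xa; exists j.
under [X in (_ * X)%E]eq_bigr do rewrite sE.
rewrite sumEFin -!(EFinM, EFinD) lee_fin.
set N := n.+2%:R / (n.+2%:R - 1).
pose t i := \sum_(j < n.+2 | j != i) kr (a i - a j).
have D_t : D = \sum_i t i by move: aD; rewrite Dsum_ordered// => -[].
have tE i : (\sum_(k < n.+1) K (a i - a (lift i k)) = (t i)%:E)%E.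
  rewrite -(big_ord_neq i (fun j => K (a i - a j))) /t -sumEFin; apply: eq_bigr => j ji.
  by rewrite K_kr//; exact: ordered_neq.
have n0 : 0 < n.+2%:R - 1 :> R by rewrite subr_gt0 ltr1n.
have N0 : 0 < N by rewrite divr_gt0.
have main i : N * t i + beta * Q (a i) <= N * (\sum_j s j - s i) + beta * Q x.
  pose a' k := if k == i then x else a k.
  have := @ID_minimizer_any _ _ _ _ a a' isT amin.
  have a'l k : a' (lift i k) = a (lift i k) by rewrite /a' eq_sym (negbTE (neq_lift _ _)).
  have a'i : a' i = x by rewrite /a' eqxx.
  rewrite !IDE !(Dsum_lift i) tE a'i.
  have -> : Dsum (fun k => a' (lift i k)) = Dsum (fun k => a (lift i k)).
    by congr Dsum; apply/funext => k; exact: a'l.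
  have [r [-> _]] : exists r, Dsum (fun k => a (lift i k)) = r%:E /\ 0 <= r.
    apply: (@pmul_fin _ 1 D) => //; first exact: Dsum_ge0.
    rewrite mul1e -aD (Dsum_lift i a) leeDr// mule_ge0//.
    by apply: sume_ge0 => k _; exact: K_ge0.
  have -> : (\sum_(k < n.+1) K (x - a' (lift i k)) = (\sum_j s j - s i)%:E)%E.
    rewrite (bigD1_ord i)//= addrAC subrr add0r -sumEFin; apply: eq_bigr => k _.
    by rewrite a'l sE.
  have -> : \sum_(k < n.+2) Q (a' k) = Q x + \sum_(k < n.+1) Q (a (lift i k)).
    by rewrite (bigD1_ord i)//= a'i; congr (_ + _); apply: eq_bigr => k _; rewrite a'l.
  have -> : \sum_(k < n.+2) Q (a k) = Q (a i) + \sum_(k < n.+1) Q (a (lift i k)).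
    by rewrite (bigD1_ord i).
  rewrite -!(EFinM, EFinD) lee_fin -/N; set A := \sum_(_ < _) Q _; lra.
have := ler_sum (index_enum 'I_n.+2) (fun i (_ : true) => main i).
rewrite !big_split /= -!mulr_sumr -D_t !sumr_const card_ord sumrB sumr_const card_ord.
move=> h; apply: le_trans h _.
rewrite -(mulr_natl (\sum_(j < n.+2) s j)) -(mulr_natl (Q x)) (mulrCA beta) mulrA lerD2r /N le_eqVlt; apply/orP; left; apply/eqP; field; rewrite gt_eqF//.
Qed.

(** * Equilibrium measures of finite sets *)

Lemma continuous_bigsum (R : realType) (T : topologicalType) (I : Type) (r : seq I)
    (F : I -> T -> R) :
  (forall i, continuous (F i)) -> continuous (fun w => \sum_(i <- r) F i w).
Proof.
move=> cF; elim: r => [|i r IH].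
  by under eq_fun do rewrite big_nil; move=> x; exact: cvg_cst.
under eq_fun do rewrite big_cons; move=> x.
by apply: cvgD; [exact: cF|exact: IH].
Qed.

Definition simplex {R : realType} (m : nat) : set 'rV[R]_m :=
  [set w | (forall i, 0 <= w ord0 i) /\ \sum_i w ord0 i = 1].

Lemma simplex_le1 (R : realType) (m : nat) (w : 'rV[R]_m) i : simplex w -> w ord0 i <= 1.
Proof.
move=> [w0 w1]; rewrite -w1 (bigD1 i)//= lerDl.
by apply: sumr_ge0 => j _; exact: w0.
Qed.

Lemma compact_simplex (R : realType) (m : nat) : compact (@simplex R m).
Proof.
have cc i : continuous (fun w : 'rV[R]_m => w ord0 i) by exact: coord_continuous.
apply: (@subclosed_compact _ _ [set w : 'rV[R]_m | forall i, w ord0 i \in `[0, 1]]).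
- have -> : @simplex R m = (\bigcap_i ((fun w : 'rV[R]_m => w ord0 i) @^-1` [set x | 0 <= x])) `&`
      ((fun w : 'rV[R]_m => \sum_i w ord0 i) @^-1` [set x | x = 1]).
    by apply/seteqP; split => [w [w0 w1]|w [w0 w1]]; split => // i; [move=> _; exact: w0|exact: (w0 i)].
  apply: closedI; last first.
    by apply: closed_comp; [move=> w _; exact: continuous_bigsum|exact: closed_eq].
  by apply: closed_bigI => i _; apply: closed_comp; [move=> w _; exact: cc|exact: closed_ge].
- by apply: (@rV_compact R m (fun=> `[0, 1]%classic)) => _; exact: segment_compact.
- by move=> w sw i; rewrite in_itv/= simplex_le1// andbT; case: sw.
Qed.

(** First-order conditions at a minimizer of the quadratic form over the simplex. For a kernel
    matrix, w is an equilibrium measure and g both its energy and the value of its potential at its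
    atoms. *)
Lemma quadratic_min (R : realType) (m : nat) (A : 'I_m.+1 -> 'I_m.+1 -> R) :
  (forall i j, A i j = A j i) ->
  exists (w : 'I_m.+1 -> R) (g : R), [/\ forall i, 0 <= w i, \sum_i w i = 1,
    forall k, g <= \sum_j w j * A k j & forall k, 0 < w k -> \sum_j w j * A k j = g].
Proof.
move=> Asym.
pose f (w : 'rV[R]_m.+1) := \sum_i \sum_j w ord0 i * w ord0 j * A i j.
have cf : continuous f.
  apply: continuous_bigsum => i; apply: continuous_bigsum => j w.
  apply: (@continuousM R _ (fun w : 'rV[R]_m.+1 => w ord0 i * w ord0 j) (fun=> A i j) w).
    by apply: (@continuousM R _ (fun w : 'rV[R]_m.+1 => w ord0 i) (fun w => w ord0 j) w);
      exact: coord_continuous.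
  exact: cst_continuous.
have [|||w /set_mem[w0 w1] wmin] := @EVT_min_rV R m.+1 f (@simplex R m.+1).
- exists (\row_i (i == ord0)%:R); split => [i|]; first by rewrite mxE.
  rewrite (bigD1 ord0)//= mxE eqxx big1 ?addr0// => i i0.
  by rewrite mxE (negbTE i0).
- exact: compact_simplex.
- exact: continuous_subspaceT.
pose G k := \sum_j w ord0 j * A k j.
pose g := f w.
have gE : g = \sum_i w ord0 i * G i.
  by apply: eq_bigr => i _; rewrite mulr_sumr; apply: eq_bigr => j _; rewrite mulrA.
have Gg k : g <= G k.
  rewrite leNgt; apply/negP => Gk.
  (* Minimality along the segment from w to the vertex k; its first-order coefficient is 2 (G k -
     g). *)
  have main t : 0 <= t <= 1 -> g <= (1 - t) ^+ 2 * g + 2 * t * (1 - t) * G k + t ^+ 2 * A k k.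
    move=> /andP[t0 t1].
    pose v : 'rV[R]_m.+1 := \row_i ((1 - t) * w ord0 i + t * (i == k)%:R).
    have sd (F : 'I_m.+1 -> R) : \sum_i (i == k)%:R * F i = F k.
      by rewrite (bigD1 k)//= eqxx mul1r big1 ?addr0// => i ik; rewrite (negbTE ik) mul0r.
    have sv : simplex v.
      split => [i|]; first by rewrite mxE addr_ge0// mulr_ge0//; lra.
      under eq_bigr do rewrite mxE; rewrite big_split /= -!mulr_sumr w1.
      have := sd (fun=> 1); under eq_bigr do rewrite mulr1; move=> ->; ring.
    have := wmin v (mem_set sv); rewrite -/g; congr (_ <= _).
    have -> : f v = \sum_i ((1 - t) * w ord0 i + t * (i == k)%:R) *
        ((1 - t) * G i + t * A i k).
      apply: eq_bigr => i _.
      under eq_bigr do rewrite !mxE -mulrA; rewrite -mulr_sumr; congr (_ * _).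
      under eq_bigr do rewrite mulrDl -!mulrA; rewrite big_split /= -!mulr_sumr.
      by rewrite (sd (fun j => A i j)).
    have -> : \sum_i ((1 - t) * w ord0 i + t * (i == k)%:R) * ((1 - t) * G i + t * A i k) =
        (1 - t) * ((1 - t) * \sum_i w ord0 i * G i + t * \sum_i w ord0 i * A i k) +
        t * \sum_i (i == k)%:R * ((1 - t) * G i + t * A i k).
      rewrite !mulrDr !mulr_sumr -!big_split /=; apply: eq_bigr => i _; ring.
    rewrite sd -gE.
    have -> : \sum_i w ord0 i * A i k = G k by apply: eq_bigr => i _; rewrite Asym.
    ring.
  have [B [B0 HB]] : exists B : R, 0 < B /\ g - 2 * G k + A k k <= B.
    by exists (Num.max 1 (g - 2 * G k + A k k)); rewrite lt_max ltr01 le_max lexx orbT.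
  have gG : 0 < g - G k by rewrite subr_gt0.
  pose t := Num.min 1 ((g - G k) / B).
  have t0 : 0 < t by rewrite lt_min ltr01 divr_gt0.
  have t1 : t <= 1 by rewrite ge_min lexx.
  have tB : t * B <= g - G k by rewrite -ler_pdivlMr// ge_min lexx orbT.
  have /main : 0 <= t <= 1 by rewrite ltW.
  have h1 : t * (g - 2 * G k + A k k) <= t * B by rewrite ler_pM2l.
  have h2 : t * (t * (g - 2 * G k + A k k)) <= t * (g - G k) by rewrite ler_pM2l//; lra.
  have h3 : 0 < t * (g - G k) by rewrite mulr_gt0.
  lra.
exists (fun i => w ord0 i), g; split => // k wk.
apply/eqP; rewrite eq_le Gg andbT.
have h : \sum_i w ord0 i * (G i - g) = 0.
  by under eq_bigr do rewrite mulrBr; rewrite sumrB -gE -mulr_suml w1 mul1r subrr.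
have : w ord0 k * (G k - g) <= 0.
  rewrite -h (bigD1 k)//= lerDl; apply: sumr_ge0 => i _.
  by rewrite mulr_ge0// subr_ge0.
by rewrite pmulr_rle0// subr_le0.
Qed.

Lemma kd_convex (R : realType) (d t u v e : R) : 0 < d -> 0 <= t <= 1 ->
  (e <= u /\ e <= v) \/ (u <= e /\ v <= e) ->
  kd d (t * u + (1 - t) * v - e) <= t * kd d (u - e) + (1 - t) * kd d (v - e).
Proof.
move=> d0 t01 H; have /andP[t0 t1] := t01; rewrite /kd.
have -> : `|t * u + (1 - t) * v - e| + d = t * (`|u - e| + d) + (1 - t) * (`|v - e| + d).
  case: H => -[h1 h2].
    have h3 : 0 <= t * (u - e) + (1 - t) * (v - e) by rewrite addr_ge0// mulr_ge0; lra.
    by rewrite !ger0_norm; lra.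
  have h3 : t * (u - e) + (1 - t) * (v - e) <= 0.
    have a1 : 0 <= t * (e - u) by rewrite mulr_ge0; lra.
    have a2 : 0 <= (1 - t) * (e - v) by rewrite mulr_ge0; lra.
    lra.
  by rewrite !ler0_norm; lra.
by apply: kr_convex => //; rewrite ltr_wpDl.
Qed.

Lemma kd_far (R : realType) (d x u e : R) : 0 < d -> `|u - e| <= `|x - e| ->
  kd d (x - e) <= kd d (u - e).
Proof. by move=> d0 h; rewrite /kd; apply: kr_nincr; [rewrite ltr_wpDl|rewrite lerD2r]. Qed.

(* An equilibrium measure of a finite set.  Its potential is convex between
   consecutive atoms, hence maximal at an atom. *)
Lemma kd_equilibrium (R : realType) (d : R) (m : nat) (e : 'I_m.+1 -> R) : 0 < d ->
  exists (w : 'I_m.+1 -> R) (g : R), [/\ forall i, 0 <= w i, \sum_i w i = 1,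
    forall i, g <= \sum_j w j * kd d (e i - e j) & forall x, \sum_j w j * kd d (x - e j) <= g].
Proof.
move=> d0.
have [|w [g [w0 w1 gle geq]]] := @quadratic_min R m (fun i j => kd d (e i - e j)).
  by move=> i j; rewrite -(kdN d (e i - e j)) opprB.
exists w, g; split => // x.
have wle (c : R -> R) : (forall j, 0 < w j -> kd d (x - e j) <= c (e j)) ->
    \sum_j w j * kd d (x - e j) <= \sum_j w j * c (e j).
  move=> H; apply: ler_sum => j _.
  have [wj|wj] := ltP 0 (w j); first by rewrite ler_pM2l// H.
  have -> : w j = 0 by apply/eqP; rewrite eq_le wj w0.
  by rewrite !mul0r.
have [k0 wk0] : exists k, 0 < w k.
  apply: contrapT => H; have : \sum_i w i <= 0.
    by apply: sumr_le0 => i _; rewrite leNgt; apply/negP => wi; apply: H; exists i.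
  by rewrite w1 ler10.
pose L k := (0 < w k) && (e k <= x).
pose U k := (0 < w k) && (x <= e k).
have [[l Ll]|nL] := pselect (exists l, L l).
  have [r0|nU] := pselect (exists r, U r).
    case: r0 => r Ur.
    (* The atoms nearest to x on either side: no atom lies strictly between them, so each term of
       the potential is convex there. *)
    pose l' := [arg max_(i > l | L i) e i]%O.
    pose r' := [arg min_(i < r | U i) e i]%O.
    have [Ll' Hl] : L l' /\ forall j, L j -> e j <= e l'.
      by rewrite /l'; case: arg_maxP.
    have [Ur' Hr] : U r' /\ forall j, U j -> e r' <= e j.
      by rewrite /r'; case: arg_minP.
    have /andP[wl lx] := Ll'; have /andP[wr xr] := Ur'.
    have side j : 0 < w j -> (e j <= e l' /\ e j <= e r') \/ (e l' <= e j /\ e r' <= e j).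
      move=> wj; have [h|h] := leP (e j) x.
        by left; have := Hl j; rewrite /L wj h => /(_ isT) h'; split; lra.
      by right; have := Hr j; rewrite /U wj ltW// => /(_ isT) h'; split; lra.
    have [t [t01 xE]] : exists t, 0 <= t <= 1 /\ x = t * e l' + (1 - t) * e r'.
      have [el|el] := eqVneq (e l') (e r').
        by exists 1; split; [rewrite ler01 lexx|rewrite mul1r subrr mul0r; lra].
      have lr : 0 < e r' - e l' by rewrite subr_gt0 lt_neqAle el; lra.
      exists ((e r' - x) / (e r' - e l')); split.
        by rewrite divr_ge0 ?ler_pdivrMr//; lra.
      by field; rewrite gt_eqF.
    have h := wle (fun z => t * kd d (e l' - z) + (1 - t) * kd d (e r' - z)) _.
    apply: le_trans (h _) _.
      by move=> j /side sj; rewrite xE; exact: kd_convex.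
    rewrite -[leRHS](_ : t * g + (1 - t) * g = g); last by ring.
    under eq_bigr do rewrite mulrDr !(mulrCA (w _)).
    by rewrite big_split /= -!mulr_sumr !geq.
  pose l' := [arg max_(i > l | L i) e i]%O.
  have [/andP[wl lx] Hl] : L l' /\ forall j, L j -> e j <= e l'.
    by rewrite /l'; case: arg_maxP.
  rewrite -(geq _ wl); apply: (wle (fun z => kd d (e l' - z))) => j wj.
  have jx : e j <= x.
    by rewrite leNgt; apply/negP => xj; apply: nU; exists j; rewrite /U wj ltW.
  have jl : e j <= e l' by apply: Hl; rewrite /L wj.
  by apply: kd_far => //; rewrite !ger0_norm; lra.
have Uk j : 0 < w j -> x <= e j.
  by move=> wj; rewrite leNgt; apply/negP => xj; apply: nL; exists j; rewrite /L wj ltW.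
pose r' := [arg min_(i < k0 | U i) e i]%O.
have [/andP[wr rx] Hr] : U r' /\ forall j, U j -> e r' <= e j.
  by rewrite /r'; case: arg_minP => //; rewrite /U wk0 Uk.
rewrite -(geq _ wr); apply: (wle (fun z => kd d (e r' - z))) => j wj.
have xj := Uk _ wj.
have jr : e r' <= e j by apply: Hr; rewrite /U wj.
by apply: kd_far => //; rewrite !ler0_norm; lra.
Qed.

Lemma grid_dense (R : realType) (s1 s2 h : R) : s1 <= s2 -> 0 < h ->
  exists (m : nat) (e : 'I_m.+1 -> R), (forall i, s1 <= e i <= s2) /\
    forall x, s1 <= x <= s2 -> exists i, `|x - e i| <= h.
Proof.
move=> s12 h0; pose m := Num.truncn ((s2 - s1) / h).
exists m, (fun i => s1 + i%:R * h).
have sh : 0 <= (s2 - s1) / h by rewrite divr_ge0 ?subr_ge0// ltW.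
split => [i|x /andP[x1 x2]].
  have im : i%:R * h <= s2 - s1.
    rewrite -ler_pdivlMr//; have /andP[+ _] := truncn_itv sh; apply: le_trans.
    by rewrite ler_nat -ltnS ltn_ord.
  have i0 : 0 <= i%:R * h by rewrite mulr_ge0// ltW.
  by apply/andP; split; lra.
have xh : 0 <= (x - s1) / h by rewrite divr_ge0 ?subr_ge0// ltW.
have /andP[k1 k2] := truncn_itv xh; set k := Num.truncn _ in k1 k2.
have km : (k < m.+1)%N.
  rewrite -(ltr_nat R); have /andP[_] := truncn_itv sh; apply: le_lt_trans.
  by apply: le_trans k1 _; rewrite ler_pM2r ?invr_gt0//; lra.
exists (Ordinal km) => /=.
rewrite ler_pdivlMr// in k1; rewrite ltr_pdivrMr// -natr1 in k2.
by rewrite ger0_norm; lra.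
Qed.

(** A domination principle. Both potentials are integrated against an equilibrium measure, for
    [kd d], of a fine grid in [s1, s2]. Its potential is at most g everywhere, wherever the points a
    j lie, and at least g - eta / 4 on [s1, s2], where p lives; a gap eta, of which regularisation
    keeps eta / 2, is then impossible. *)
Lemma potential_compare (R : realType) (p : probability (measurableTypeR R) R) (n : nat)
    (a : 'I_n.+1 -> R) (s1 s2 lam eta : R) : s1 <= s2 ->
  p (~` `[s1, s2]%classic) = 0%E ->
  (forall x, s1 <= x <= s2 -> (pot p x <= lam%:E)%E) ->
  (forall x, s1 <= x <= s2 ->
     (pot p x + eta%:E <= (n.+1%:R^-1)%:E * \sum_j K (x - a j))%E) -> eta <= 0.
Proof.
move=> s12 ps plam H; rewrite leNgt; apply/negP => eta0.
have n0 : 0 < n.+1%:R :> R by rewrite ltr0n.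
(* Within r of some a j a single regularised term already exceeds n (lam + eta), and the bound pot p
   <= lam suffices. At larger distances the shift by d costs at most 2 d kap r <= eta / 2. *)
have [r0 r00 Hr] := kr_unbounded (n.+1%:R * (lam + eta)).
pose r := r0 / 2.
have r_0 : 0 < r by rewrite /r; lra.
have kr0 := kap_gt0 r_0.
have [d [d0 dr dk]] : exists d : R, [/\ 0 < d, d <= r & 2 * d * kap r <= eta / 2].
  exists (Num.min r (eta / 4 / kap r)); split.
  - by rewrite lt_min r_0 divr_gt0//; lra.
  - by rewrite ge_min lexx.
  - have : Num.min r (eta / 4 / kap r) * kap r <= eta / 4.
      by rewrite -ler_pdivlMr// ge_min lexx orbT.
    lra.
have main x : s1 <= x <= s2 ->
    (pot p x + (eta / 2)%:E <= (n.+1%:R^-1 * \sum_j kd d (x - a j))%:E)%E.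
  move=> xs; have [[j xj]|far] := pselect (exists j, `|x - a j| <= r).
    apply: (@le_trans _ _ (lam + eta)%:E).
      by rewrite EFinD; apply: leeD; [exact: plam|rewrite lee_fin; lra].
    rewrite lee_fin mulrC ler_pdivlMr// mulrC.
    apply: (@le_trans _ _ (kd d (x - a j))).
      by rewrite /kd; apply: Hr; [rewrite ltr_wpDl|rewrite /r in xj dr; lra].
    by rewrite (bigD1 j)//= lerDl sumr_ge0// => i _; exact: kd_ge0.
  have fr j : r < `|x - a j| by rewrite ltNge; apply/negP => xj; apply: far; exists j.
  have aj j : x - a j != 0 by rewrite -normr_gt0 (lt_trans r_0).
  have := H _ xs.
  have -> : (\sum_j K (x - a j) = (\sum_j kr (x - a j))%:E)%E.
    by rewrite -sumEFin; apply: eq_bigr => j _; rewrite K_kr.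
  rewrite -EFinM => h.
  have sk : n.+1%:R^-1 * \sum_j kr (x - a j) <= n.+1%:R^-1 * \sum_j kd d (x - a j) + eta / 2.
    have -> : eta / 2 = n.+1%:R^-1 * \sum_(j < n.+1) (eta / 2).
      by rewrite sumr_const card_ord -[X in _ = _ * X]mulr_natl mulrA mulVf ?mul1r// gt_eqF.
    rewrite -mulrDr ler_pM2l ?invr_gt0// -big_split /=; apply: ler_sum => j _.
    rewrite -(kr_norm (x - a j)) /kd.
    have w0 : 0 < `|x - a j| by rewrite normr_gt0.
    have wd : 0 < `|x - a j| + d by rewrite ltr_wpDl.
    have := kr_tangent w0 wd; have := kap_nincr r_0 (ltW (fr j)).
    set k := kap _ => h1 h2.
    have : d * k <= d * kap r by rewrite ler_pM2l.
    lra.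
  have {}h : (pot p x + eta%:E <= (n.+1%:R^-1 * \sum_j kd d (x - a j) + eta / 2)%:E)%E.
    by apply: le_trans h _; rewrite lee_fin.
  have [v [Ev _ _]] := ge0_fin (pot_ge0 p x) (plam _ xs).
  move: h; set Z := n.+1%:R^-1 * _; rewrite Ev -!EFinD !lee_fin; clear => h; lra.
have kd0 := kap_gt0 d0.
(* The kernels have Lipschitz constant 2 kap d, so the grid potential varies by at most eta / 4 over
   a distance h. *)
pose h := eta / 8 / kap d.
have h0 : 0 < h by apply: divr_gt0 => //; exact: divr_gt0.
have [m [e [es enet]]] := grid_dense s12 h0.
have [w [g [w0 w1 gle gge]]] := kd_equilibrium e d0.
have phi_ge x : s1 <= x <= s2 -> g - eta / 4 <= \sum_j w j * kd d (x - e j).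
  move=> /enet[i xi].
  have : g <= \sum_j w j * kd d (x - e j) + \sum_j w j * (eta / 4).
    apply: le_trans (gle i) _; rewrite -big_split /=; apply: ler_sum => j _.
    rewrite -mulrDr ler_wpM2l//; apply: le_trans (kd_lip (e i - e j) (x - e j) d0) _.
    rewrite lerD2l; have -> : e i - e j - (x - e j) = - (x - e i) by ring.
    rewrite normrN; have : kap d * `|x - e i| <= kap d * h by rewrite ler_pM2l.
    have -> : kap d * h = eta / 8 by rewrite /h; field; rewrite gt_eqF.
    lra.
  by rewrite -mulr_suml w1 mul1r; lra.
pose V i := fine (pot p (e i)).
have VE i : pot p (e i) = (V i)%:E.
  by have [v [Ev _ _]] := ge0_fin (pot_ge0 p (e i)) (plam _ (es i)); rewrite /V Ev.
have up : \sum_i w i * V i + eta / 2 <= g.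
  have : \sum_i w i * V i + \sum_i w i * (eta / 2) <=
      \sum_i w i * (n.+1%:R^-1 * \sum_j kd d (e i - a j)).
    rewrite -big_split /=; apply: ler_sum => i _; rewrite -mulrDr ler_wpM2l//.
    by have := main _ (es i); rewrite VE -EFinD lee_fin.
  rewrite -mulr_suml w1 mul1r => h1; apply: le_trans h1 _.
  have -> : \sum_i w i * (n.+1%:R^-1 * \sum_j kd d (e i - a j)) =
      n.+1%:R^-1 * \sum_j \sum_i w i * kd d (a j - e i).
    rewrite exchange_big /= mulr_sumr; apply: eq_bigr => i _.
    rewrite mulrCA; congr (_ * _); rewrite mulr_sumr; apply: eq_bigr => j _.
    by rewrite -(kdN d (e i - a j)) opprB.
  rewrite mulrC ler_pdivrMr//.
  apply: (@le_trans _ _ (\sum_(j < n.+1) g)); first by apply: ler_sum => j _; exact: gge.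
  by rewrite sumr_const card_ord mulr_natr.
(* By symmetry the sum is the p-integral of the grid potential for [K], which dominates the one for
   [kd d]. *)
have lo : g - eta / 4 <= \sum_i w i * V i.
  rewrite -lee_fin -sumEFin.
  have -> : (\sum_i (w i * V i)%:E = \int[p]_y \sum_i (w i)%:E * K (e i - y))%E.
    rewrite ge0_integral_sum//; last 2 first.
    - by move=> i; apply: emeasurable_funM => //; exact: measurable_K_subr.
    - by move=> i y _; rewrite mule_ge0 ?K_ge0// lee_fin.
    apply: eq_bigr => i _; rewrite EFinM -VE ge0_integralZl//; first exact: measurable_K_subr.
      by move=> y _; exact: K_ge0.
    by rewrite lee_fin.
  have [gp|gn] := leP 0 (g - eta / 4); last first.
    apply: (@le_trans _ _ 0%E); first by rewrite lee_fin ltW.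
    apply: integral_ge0 => y _; apply: sume_ge0 => i _.
    by rewrite mule_ge0 ?K_ge0// lee_fin.
  rewrite -[leLHS]mule1 -(probability_setT p) -integral_cst//.
  apply: ae_ge0_le_integral => //.
  - by move=> y _; apply: sume_ge0 => i _; rewrite mule_ge0 ?K_ge0// lee_fin.
  - apply: emeasurable_sum => i; apply: emeasurable_funM => //; exact: measurable_K_subr.
  exists (~` `[s1, s2]%classic); split => //; first exact: measurableC.
  move=> y /= /not_implyP[_]; apply: contra_not; rewrite in_itv/= => ys.
  apply: (@le_trans _ _ (\sum_j w j * kd d (y - e j))%:E); first by rewrite lee_fin phi_ge.
  rewrite -sumEFin; apply: lee_sum => j _; rewrite EFinM lee_wpmul2l ?lee_fin//.
  by rewrite K_subC; exact: kd_le_K.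
lra.
Qed.

(** * Comparison of the energies *)

(** The numbers x, y, z are the [kd d] energies of the empirical measure, of the pair, and of p. The
    term kr d / n is the diagonal, n values kd d 0 over n^2, and D bounds what regularisation takes
    from the potential of p. Everything after this is real arithmetic. *)
Lemma kd_comparison (R : realType) (Q : R -> R) (b : R)
    (p : probability (measurableTypeR R) R) (lam W d D T : R) (n : nat) (a : 'I_n.+1 -> R) :
  euler_lagrange Q b p lam -> (\int[p]_x pot p x = W%:E)%E -> 0 < d <= 1 / 2 ->
  (forall x, (gpot (4 * d) p x <= D%:E)%E) -> Dsum a = T%:E ->
  exists x y z : R, [/\ x - kr d / n.+1%:R <= T / n.+1%:R ^+ 2,
    lam <= y + D + b * (n.+1%:R^-1 * \sum_i Q (a i)), 0 <= z <= W, W <= z + D &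
    forall s, 0 < s -> 2 * y <= s * x + s^-1 * z].
Proof.
move=> [cQ Q0 b0 EL1 _] pW /andP[d0 d2] HD aT.
have [mk k0 kcs] := cs_kernel_kd d0.
have kle z : kd d z <= kr d by exact: kd_le.
have n0 : 0 < n.+1%:R :> R by rewrite ltr0n.
have [nu Hnu] := probability_empirical a.
have finp (mu1 mu2 : probability (measurableTypeR R) R) : exists v : R, dint (kd d) mu1 mu2 = v%:E /\ 0 <= v.
  have [|v [-> v0 _]] := @ge0_fin R (dint (kd d) mu1 mu2) (kr d) (dint_ge0 _ _ k0); last by exists v.
  exact: dint_le_cst.
have Ufin (x : R) : exists v : R, (\int[p]_y (kd d (x - y))%:E)%E = v%:E /\ 0 <= v.
  have [| |v [-> v0 _]] := @ge0_fin R (\int[p]_y (kd d (x - y))%:E)%E (kr d); last by exists v.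
  - by apply: integral_ge0 => y _; rewrite lee_fin.
  - apply: integral_le_cst; first exact: measurable_kernel_subr.
      by move=> y; rewrite lee_fin.
    by move=> y; rewrite lee_fin.
have [x [Ex x0]] := finp nu nu; have [y [Ey y0]] := finp p nu; have [z [Ez z0]] := finp p p.
have xE : x = n.+1%:R^-1 * \sum_i (n.+1%:R^-1 * \sum_j kd d (a i - a j)).
  have : dint (kd d) nu nu = (n.+1%:R^-1 * \sum_i (n.+1%:R^-1 * \sum_j kd d (a i - a j)))%:E.
    rewrite /dint Hnu; last 2 first.
    - exact: measurable_kernel_pot.
    - by move=> t; apply: integral_ge0 => u _; rewrite lee_fin.
    rewrite EFinM -sumEFin; congr (_ * _)%E; apply: eq_bigr => i _.
    rewrite Hnu; last 2 first.
    - exact: measurable_kernel_subr.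
    - by move=> u; rewrite lee_fin.
    by rewrite EFinM -sumEFin.
  by rewrite Ex => -[].
pose U i := fine (\int[p]_y (kd d (a i - y))%:E)%E.
have UE i : (\int[p]_y (kd d (a i - y))%:E)%E = (U i)%:E.
  by have [v [Ev _]] := Ufin (a i); rewrite /U Ev.
have yE : y = n.+1%:R^-1 * \sum_i U i.
  have : dint (kd d) p nu = (n.+1%:R^-1 * \sum_i U i)%:E.
    rewrite /dint Hnu; last 2 first.
    - exact: measurable_kernel_pot.
    - by move=> t; apply: integral_ge0 => u _; rewrite lee_fin.
    by rewrite EFinM -sumEFin; congr (_ * _)%E; apply: eq_bigr => i _; rewrite UE.
  by rewrite Ey => -[].
have potD t : (pot p t <= \int[p]_u (kd d (t - u))%:E + D%:E)%E.
  apply: (@le_trans _ _ (\int[p]_u (kd d (t - u))%:E + gpot (4 * d) p t)%E); last by rewrite leeD2l.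
  rewrite /pot /gpot -ge0_integralD//; last 4 first.
  - by move=> u _; rewrite lee_fin.
  - exact: measurable_kernel_subr.
  - by move=> u _; apply: gam_ge0; lra.
  - exact: measurable_gam_subr.
  apply: ge0_le_integral => //.
  - by move=> u _; exact: K_ge0.
  - exact: measurable_K_subr.
  - apply: emeasurable_funD; [exact: measurable_kernel_subr|exact: measurable_gam_subr].
  by move=> u _; apply: K_kr_shift_gam; rewrite ltW.
exists x, y, z; split.
- have TE : (\sum_i \sum_(j < n.+1 | j != i) kd d (a i - a j)) <= T.
    rewrite -lee_fin -aT /Dsum -sumEFin; apply: lee_sum => i _.
    by rewrite -sumEFin; apply: lee_sum => j _; exact: kd_le_K.
  have e1 : \sum_i \sum_j kd d (a i - a j) =
      n.+1%:R * kr d + \sum_i \sum_(j < n.+1 | j != i) kd d (a i - a j).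
    have -> : n.+1%:R * kr d = \sum_(i < n.+1) kr d by rewrite sumr_const card_ord mulr_natl.
    rewrite -big_split /=; apply: eq_bigr => i _; rewrite (bigD1 i)//=.
    by rewrite subrr /kd normr0 add0r.
  rewrite xE -mulr_sumr e1 ler_pdivlMr ?exprn_gt0//.
  set A := \sum_i \sum_(_ < _ | _) _ in TE *; set N : R := n.+1%:R in n0 *.
  by have -> : (N^-1 * (N^-1 * (N * kr d + A)) - kr d / N) * N ^+ 2 = A by field; rewrite gt_eqF.
- have : lam <= n.+1%:R^-1 * \sum_i (U i + D + b * Q (a i)).
    rewrite mulrC ler_pdivlMr//.
    have -> : lam * n.+1%:R = \sum_(i < n.+1) lam by rewrite sumr_const card_ord mulr_natr.
    apply: ler_sum => i _; rewrite -lee_fin; apply: le_trans (EL1 (a i)) _.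
    by rewrite EFinD EFinD -UE leeD2r//.
  rewrite !big_split /= -mulr_sumr sumr_const card_ord -mulr_natl => h.
  apply: le_trans h _; rewrite yE; set N : R := n.+1%:R in n0 *.
  by rewrite le_eqVlt; apply/orP; left; apply/eqP; field; rewrite gt_eqF.
- rewrite z0 -lee_fin -Ez -pW; apply: ge0_le_integral => //.
  - by move=> t _; apply: integral_ge0 => u _; rewrite lee_fin.
  - exact: measurable_kernel_pot.
  - exact: measurable_pot.
  move=> t _; apply: ge0_le_integral => //.
  - by move=> u _; rewrite lee_fin.
  - exact: measurable_kernel_subr.
  - exact: measurable_K_subr.
  by move=> u _; exact: kd_le_K.
- have D0 : 0 <= D by rewrite -lee_fin; apply: le_trans (HD 0); apply: gpot_ge0; lra.
  rewrite -lee_fin -pW EFinD -Ez -[X in (_ + X)%E]mule1 -(probability_setT p) -integral_cst//.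
  rewrite -ge0_integralD//; last 2 first.
  - by move=> t _; apply: integral_ge0 => u _; rewrite lee_fin.
  - exact: measurable_kernel_pot.
  apply: ge0_le_integral => //.
  - by move=> t _; exact: pot_ge0.
  - exact: measurable_pot.
  - by apply: emeasurable_funD => //; exact: measurable_kernel_pot.
- move=> s s0; have s'0 : 0 < s^-1 by rewrite invr_gt0.
  by have := kcs p nu _ s'0; rewrite invrK Ex Ey Ez -!(EFinM, EFinD) lee_fin addrC.
Qed.

(** The case s = 1 says x - 2y + z >= 0 and gives the lower bound on the total energy. The upper
    bound [IDC] makes this squared distance at most 2D + k / n. Passing from it to x - z needs s = 1
    + t, at the cost t z + (2D + k / n) / t. *)
Lemma gap_bounds (R : realType) (n lam W bq bqa T k D x y z t : R) :
  2 <= n -> 0 <= T -> lam = W + bq ->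
  T / (n * (n - 1)) + 2 * bqa <= W + 2 * bq ->
  x - k / n <= T / n ^+ 2 -> lam <= y + D + bqa -> 0 <= z <= W -> W <= z + D ->
  (forall s, 0 < s -> 2 * y <= s * x + s^-1 * z) -> 0 < t ->
  W + 2 * bq - (2 * D + k / n) <= T / (n * (n - 1)) + 2 * bqa /\
  lam - (t * z + (2 * D + k / n) / t) / 2 - (2 * D + k / n) <= T / (n * (n - 1)) + bqa.
Proof.
move=> n2 T0 El IDC hx hl /andP[z0 zW] WD cs t0.
have Tn : T / n ^+ 2 <= T / (n * (n - 1)).
  rewrite ler_wpM2l// lef_pV2 ?posrE; nra.
have cs1 := cs 1 ltr01; rewrite invr1 !mul1r in cs1.
have t1 : 0 < 1 + t by lra.
have cst := cs _ t1.
have e0 : x - 2 * y + z <= 2 * D + k / n by lra.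
set T1 := T / (n * (n - 1)) in IDC Tn *; set T2 := T / n ^+ 2 in hx Tn.
set kn := k / n in hx e0 *.
split; first by lra.
have hz : z - t * z - (2 * D + kn) / t <= x.
  have h1 : (1 + t)^-1 * z = z - t * z / (1 + t) by field; rewrite gt_eqF.
  have h2 : t * z / (1 + t) <= t * z.
    by rewrite ler_pdivrMr//; have := mulr_ge0 (ltW t0) z0; nra.
  have h3 : t * (z / (1 + t)) <= t * x + (2 * D + kn).
    have : t * (z / (1 + t)) = t * z / (1 + t) by rewrite mulrA.
    move=> ->; lra.
  have h4 : z / (1 + t) <= x + (2 * D + kn) / t.
    by rewrite -(ler_pM2l t0) mulrDr (mulrC t ((_ + _) / t)) divfK// gt_eqF.
  have : z / (1 + t) = z - t * z / (1 + t) by rewrite mulrC.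
  lra.
lra.
Qed.

(** The expected interaction of n independent points is n (n - 1) W, which the prefactor n / (n - 1)
    turns into exactly n^2 W; no error term arises. *)
Lemma ID_le_continuum (R : realType) (Q : R -> R) (p : probability (measurableTypeR R) R)
    (W q beta : R) (n : nat) (a : 'I_n.+2 -> R) :
  measurable_fun [set: R] Q -> (forall x, 0 <= Q x) ->
  (\int[p]_x pot p x = W%:E)%E -> (\int[p]_x (Q x)%:E = q%:E)%E -> 0 < beta ->
  ID_minimizer Q beta a ->
  (ID Q beta a <= (n.+2%:R ^+ 2 * W + 2 * beta * n.+2%:R * q)%:E)%E.
Proof.
move=> mQ Q0 pW pq b0 amin.
set N : R := n.+2%:R.
have N0 : 0 < N by rewrite ltr0n.
have N1 : 0 < N - 1 by rewrite subr_gt0 ltr1n.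
apply/lee_addgt0Pr => e e0.
have c0 : 0 < 2 * (N / (N - 1)) by rewrite mulr_gt0// divr_gt0.
have d0 : 0 <= 2 * beta by rewrite mulr_ge0// ltW.
have eN : 0 < e / N by rewrite divr_gt0.
have [a' Ha'] := energy_sampling n.+2 mQ Q0 pW pq c0 d0 eN 0.
apply: le_trans (ID_minimizer_any a' isT amin) _.
rewrite IDE -/N; move: Ha'; rewrite mulr0 mul0e adde0 mul0r -/N.
have -> : 2 * (N / (N - 1)) / 2 = N / (N - 1) by field; rewrite gt_eqF.
move=> h; apply: le_trans h _; rewrite -EFinD lee_fin mul0r addr0.
rewrite le_eqVlt; apply/orP; left; apply/eqP; field; rewrite !gt_eqF//.
Qed.

(** On the support the term b Q cancels between the discrete and the continuum Euler-Lagrange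
    conditions; what remains is a constant gap between potentials, the situation of
    [potential_compare]. *)
Lemma discrete_potential_le (R : realType) (Q : R -> R) (b : R)
    (p : probability (measurableTypeR R) R) (lam s1 s2 T : R) (n : nat) (a : 'I_n.+2 -> R) :
  euler_lagrange Q b p lam -> s1 <= s2 -> (forall x, supp p x <-> s1 <= x <= s2) ->
  p (~` `[s1, s2]%classic) = 0%E ->
  ID_minimizer Q (n.+2%:R * b) a -> Dsum a = T%:E ->
  T / (n.+2%:R * (n.+2%:R - 1)) + b * (n.+2%:R^-1 * \sum_i Q (a i)) <= lam.
Proof.
move=> [cQ Q0 b0 EL1 EL2] s12 sE ps amin aT.
set F := _ + _; rewrite -subr_le0.
have N0 : 0 < n.+2%:R :> R by rewrite ltr0n.
have N1 : 0 < n.+2%:R - 1 :> R by rewrite subr_gt0 ltr1n.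
apply: (@potential_compare R p n.+1 a s1 s2 lam) => //.
  move=> x /sE/EL2 h; apply: le_trans h _.
  by rewrite lee_fin gerBl mulr_ge0// ltW.
move=> x /sE/EL2 h.
have := discrete_euler_lagrange x amin aT.
set S := (\sum_j K _)%E => h2.
have S0 : (0 <= S)%E by apply: sume_ge0 => j _; exact: K_ge0.
have {}h2 : (F%:E <= (n.+2%:R^-1)%:E * S + (b * Q x)%:E)%E.
  have -> : F = (n.+2%:R ^+ 2)^-1 * (n.+2%:R / (n.+2%:R - 1) * T + n.+2%:R * b * \sum_i Q (a i)).
    by rewrite /F; set N : R := n.+2%:R in N0 N1 *; field; rewrite !gt_eqF.
  rewrite EFinM lee_pdivrMl ?exprn_gt0//; apply: le_trans h2 _.
  rewrite ge0_muleDr ?mule_ge0 ?lee_fin ?mulr_ge0 ?invr_ge0 ?(ltW b0)//.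
  rewrite muleA -!EFinM expr2 mulfK ?gt_eqF//.
  by rewrite leeD2l// lee_fin mulrA mulrA.
have [v [Ev _ _]] := ge0_fin (pot_ge0 p x) h.
move: h; rewrite Ev lee_fin => h.
rewrite -EFinD; apply: (@le_trans _ _ (F%:E - (b * Q x)%:E)%E).
  by rewrite -EFinB lee_fin; lra.
by rewrite leeBlDr.
Qed.

Lemma kr_le_log (R : realType) (d : R) : 0 < d <= 1 -> kr d <= 2 - ln d.
Proof.
move=> /andP[d0 d1]; apply: le_trans (kr_le_ln d0) _.
have d2 : 0 < d ^+ 2 by rewrite exprn_gt0.
have h : ln (1 + 4 / d ^+ 2) <= ln (5 / d ^+ 2).
  rewrite ler_ln ?posrE ?divr_gt0//; last by rewrite addr_gt0// divr_gt0.
  have : 1 <= (d ^+ 2)^-1 by rewrite invf_ge1//; nra.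
  lra.
rewrite lnM ?posrE ?invr_gt0// lnV ?posrE// lnXn// in h.
have h5 : ln (5 : R) <= 4.
  have -> : (5 : R) = 1 + 4 by ring.
  by apply: ln1D_le.
by rewrite mulr2n in h; lra.
Qed.

(** With l about (ln X) / c, (1 - c)^l <= exp(-cl) <= 1 / X, while - ln of r / 2^l / 4 grows
    linearly in l. The hypothesis X >= 1 + c0 keeps ln X away from 0, so constants can be absorbed
    into A ln X. *)
Lemma scale_choice (R : realType) (c r c0 : R) : 0 < c <= 1 / 2 -> 0 < r <= 1 / 8 -> 0 < c0 ->
  exists2 A : R, 0 < A & forall X : R, 1 + c0 <= X ->
  exists l : nat, (1 - c) ^+ l * X <= 1 /\ kr (r / 2 ^+ l / 4) <= A * ln X.
Proof.
move=> /andP[c_0 c2] /andP[r0 r8] c00.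
have L0 : 0 < ln (1 + c0) by rewrite ln_gt0// ltrDl.
have lr : ln (r / 4) <= 0 by rewrite ln_le0//; lra.
pose A1 : R := 3 - ln (r / 4).
have A10 : 0 < A1 by rewrite /A1; lra.
exists (A1 / ln (1 + c0) + c^-1); first by rewrite addr_gt0 ?divr_gt0 ?invr_gt0.
move=> X X1.
have X0 : 0 < X by lra.
have LX : ln (1 + c0) <= ln X by rewrite ler_ln ?posrE//; lra.
have lc0 : 0 <= ln X / c by rewrite divr_ge0//; lra.
have [l [l1 l2]] : exists l : nat, ln X <= l%:R * c /\ l%:R <= ln X / c + 1.
  have /andP[l1 l2] := truncn_itv lc0; exists (Num.truncn (ln X / c)).+1; split.
    by rewrite -ler_pdivrMr// ltW.
  by rewrite -natr1 lerD2r.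
have p2 : 0 < (2 : R) ^+ l by rewrite exprn_gt0.
exists l; split.
  have h1 : (1 - c) ^+ l <= expR (- (c * l%:R)).
    have -> : expR (- (c * l%:R)) = expR (- c) ^+ l by rewrite -expRM_natl; congr expR; ring.
    apply: lerXn2r; rewrite ?nnegrE ?expR_ge0//; last exact: expR_ge1Dx.
    by rewrite subr_ge0 (le_trans c2)// ler_pdivrMr// mul1r ler1n.
  have h2 : expR (- (c * l%:R)) * X <= 1.
    rewrite -[X in _ * X](lnK X0) -expRD -[leRHS]expR0 ler_expR.
    by rewrite addrC subr_le0 mulrC.
  by apply: le_trans h2; rewrite ler_pM2r.
have d0 : 0 < r / 2 ^+ l / 4 by rewrite !divr_gt0.
have p1 : 1 <= (2 : R) ^+ l by rewrite exprn_ege1// ler1n.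
have d1 : r / 2 ^+ l / 4 <= 1.
  by rewrite ler_pdivrMr// mul1r ler_pdivrMr//; clear -r8 p1; nra.
have := @kr_le_log R (r / 2 ^+ l / 4); rewrite d0 d1 => /(_ isT) h; apply: le_trans h _.
have -> : r / 2 ^+ l / 4 = (r / 4) * (2 ^+ l)^-1 by ring.
have r40 : 0 < r / 4 by rewrite divr_gt0.
have e2 : ln ((2 : R) ^+ l)^-1 = - (ln 2 *+ l) by rewrite lnV ?posrE// lnXn.
rewrite lnM ?posrE ?invr_gt0// e2.
have ln2 : ln (2 : R) <= 1.
  have -> : (2 : R) = 1 + 1 by ring.
  exact: ln1D_le.
have h1 : ln (2 : R) *+ l <= ln X / c + 1.
  apply: (@le_trans _ _ (1 *+ l)); first by rewrite lerMn2r ln2 orbT.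
  exact: l2.
have h2 : A1 <= A1 / ln (1 + c0) * ln X.
  by rewrite mulrAC ler_pdivlMr// ler_pM2l.
have -> : (A1 / ln (1 + c0) + c^-1) * ln X = A1 / ln (1 + c0) * ln X + ln X / c by ring.
rewrite /A1 in h2 *; clear -h1 h2; lra.
Qed.

(* With p = mu / n and b = beta / n, the numbers E1 + 2 * E2 and E1 + E2 below are
   I_n^D / n^2 and F_n^D / n^2, while W + 2 * (b * q) and W + b * q are I_n^C / n^2
   and F_n^C / n^2. *)
Lemma normalized_estimates (R : realType) (alpha0 : R) : 0 < alpha0 ->
  exists2 C : R, 0 < C & forall (Q : R -> R) (b : R) (p : probability (measurableTypeR R) R)
    (alpha : R) (n : nat) (a : 'I_n.+2 -> R),
  C4 Q -> (forall x, 0 <= Q x) -> Q 0 = 0 ->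
  (forall x y, Q ((x + y) / 2) <= (Q x + Q y) / 2) ->
  0 < b -> energy_minimizer Q b p -> (energy Q b p <= (14 / alpha)%:E)%E ->
  alpha0 <= alpha -> alpha <= n.+2%:R ->
  (forall x, b * Q x <= 14 / alpha -> - (14 * alpha) <= x <= 14 * alpha) ->
  ID_minimizer Q (n.+2%:R * b) a ->
  exists W q T : R, [/\ (\int[p]_x pot p x = W%:E)%E, (\int[p]_x (Q x)%:E = q%:E)%E,
    Dsum a = T%:E, forall x, supp p x -> - (14 * alpha) <= x <= 14 * alpha &
    let E1 := T / (n.+2%:R * (n.+2%:R - 1)) in
    let E2 := b * (n.+2%:R^-1 * \sum_i Q (a i)) in
    let m := Num.min (alpha / n.+2%:R * ln (n.+2%:R / alpha *
      (1 + b * alpha ^+ 3 * Linfty (supp p) (derive1n 2 Q)))) 1 in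
    [/\ 0 <= m, E1 + 2 * E2 <= W + 2 * (b * q),
      W + 2 * (b * q) - C * (m / alpha) <= E1 + 2 * E2, E1 + E2 <= W + b * q &
      W + b * q - C * (Num.sqrt m / alpha) <= E1 + E2]].
Proof.
move=> a00.
(* Since lam <= 14 / alpha0 < kr l0, [supp_length] makes the support longer than l0, which leaves
   room for scales up to r0. *)
have [l0 l00 Hl0] := kr_unbounded (14 / alpha0 + 1).
pose r0 : R := Num.min (1 / 8) (l0 / 2).
have r0_0 : 0 < r0 by rewrite lt_min; apply/andP; split; lra.
have r0_8 : r0 <= 1 / 8 by rewrite ge_min lexx.
have r0l : 2 * r0 <= l0.
  have : r0 <= l0 / 2 by rewrite ge_min lexx orbT.
  lra.
pose m0 : R := Num.min 1 (14 * alpha0).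
have m00 : 0 < m0 by rewrite lt_min ltr01 mulr_gt0.
have m01 : m0 <= 1 by rewrite ge_min lexx.
have m0a : m0 <= 14 * alpha0 by rewrite ge_min lexx orbT.
(* The lower bound on u obtained by comparing [exp_energy_ge] with [dilation_energy] for M = 14
   alpha and L = 28 alpha S: 24 from the first, 8 * 14^3 from 4 b M L multiplied by M. *)
pose c0 : R := expR (- 8) * m0 ^+ 2 / (192 * 14 ^+ 3).
have c00 : 0 < c0.
  apply: divr_gt0; first by apply: mulr_gt0; [exact: expR_gt0|exact: exprn_gt0].
  by apply: mulr_gt0 => //; exact: exprn_gt0.
have [c c_0 c300] : exists2 c : R, 0 < c & c <= 1 / 300 by exists (1 / 300); lra.
have c12 : 0 < c <= 1 / 2 by rewrite c_0; apply: le_trans c300 _; lra.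
have r01 : 0 < r0 <= 1 / 8 by rewrite r0_0.
have [A A0 HA] := scale_choice c12 r01 c00.
have L0 : 0 < ln (1 + c0) by rewrite ln_gt0// ltrDl.
(* The 14 is for lam <= 14 / alpha, the 4 / alpha0 for b L r0 <= (7/2) b S alpha; alpha >= alpha0
   raises the power of alpha to that in u. *)
pose C2 : R := 14 + 4 / alpha0.
have C20 : 0 < C2 by rewrite addr_gt0// divr_gt0.
pose C6 : R := 2 * C2 / ln (1 + c0) + A.
have C60 : 0 < C6 by rewrite addr_gt0// divr_gt0// mulr_gt0.
exists (14 + 2 * C6); first by rewrite addr_gt0// mulr_gt0.
move=> Q b p alpha n a QC4 Q0 Q00 Qmid b0 pmin pE al0 aln HM amin.
have al : 0 < alpha by lra.
have [d1 d2 cQ cdd] := C4_derive QC4.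
have mQ : measurable_fun [set: R] Q by exact: continuous_measurable_fun.
have [W [q [pW pq W0 q0 WE]]] := energy_fin Q0 b0 pE.
have aT := Dsum_ordered amin.1.
set T := \sum_i _ in aT.
have T0 : 0 <= T by rewrite -lee_fin -aT; exact: Dsum_ge0.
have EL := minimizer_euler_lagrange cQ Q0 b0 pmin pW pq.
set lam := W + b * q in EL.
have bq0 : 0 <= b * q by rewrite mulr_ge0// ltW.
have lam14 : lam <= 14 / alpha by rewrite /lam; clear -WE bq0; lra.
have pM : p (~` `[- (14 * alpha), 14 * alpha]%classic) = 0%E.
  apply: (euler_lagrange_bounded cQ Q0 b0 pmin pW pq) => x bx.
  by apply: HM; apply: le_trans bx _.
exists W, q, T; split => //; first exact: supp_le.
set N : R := n.+2%:R; set S := Linfty _ _.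
move=> E1 E2 m.
have N0 : 0 < N by rewrite ltr0n.
have N2 : 2 <= N by rewrite ler_nat.
have N1 : 0 < N - 1 by rewrite subr_gt0 ltr1n.
have E10 : 0 <= E1 by apply: divr_ge0 => //; apply: mulr_ge0; exact: ltW.
have E20 : 0 <= E2.
  apply: mulr_ge0; first exact: ltW.
  by apply: mulr_ge0; [rewrite invr_ge0 ltW|apply: sumr_ge0].
have [s1 [s2 [s12 sE ps]]] := supp_interval EL Qmid pM.
have ss1 : supp p s1 by apply/sE; rewrite lexx.
have ss2 : supp p s2 by apply/sE; rewrite s12 lexx.
have /andP[s1M _] := supp_le pM ss1; have /andP[_ s2M] := supp_le pM ss2.
have ID1 : E1 + 2 * E2 <= W + 2 * (b * q).
  have bn0 : 0 < N * b by rewrite mulr_gt0.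
  have := ID_le_continuum mQ Q0 pW pq bn0 amin.
  rewrite IDE aT -!(EFinM, EFinD) lee_fin -/N.
  have -> : N / (N - 1) * T + 2 * (N * b) * \sum_i Q (a i) = N ^+ 2 * (E1 + 2 * E2).
    by rewrite /E1 /E2 -/N; field; rewrite !gt_eqF.
  have -> : N ^+ 2 * W + 2 * (N * b) * N * q = N ^+ 2 * (W + 2 * (b * q)) by ring.
  by rewrite ler_pM2l// exprn_gt0.
have FD1 : E1 + E2 <= lam by exact: (discrete_potential_le EL s12 sE ps amin aT).
have slen : l0 < s2 - s1.
  rewrite ltNge; apply/negP => h.
  have := supp_length EL ss1 ps l00 h.
  have := Hl0 _ l00 (lexx _).
  have : 14 / alpha <= 14 / alpha0 by rewrite ler_pM2l// lef_pV2 ?posrE.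
  clear -lam14; lra.
have {}s12 : s1 < s2 by rewrite -subr_gt0 (lt_trans l00).
have HS := Linfty_ge s12 cdd sE.
rewrite -/S in HS.
have S0 : 0 <= S by apply: le_trans (HS s1 _); rewrite ?normr_ge0// lexx ltW.
have [z zs Qz] := supp_meets_zero EL Q00 (ltW s12) sE ps.
have HdQ' := derive_bound d1 d2 Q0 Qz zs HS.
pose L := S * (28 * alpha).
have HdQ x : s1 <= x <= s2 -> `|derive1n 1 Q x| <= L.
  by move=> xs; apply: le_trans (HdQ' _ xs) _; rewrite ler_wpM2l//; clear -s1M s2M; lra.
have L_0 : 0 <= L by apply: mulr_ge0 => //; apply: mulr_ge0 => //; exact: ltW.
pose M := 14 * alpha.
have M0 : 0 < M by exact: mulr_gt0.
pose u := b * alpha ^+ 3 * S.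
have u0 : c0 <= u.
  have := dilation_energy d1 d2 cQ cdd Q0 b0 pmin pW pq ps s1M (ltW s12) s2M M0 HdQ.
  have m0M : m0 <= M by apply: le_trans m0a _; rewrite ler_pM2l.
  have m001 : 0 < m0 <= 1 by rewrite m00.
  move=> /(le_trans (exp_energy_ge pM m001 m0M)); rewrite lee_fin.
  have -> : expR (- 8) * m0 ^+ 2 / (24 * M) = c0 * (8 * 14 ^+ 3 / M).
    by rewrite /c0; field; rewrite gt_eqF.
  have -> : 4 * b * M * L = u * (8 * 14 ^+ 3 / M) by rewrite /L /u /M; field; rewrite gt_eqF.
  by rewrite ler_pM2r// divr_gt0// mulr_gt0// exprn_gt0.
pose X := N / alpha * (1 + u).
have X1 : 1 + c0 <= X.
  have h : 1 <= N / alpha by rewrite ler_pdivlMr// mul1r.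
  rewrite /X; clear -h u0 c00; nra.
have c01 : 0 < 1 + c0 by rewrite addr_gt0.
have X_0 : 0 < X by exact: lt_le_trans X1.
have lnX : ln (1 + c0) <= ln X by rewrite ler_ln ?posrE.
have lnX0 : 0 < ln X by exact: lt_le_trans lnX.
have mE : m = Num.min (alpha / N * ln X) 1 by [].
have mp : 0 < m by rewrite mE lt_min ltr01 andbT mulr_gt0// divr_gt0.
have m1 : m <= 1 by rewrite mE ge_min lexx orbT.
have C14 : 14 / alpha <= (14 + 2 * C6) / alpha.
  by rewrite ler_pM2r ?invr_gt0// lerDl mulr_ge0// ltW.
(* If m = 1 the claim is trivial, because all the quantities lie between 0 and 14 / alpha. *)
have [mbig|msmall] := leP 1 (alpha / N * ln X).
  have -> : m = 1 by rewrite mE min_r.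
  rewrite sqrtr1 div1r.
  clear -WE bq0 E10 E20 ID1 FD1 C14; split => //; lra.
have {}mE : m = alpha / N * ln X by rewrite mE min_l// ltW.
have [l [Hl krl]] := HA _ X1.
set d := r0 / 2 ^+ l / 4 in krl.
have p2 : 0 < (2 : R) ^+ l by rewrite exprn_gt0.
have p1 : 1 <= (2 : R) ^+ l by rewrite exprn_ege1// ler1n.
have d0 : 0 < d <= 1 / 2.
  rewrite /d !divr_gt0//= ler_pdivrMr// ler_pdivrMr//; clear -p1 r0_8; nra.
(* One has lam + b L r0 <= (C2 / alpha) (1 + u) = C2 X / N, and the choice of l removes the factor
   X. *)
pose D := C2 / N.
have HD x : (gpot (4 * d) p x <= D%:E)%E.
  have -> : 4 * d = r0 / 2 ^+ l by rewrite /d; field; rewrite gt_eqF.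
  have c3 : 0 < c <= 1 / 300 by rewrite c_0.
  have rs : 2 * r0 <= s2 - s1 by apply: le_trans r0l _; exact: ltW.
  apply: le_trans (gpot_decay x l EL sE ps (lipschitz_between d1 HdQ) L_0 c3 r01 rs) _.
  rewrite lee_fin.
  have h1 : lam + b * L * r0 <= C2 / alpha * (1 + u).
    have h2 : b * L * r0 <= b * L * (1 / 8) by rewrite ler_wpM2l// mulr_ge0// ltW.
    have h3 : b * L * (1 / 8) <= 4 / alpha0 / alpha * u.
      have -> : 4 / alpha0 / alpha * u = 4 * (b * S * alpha) * (alpha / alpha0).
        by rewrite /u; field; rewrite !gt_eqF.
      have -> : b * L * (1 / 8) = 7 / 2 * (b * S * alpha) by rewrite /L; field.
      have h4 : 1 <= alpha / alpha0 by rewrite ler_pdivlMr// mul1r.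
      have h5 : 0 <= b * S * alpha by rewrite !mulr_ge0// ltW.
      clear -h4 h5; nra.
    have h6 : 14 / alpha <= 14 / alpha * (1 + u).
      have h8 : 0 < 14 / alpha by rewrite divr_gt0.
      by rewrite ler_pMr// lerDl (le_trans (ltW c00)).
    have h7 : 0 < 4 / alpha0 / alpha by rewrite !divr_gt0.
    have -> : C2 / alpha * (1 + u) = 14 / alpha * (1 + u) + 4 / alpha0 / alpha * (1 + u).
      by rewrite /C2; field; rewrite !gt_eqF.
    clear -h2 h3 h6 h7 lam14; lra.
  have c1 : 0 <= (1 - c) ^+ l.
    by apply: exprn_ge0; clear -c12; case/andP: c12; lra.
  apply: le_trans (ler_wpM2l c1 h1) _.
  have -> : (1 - c) ^+ l * (C2 / alpha * (1 + u)) = (1 - c) ^+ l * X * (C2 / N).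
    by rewrite /X; field; rewrite !gt_eqF.
  by rewrite ler_piMl// divr_ge0// ltW.
have [x [y [z' [hx hl hz hW hcs]]]] := kd_comparison EL pW d0 HD aT.
(* The choice t = sqrt m balances t z, of order t / alpha, with eps / t, of order m / (t alpha). *)
have t0 : 0 < Num.sqrt m by rewrite sqrtr_gt0.
have [] := gap_bounds N2 T0 (erefl lam) ID1 hx hl hz hW hcs t0.
rewrite -/E1 -/N.
set eps := 2 * D + kr d / N.
have epsm : eps <= C6 * (m / alpha).
  have -> : C6 * (m / alpha) = (2 * C2 / ln (1 + c0) * ln X + A * ln X) / N.
    by rewrite mE /C6; field; rewrite !gt_eqF.
  have -> : eps = (2 * C2 + kr d) / N by rewrite /eps /D; field; rewrite gt_eqF.
  rewrite ler_pM2r ?invr_gt0//; apply: lerD => //.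
  by rewrite mulrAC ler_pdivlMr// ler_pM2l// mulr_gt0.
have msq : m <= Num.sqrt m.
  have sm1 : Num.sqrt m <= 1 by rewrite -[leRHS]sqrtr1 ler_wsqrtr.
  by rewrite -{1}(sqr_sqrtr (ltW mp)) expr2 ler_piMl// sqrtr_ge0.
have CC : 0 < m / alpha by rewrite divr_gt0.
have CC6 : 0 <= C6 * (m / alpha) by rewrite mulr_ge0// ltW.
move=> g1 g2; split => //.
- exact: ltW.
- rewrite mulrDl; clear -g1 epsm CC CC6; lra.
- rewrite -/E2 in g2.
  have z14 : z' <= 14 / alpha by case/andP: hz => _ h; rewrite /lam in lam14; clear -h bq0 lam14; lra.
  have h1 : Num.sqrt m * z' <= 14 * (Num.sqrt m / alpha).
    by rewrite mulrCA ler_pM2l.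
  have h2 : eps / Num.sqrt m <= C6 * (Num.sqrt m / alpha).
    rewrite ler_pdivrMr//; apply: le_trans epsm _.
    by rewrite -{1}(sqr_sqrtr (ltW mp)) expr2 -!mulrA (mulrC alpha^-1) lexx.
  have h3 : C6 * (m / alpha) <= C6 * (Num.sqrt m / alpha).
    by rewrite ler_pM2l// ler_pM2r// invr_gt0.
  set v := Num.sqrt m / alpha in h1 h2 h3 *; set vv := eps / Num.sqrt m in h2 g2.
  have v0 : 0 < v by rewrite divr_gt0.
  have C6v : 0 < C6 * v by rewrite mulr_gt0.
  rewrite mulrDl -/lam; clear -g2 h1 h2 h3 epsm v0 C6v; lra.
Qed.

(** * The primitive of Q *)

Lemma convex_functionE (R : realType) (Q : R -> R) :
  convex_function [set: R^o] (Q : R^o -> R^o) ->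
  forall t x y : R, 0 <= t <= 1 -> Q (t * x + (1 - t) * y) <= t * Q x + (1 - t) * Q y.
Proof.
move=> cvx t x y t01.
have t01' : 0 <= t by case/andP: t01.
have := cvx (Itv01 (proj1 (andP t01)) (proj2 (andP t01))) x y.
rewrite !inE => /(_ I I); rewrite !convRE.
by [].
Qed.

Lemma convex_ray (R : realType) (Q : R -> R) (t x : R) :
  (forall t x y : R, 0 <= t <= 1 -> Q (t * x + (1 - t) * y) <= t * Q x + (1 - t) * Q y) ->
  Q 0 = 0 -> 0 <= t <= 1 -> Q (t * x) <= t * Q x.
Proof. by move=> cvx Q0 t01; have := cvx t x 0 t01; rewrite Q0 !mulr0 !addr0. Qed.

Lemma convex_ray_ge (R : realType) (Q : R -> R) (x z : R) :
  (forall t x y : R, 0 <= t <= 1 -> Q (t * x + (1 - t) * y) <= t * Q x + (1 - t) * Q y) ->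
  Q 0 = 0 -> z != 0 -> 1 <= x / z -> Q z * (x / z) <= Q x.
Proof.
move=> cvx Q0 z0 xz1; have xz0 : 0 < x / z by exact: lt_le_trans xz1.
have t01 : 0 <= (x / z)^-1 <= 1 by rewrite invr_ge0 ltW//= invf_le1.
have := convex_ray x cvx Q0 t01.
have x0 : x != 0 by apply: contraTneq xz0 => ->; rewrite mul0r ltxx.
have -> : (x / z)^-1 * x = z by field; rewrite x0 z0.
by move=> h; rewrite mulrC -ler_pdivlMl.
Qed.

Lemma convex_ray_nondecreasing (R : realType) (Q : R -> R) (x z : R) :
  (forall t x y : R, 0 <= t <= 1 -> Q (t * x + (1 - t) * y) <= t * Q x + (1 - t) * Q y) ->
  Q 0 = 0 -> (forall x, 0 <= Q x) -> (0 <= z <= x) || (x <= z <= 0) -> Q z <= Q x.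
Proof.
move=> cvx Q00 Q0 zx; have [->|z0] := eqVneq z 0; first by rewrite Q00.
have xz1 : 1 <= x / z.
  case/orP: zx => /andP[h1 h2].
    by rewrite ler_pdivlMr ?mul1r// lt_neqAle eq_sym z0.
  by rewrite ler_ndivlMr ?mul1r// lt_neqAle z0.
by apply: le_trans (convex_ray_ge cvx Q00 z0 xz1); rewrite ler_peMr.
Qed.

(* The weight at [z] fixes the slope of [Q] on the ray through [z]. *)
Lemma sublevel_ray (R : realType) (Q : R -> R) (b k alpha z x : R) :
  (forall t x y : R, 0 <= t <= 1 -> Q (t * x + (1 - t) * y) <= t * Q x + (1 - t) * Q y) ->
  Q 0 = 0 -> 0 < b -> 1 <= k -> z != 0 -> `|z| <= alpha -> b^-1 <= `|z| * Q z ->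
  b * Q x <= k / alpha -> x / z <= k.
Proof.
move=> cvx Q00 b0 k1 z0 za bz bx; rewrite leNgt; apply/negP => xk.
have zn : 0 < `|z| by rewrite normr_gt0.
have a0 : 0 < alpha by exact: lt_le_trans za.
have xz := convex_ray_ge cvx Q00 z0 (le_trans k1 (ltW xk)).
have h1 : alpha^-1 <= b * Q z.
  apply: (@le_trans _ _ `|z|^-1); first by rewrite lef_pV2 ?posrE.
  rewrite -(ler_pM2l zn) mulfV ?gt_eqF// mulrCA.
  by rewrite -(mulfV (lt0r_neq0 b0)) ler_pM2l.
have h2 : b * (Q z * (x / z)) <= b * Q x by rewrite ler_pM2l.
have h3 : alpha^-1 * (x / z) <= b * Q z * (x / z) by rewrite ler_pM2r//; lra.
have h4 : alpha^-1 * k < alpha^-1 * (x / z) by rewrite ltr_pM2l ?invr_gt0.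
have : alpha^-1 * k < b * Q x.
  by apply: lt_le_trans h4 _; apply: le_trans h3 _; rewrite -mulrA.
by rewrite mulrC ltNge bx.
Qed.

Lemma integrable_continuous_itv (R : realType) (Q : R -> R) (x y : R) : continuous Q ->
  (@lebesgue_measure R).-integrable `[x, y] (EFin \o Q).
Proof.
move=> cQ; apply: continuous_compact_integrable; first exact: segment_compact.
exact: continuous_subspaceT.
Qed.

Lemma Rintegral_itvD (R : realType) (Q : R -> R) (x y z : R) : continuous Q ->
  x <= y -> y <= z ->
  \int[lebesgue_measure]_(t in `[x, z]) Q t =
  \int[lebesgue_measure]_(t in `[x, y]) Q t + \int[lebesgue_measure]_(t in `[y, z]) Q t.
Proof.
move=> cQ xy yz.
have := @Rintegral_itvB R Q (BLeft x) (BRight z) y (integrable_continuous_itv _ _ cQ).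
rewrite !bnd_simp => /(_ xy yz) h; apply/eqP; rewrite addrC -subr_eq h.
rewrite Rintegral_itv_obnd_cbnd//.
apply: integrableS (integrable_continuous_itv y z cQ) => //.
by apply: subset_itvr; rewrite bnd_simp.
Qed.

Lemma P_sub (R : realType) (Q : R -> R) (x y : R) : continuous Q -> x <= y ->
  P Q y - P Q x = \int[lebesgue_measure]_(t in `[x, y]) Q t.
Proof.
move=> cQ xy; rewrite /P; have [x0|x0] := leP 0 x.
  rewrite (le_trans x0 xy) (Rintegral_itvD cQ x0 xy); ring.
have [y0|y0] := leP 0 y; first by rewrite (Rintegral_itvD cQ (ltW x0) y0); ring.
rewrite (Rintegral_itvD cQ xy (ltW y0)); ring.
Qed.

Lemma P_slope (R : realType) (Q : R -> R) (x y m M : R) : continuous Q -> x < y ->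
  (forall t, x <= t <= y -> m <= Q t <= M) ->
  m * (y - x) <= P Q y - P Q x <= M * (y - x).
Proof.
move=> cQ xy H; rewrite (P_sub cQ (ltW xy)).
have Ic c : \int[lebesgue_measure]_(t in `[x, y]) c = c * (y - x) :> R.
  by rewrite /Rintegral integral_cst_itv.
have ic (c : R) : (@lebesgue_measure R).-integrable `[x, y] (EFin \o cst c).
  by apply: integrable_continuous_itv => t; exact: cvg_cst.
have iQ := integrable_continuous_itv x y cQ.
by apply/andP; split; rewrite -Ic; apply: le_Rintegral => //; try exact: ic;
  move=> t /=; rewrite in_itv/= => /H/andP[].
Qed.

Lemma P0 (R : realType) (Q : R -> R) : P Q 0 = 0.
Proof. by rewrite /P lexx set_itv1 Rintegral_set1. Qed.

Lemma P_mono (R : realType) (Q : R -> R) (x y : R) : continuous Q -> (forall t, 0 <= Q t) ->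
  x <= y -> P Q x <= P Q y.
Proof.
move=> cQ Q0 xy; rewrite -subr_ge0 P_sub//.
by apply: Rintegral_ge0 => t _; exact: Q0.
Qed.

Lemma continuous_P (R : realType) (Q : R -> R) : continuous Q -> (forall t, 0 <= Q t) ->
  continuous (P Q).
Proof.
move=> cQ Q0 x.
have [M HM] : exists M : R, forall t : R, x - 1 <= t <= x + 1 -> Q t <= M.
  have [|c _ H] := EVT_max _ (continuous_subspaceT cQ : {within `[x - 1, x + 1], continuous Q}); first lra.
  by exists (Q c) => t xt; apply: H; rewrite in_itv.
have M0 : 0 <= M by apply: le_trans (HM x _); rewrite ?Q0//; apply/andP; split; lra.
apply/cvgrPdist_le => e e0.
have d0 : 0 < Num.min 1 (e / (M + 1)) by rewrite lt_min ltr01 divr_gt0//; lra.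
near=> y.
have xy : `|x - y| <= Num.min 1 (e / (M + 1)).
  by near: y; exact: cvgr_dist_le.
have xy1 : `|x - y| <= 1 by apply: le_trans xy _; rewrite ge_min lexx.
have xye : `|x - y| * (M + 1) <= e.
  by rewrite -ler_pdivlMr; [apply: le_trans xy _; rewrite ge_min lexx orbT|lra].
have n0 := normr_ge0 (x - y).
suff : `|P Q x - P Q y| <= M * `|x - y| by nra.
move: xy1; rewrite ler_norml => /andP[a1 a2].
have [h|h|->] := ltgtP x y; last by rewrite !subrr !normr0 mulr0.
- have /(P_slope cQ h)/andP[h1 h2] : forall t, x <= t <= y -> 0 <= Q t <= M.
    by move=> t /andP[t1 t2]; rewrite Q0 HM//; apply/andP; split; lra.
  by clear -h h1 h2; rewrite distrC (distrC x) !ger0_norm; lra.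
- have /(P_slope cQ h)/andP[h1 h2] : forall t, y <= t <= x -> 0 <= Q t <= M.
    by move=> t /andP[t1 t2]; rewrite Q0 HM//; apply/andP; split; lra.
  by clear -h h1 h2; rewrite !ger0_norm; lra.
Unshelve. all: by end_near.
Qed.

Lemma limf_einf_gt0 (R : realType) (f : R -> R) (F : set_system R) (A : set R) : ProperFilter F ->
  F A -> (0 < limf_einf (fun x => (f x)%:E) F)%E -> exists2 x, A x & 0 < f x.
Proof.
move=> FF FA; rewrite /limf_einf oppe_gt0 => h; apply: contrapT => H.
move: h; apply/negP; rewrite -leNgt; apply/ereal_infP => _ [B FB <-].
have [x [Ax Bx]] := filter_ex (filterI FA FB).
apply: (@le_trans _ _ (- (f x)%:E)%E); last by apply: ereal_sup_ubound; exists x.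
by rewrite -EFinN lee_fin oppr_ge0 leNgt; apply/negP => fx; apply: H; exists x.
Qed.

(** Preimages come from the intermediate value theorem. The inequalities with Q hold because Q
    increases away from 0, so |P x| <= |x| Q x. *)
Lemma Pinv_facts (R : realType) (Q : R -> R) (q1 q2 n y : R) :
  continuous Q -> (forall x, 0 <= Q x) -> Q 0 = 0 ->
  (forall t x y : R, 0 <= t <= 1 -> Q (t * x + (1 - t) * y) <= t * Q x + (1 - t) * Q y) ->
  `[q1, q2]%classic = [set x : R | Q x = 0] ->
  (exists2 x, x < 0 & 0 < Q x) ->
  q2 < n -> 0 < n -> 0 < y <= P Q n ->
  [/\ 0 < Pinv Q q1 q2 y <= n, P Q (Pinv Q q1 q2 y) = y,
    y <= Pinv Q q1 q2 y * Q (Pinv Q q1 q2 y) &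
    Pinv Q q1 q2 (- y) < 0 /\ y <= - Pinv Q q1 q2 (- y) * Q (Pinv Q q1 q2 (- y))].
Proof.
move=> cQ Q0 Q00 cvx qE [x1 x10 Qx1] q2n n0 /andP[y0 yn].
have cP := continuous_P cQ Q0.
have qz x : q1 <= x <= q2 <-> Q x = 0.
  split=> h; first by have : `[q1, q2]%classic x; [rewrite /= in_itv|rewrite qE].
  have : [set x | Q x = 0] x by [].
  by rewrite -qE /= in_itv.
have /andP[q10 q20] : q1 <= 0 <= q2 by apply/qz.
have Ppos x : 0 <= x -> P Q x <= x * Q x.
  rewrite le_eqVlt => /orP[/eqP <-|x0]; first by rewrite P0 mul0r.
  have /(P_slope cQ x0)/andP[_ h] : forall t, 0 <= t <= x -> 0 <= Q t <= Q x.
    by move=> t tx; rewrite Q0 (convex_ray_nondecreasing cvx Q00 Q0) ?tx.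
  by move: h; rewrite P0 !subr0 mulrC.
have Pneg x : x <= 0 -> - P Q x <= - x * Q x.
  rewrite le_eqVlt => /orP[/eqP ->|x0]; first by rewrite P0 oppr0 mul0r.
  have /(P_slope cQ x0)/andP[_ h] : forall t, x <= t <= 0 -> 0 <= Q t <= Q x.
    by move=> t tx; rewrite Q0 (convex_ray_nondecreasing cvx Q00 Q0) ?tx ?orbT.
  by move: h; rewrite P0 !sub0r mulrC.
have a_gt0 x : 0 < P Q x -> 0 < x.
  move=> h; rewrite ltNge; apply/negP => x0.
  by have := P_mono cQ Q0 x0; rewrite P0 leNgt h.
have a_lt0 x : P Q x < 0 -> x < 0.
  move=> h; rewrite ltNge; apply/negP => x0.
  by have := P_mono cQ Q0 x0; rewrite P0 leNgt h.
have Pz x : q1 <= x <= q2 -> P Q x = 0.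
  move=> /qz Qx; apply/eqP; rewrite eq_le.
  have [x0|x0] := leP 0 x.
    have := Ppos _ x0; have := P_mono cQ Q0 x0; rewrite Qx mulr0 P0 => -> ->//.
  have := Pneg _ (ltW x0); have := P_mono cQ Q0 (ltW x0).
  by rewrite Qx mulr0 P0 oppr_le0 => -> ->.
have img z x : P Q x = z -> z != 0 -> P Q (Pinv Q q1 q2 z) = z.
  move=> Px z0; apply: (pinvK (fun=> 0) (A := ~` `[q1, q2])); rewrite inE.
  by exists x => //=; rewrite in_itv/= => /Pz; rewrite Px; apply/eqP.
have cPw (u v : R) : {within `[u, v], continuous (P Q)} by exact: continuous_subspaceT.
have [x xn Px] : exists2 x, x \in `[0, n] & P Q x = y.
  apply: IVT => //; first exact: ltW.
  by rewrite P0 minEle maxEle (le_trans (ltW y0) yn) ltW.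
have Pa := img _ _ Px (lt0r_neq0 y0).
set a := Pinv Q q1 q2 y in Pa *.
have a0 : 0 < a by apply: a_gt0; rewrite Pa.
(* [Pinv] could return another preimage than the one found in [0, n]. Beyond n > q2, however, Q is
   positive and P exceeds P n >= y. *)
have an : a <= n.
  rewrite leNgt; apply/negP => na.
  have Qn : 0 < Q n.
    rewrite lt0r Q0 andbT; apply/eqP => /qz/andP[_]; rewrite leNgt q2n//.
  have /(P_slope cQ na)/andP[h _] : forall t, n <= t <= a -> Q n <= Q t <= Q a.
    move=> t /andP[nt ta]; apply/andP; split; apply: (convex_ray_nondecreasing cvx Q00 Q0).
      by rewrite (ltW n0) nt.
    by rewrite ta (le_trans (ltW n0)).
  have hn : 0 < Q n * (a - n) by rewrite mulr_gt0// subr_gt0.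
  clear -h hn Pa yn; lra.
have ya : y <= a * Q a by rewrite -{1}Pa Ppos// ltW.
(* To the left of x1 the values of Q are at least Q x1, so P drops by at least y over the length y /
   Q x1. *)
have [x' x'n Px'] : exists2 x, x \in `[x1 - y / Q x1, 0] & P Q x = - y.
  have yQ : 0 < y / Q x1 by rewrite divr_gt0.
  apply: IVT => //; first lra.
  have x2x1 : x1 - y / Q x1 < x1 by rewrite ltrBlDr ltrDl.
  have /(P_slope cQ x2x1)/andP[h _] : forall t, x1 - y / Q x1 <= t <= x1 -> Q x1 <= Q t <= Q (x1 - y / Q x1).
    move=> t /andP[t1 t2]; apply/andP; split; apply: (convex_ray_nondecreasing cvx Q00 Q0).
      by rewrite t2 (ltW x10) orbT.
    by rewrite t1 (le_trans t2 (ltW x10)) orbT.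
  have Px1 : P Q x1 <= 0 by have := P_mono cQ Q0 (ltW x10); rewrite P0.
  have e : Q x1 * (x1 - (x1 - y / Q x1)) = y by field; rewrite gt_eqF.
  rewrite P0 ge_min le_max; clear -h Px1 e y0; apply/andP; split; apply/orP; [left|right]; lra.
have y0' : - y != 0 by rewrite oppr_eq0 lt0r_neq0.
have Pa' := img _ _ Px' y0'.
set a' := Pinv Q q1 q2 (- y) in Pa' *.
have a'0 : a' < 0 by apply: a_lt0; rewrite Pa' oppr_lt0.
split => //; first by rewrite a0.
by split=> //; have := Pneg _ (ltW a'0); rewrite Pa' opprK.
Qed.

(** * Scaling by n *)

Lemma integral_scaled (R : realType) (n : nat)
    (mu : {measure set (measurableTypeR R) -> \bar R}) (p : probability (measurableTypeR R) R)
    (f : R -> \bar R) :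
  (forall A : set (measurableTypeR R), measurable A -> mu A = (n%:R%:E * p A)%E) ->
  measurable_fun [set: R] f -> (forall x, 0 <= f x)%E ->
  (\int[mu]_x f x = n%:R%:E * \int[p]_x f x)%E.
Proof.
move=> muE mf f0.
have n0 : 0 <= n%:R :> R by [].
have -> : (\int[mu]_x f x = \int[mscale (NngNum n0) p]_x f x)%E.
  by apply: eq_measure_integral => A mA _; rewrite muE.
by rewrite ge0_integral_mscale.
Qed.

Lemma IC_scaled (R : realType) (Q : R -> R) (n : nat) (b : R)
    (mu : {measure set (measurableTypeR R) -> \bar R}) (p : probability (measurableTypeR R) R) :
  measurable_fun [set: R] Q -> (forall x, 0 <= Q x) -> 0 < b ->
  (forall A : set (measurableTypeR R), measurable A -> mu A = (n%:R%:E * p A)%E) ->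
  IC Q (n%:R * b) mu = ((n%:R ^+ 2)%:E * energy Q b p)%E.
Proof.
move=> mQ Q0 b0 muE; rewrite /IC /energy.
have n0 : (0 <= n%:R%:E :> \bar R)%E by rewrite lee_fin.
have mQE : measurable_fun [set: R] (fun x : R => (Q x)%:E) by apply/measurable_EFinP.
have iQ0 : (0 <= \int[p]_x (Q x)%:E)%E by apply: integral_ge0 => x _; rewrite lee_fin.
have ipot0 : (0 <= \int[p]_x pot p x)%E by apply: integral_ge0 => x _; exact: pot_ge0.
have -> : (\int[mu]_x \int[mu]_y K (x - y) = (n%:R ^+ 2)%:E * \int[p]_x pot p x)%E.
  under eq_integral => x _.
    rewrite (integral_scaled muE (measurable_K_subr x)); last by move=> y; exact: K_ge0.
    over.
  rewrite (integral_scaled muE); last 2 first.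
  - by apply: emeasurable_funM => //; exact: measurable_pot.
  - by move=> x; rewrite mule_ge0// pot_ge0.
  rewrite ge0_integralZl//; last 2 first.
  - exact: measurable_pot.
  - by move=> x _; exact: pot_ge0.
  by rewrite muleA -EFinM expr2.
rewrite (integral_scaled muE mQE); last by move=> x; rewrite lee_fin.
have bQ0 : (0 <= (2 * b)%:E * \int[p]_x (Q x)%:E)%E.
  by apply: mule_ge0 => //; rewrite lee_fin mulr_ge0// ltW.
rewrite (@ge0_muleDr _ _ _ _ ipot0 bQ0).
congr (_ + _)%E; rewrite !muleA -!EFinM; congr (_%:E * _)%E; ring.
Qed.

Lemma energy_minimizer_of_IC (R : realType) (Q : R -> R) (n : nat) (b : R)
    (mu : {measure set (measurableTypeR R) -> \bar R}) (p : probability (measurableTypeR R) R) :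
  measurable_fun [set: R] Q -> (forall x, 0 <= Q x) -> 0 < b -> (0 < n)%N ->
  (forall A : set (measurableTypeR R), measurable A -> mu A = (n%:R%:E * p A)%E) ->
  IC_minimizer Q n (n%:R * b) mu -> energy_minimizer Q b p.
Proof.
move=> mQ Q0 b0 n0 muE [_ mumin] nu.
have n0' : 0 <= n%:R :> R by [].
have h := mumin (mscale (NngNum n0') nu) _.
have nuE (A : set (measurableTypeR R)) : measurable A ->
    mscale (NngNum n0') nu A = (n%:R%:E * nu A)%E by [].
move: h; rewrite (IC_scaled mQ Q0 b0 muE) (IC_scaled mQ Q0 b0 nuE) => h.
have : ((n%:R ^+ 2)%:E * energy Q b p <= (n%:R ^+ 2)%:E * energy Q b nu)%E.
  by apply: h; exists nu => A mA.
by rewrite lee_pmul2l// lte_fin exprn_gt0// ltr0n.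
Qed.

Lemma supp_scaled (R : realType) (n : nat)
    (mu : {measure set (measurableTypeR R) -> \bar R}) (p : probability (measurableTypeR R) R) :
  (0 < n)%N ->
  (forall A : set (measurableTypeR R), measurable A -> mu A = (n%:R%:E * p A)%E) ->
  supp mu = supp p.
Proof.
move=> n0 muE; apply/seteqP; split => x sx U oU Ux; have := sx U oU Ux;
  rewrite muE; try exact: open_measurable.
- by rewrite pmule_rgt0// lte_fin ltr0n.
- by move=> h; rewrite mule_gt0// lte_fin ltr0n.
Qed.

Lemma sqrt_ge (R : realType) (v w : R) : 0 <= v -> v ^+ 2 <= w -> v <= Num.sqrt w.
Proof. by move=> v0 vw; rewrite -[leLHS](ger0_norm v0) -sqrtr_sqr ler_wsqrtr. Qed.

Lemma P_gt0 (R : realType) (Q : R -> R) (x y : R) :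
  continuous Q -> (forall x, 0 <= Q x) -> Q 0 = 0 ->
  (forall t x y : R, 0 <= t <= 1 -> Q (t * x + (1 - t) * y) <= t * Q x + (1 - t) * Q y) ->
  0 < x < y -> 0 < Q x -> 0 < P Q y.
Proof.
move=> cQ Q0 Q00 cvx /andP[x0 xy] Qx.
have /(P_slope cQ xy)/andP[h _] : forall t, x <= t <= y -> Q x <= Q t <= Q y.
  move=> t /andP[xt ty]; apply/andP; split; apply: (convex_ray_nondecreasing cvx Q00 Q0).
    by rewrite (ltW x0) xt.
  by rewrite ty (le_trans (ltW x0)).
have := P_mono cQ Q0 (ltW x0); rewrite P0.
have : 0 < Q x * (y - x) by rewrite mulr_gt0// subr_gt0.
lra.
Qed.

Theorem theorem2p1 (R : realType) (Q : R -> R) (q1 q2 : R)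
  (Q_C4 : C4 Q)
  (Q_convex : convex_function [set: R^o] (Q : R^o -> R^o))
  (Q_liminf_pinfty :
    (ereal_inf [set (Q x)%:E | x in [set: R]] <
     limf_einf (fun x : R => (Q x)%:E) (pinfty_nbhs R))%E)
  (Q_liminf_ninfty :
    (ereal_inf [set (Q x)%:E | x in [set: R]] <
     limf_einf (fun x : R => (Q x)%:E) (ninfty_nbhs R))%E)
  (Q_min : Q 0 = 0 /\ forall x : R, 0 <= Q x)
  (q_def : `[q1, q2]%classic = [set x : R | Q x = 0])
  (Pinv_asym : forall y : R, 0 < y -> - Pinv Q q1 q2 (- y) <= Pinv Q q1 q2 y) :
  forall Gamma : R, 0 < Gamma ->
  exists C C' : R, 0 < C /\ 0 < C' /\
  forall (n : nat) (beta : R),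
    Num.max q2 1 < n%:R ->
    n%:R / P Q n%:R <= beta -> beta <= Gamma * n%:R ->
  forall (a : 'I_n -> R)
         (mu : {measure set (measurableTypeR R) -> \bar R}),
    ID_minimizer Q beta a -> IC_minimizer Q n beta mu ->
  let alpha := Pinv Q q1 q2 (n%:R / beta) in
  let B := Bbound Q C' n beta alpha mu in
  [/\ supp mu `<=` `[- (C * alpha), C * alpha],
      ((- Num.sqrt (n%:R ^+ 2 / alpha * B))%:E <= FD Q beta a - FC Q beta mu)%E,
      (FD Q beta a - FC Q beta mu <= 0)%E,
      ((- B)%:E <= ID Q beta a - IC Q beta mu)%E &
      (ID Q beta a - IC Q beta mu <= B%:E)%E].
Proof.
move=> Gamma Gamma0.
have [Q00 Q0] := Q_min.
have cvx := convex_functionE Q_convex.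
have [_ _ cQ _] := C4_derive Q_C4.
have mQ : measurable_fun [set: R] Q by exact: continuous_measurable_fun.
have Qmid x y : Q ((x + y) / 2) <= (Q x + Q y) / 2.
  have h : 0 <= (1 / 2 : R) <= 1 by apply/andP; split; lra.
  have := cvx _ x y h.
  have -> : 1 / 2 * x + (1 - 1 / 2) * y = (x + y) / 2 by field.
  by have -> : 1 / 2 * Q x + (1 - 1 / 2) * Q y = (Q x + Q y) / 2 by field.
have Qneg : exists2 x, x < 0 & 0 < Q x.
  have N0 : ninfty_nbhs R [set x | x < 0] by exists 0; split.
  apply: (@limf_einf_gt0 R Q (ninfty_nbhs R) [set x | x < 0] _ N0).
  apply: le_lt_trans Q_liminf_ninfty.
  by apply: le_ereal_inf_tmp => _ [x _ <-]; rewrite lee_fin.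
(* A lower bound for alpha: beta <= Gamma n gives 1 / Gamma <= n / beta <= alpha Q alpha, whereas
   alpha < al0 <= 1 would make alpha Q alpha at most 1 / (2 Gamma). *)
pose al0 : R := Num.min 1 (1 / (2 * Gamma * (1 + Q 1))).
have Q1 : 0 < 1 + Q 1 by rewrite ltr_pwDl.
have al00 : 0 < al0 by rewrite lt_min ltr01 divr_gt0// !mulr_gt0.
have al01 : al0 <= 1 by rewrite ge_min lexx.
have al0G : al0 * (1 + Q 1) <= 1 / (2 * Gamma).
  rewrite -ler_pdivlMr//; have -> : 1 / (2 * Gamma) / (1 + Q 1) = 1 / (2 * Gamma * (1 + Q 1)).
    by field; rewrite !gt_eqF.
  by rewrite ge_min lexx orbT.
have [C C0 HC] := normalized_estimates al00.
have CC0 : 0 < C + C ^+ 2 by rewrite addr_gt0// exprn_gt0.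
(* The summand C serves the bound on I. The square C^2 serves the bound on F, where the constant
   appears under the root. *)
exists 14, (C + C ^+ 2); do 2 split => //.
move=> n beta; rewrite gt_max => /andP[q2n n1] nb bG a mu amin mumin alpha B.
have n0 : 0 < n%:R :> R by lra.
have q20 : q1 <= 0 <= q2.
  have : [set x | Q x = 0] 0 by [].
  by rewrite -q_def /= in_itv.
have Pn : 0 < P Q n%:R.
  apply: (@P_gt0 R Q ((q2 + n%:R) / 2)) => //; first by case/andP: q20 => _ q20; lra.
  rewrite lt0r Q0 andbT; apply/eqP => h.
  have : [set x | Q x = 0] ((q2 + n%:R) / 2) by [].
  rewrite -q_def /= in_itv/= => /andP[_]; lra.
have beta0 : 0 < beta by apply: lt_le_trans nb; rewrite divr_gt0.
pose b := beta / n%:R.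
have b0 : 0 < b by rewrite divr_gt0.
have betaE : beta = n%:R * b by rewrite /b mulrC divfK// gt_eqF.
pose y := n%:R / beta.
have yb : y = b^-1 by rewrite /y /b invf_div.
have y0 : 0 < y <= P Q n%:R.
  rewrite divr_gt0//= ler_pdivrMr// mulrC.
  by rewrite ler_pdivrMr// in nb.
have [/andP[a0 an] Pa ya [a'0 ya']] := Pinv_facts cQ Q0 Q00 cvx q_def Qneg q2n n0 y0.
have asym := Pinv_asym y (proj1 (andP y0)).
rewrite -/y in a0 an Pa ya ya' asym; rewrite -/alpha in a0 an Pa ya asym.
set a' := Pinv Q q1 q2 (- y) in a'0 ya' asym.
have al_ge : al0 <= alpha.
  rewrite leNgt; apply/negP => h.
  have yG : 1 / Gamma <= y.
    by rewrite /y ler_pdivrMr// mulrAC ler_pdivlMr// mul1r mulrC.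
  have Qa : Q alpha <= Q 1.
    apply: (convex_ray_nondecreasing cvx Q00 Q0).
    by rewrite (ltW a0) (le_trans (ltW h)).
  have h1 : alpha * Q alpha <= al0 * (1 + Q 1).
    by apply: ler_pM => //; [exact: ltW|exact: ltW|rewrite ler_wpDl].
  have h2 : 1 / (2 * Gamma) = 1 / Gamma / 2 by field; rewrite gt_eqF.
  have h3 : 0 < 1 / Gamma by rewrite divr_gt0.
  clear -al0G yG ya h1 h2 h3; lra.
(* On the right the slope of Q is fixed at alpha, on the left at [a']; the asymmetry assumption |a'|
   <= alpha lets both sides use the scale alpha. *)
have HM x : b * Q x <= 14 / alpha -> - (14 * alpha) <= x <= 14 * alpha.
  have k1 : 1 <= 14 :> R by rewrite ler1n.
  move=> bx; apply/andP; split.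
    have h : b^-1 <= `|a'| * Q a' by rewrite -yb ltr0_norm.
    have a'al : `|a'| <= alpha by rewrite ltr0_norm.
    have := sublevel_ray cvx Q00 b0 k1 (ltr0_neq0 a'0) a'al h bx.
    by rewrite ler_ndivrMr//; clear -asym; lra.
  have h : b^-1 <= `|alpha| * Q alpha by rewrite -yb gtr0_norm.
  have aal : `|alpha| <= alpha by rewrite gtr0_norm.
  have := sublevel_ray cvx Q00 b0 k1 (lt0r_neq0 a0) aal h bx.
  by rewrite ler_pdivrMr.
have [p muE] := mumin.1.
have nn : (0 < n)%N by rewrite -(ltr0n R).
rewrite betaE in mumin.
have pmin := energy_minimizer_of_IC mQ Q0 b0 nn muE mumin.
have pE : (energy Q b p <= (14 / alpha)%:E)%E.
  apply: le_trans (pmin (uniform_prob a0)) _.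
  apply: energy_uniform_le => //.
  have -> : (\int[lebesgue_measure]_(t in `[0%R, alpha]) (Q t)%:E =
      (\int[lebesgue_measure]_(t in `[0%R, alpha]) Q t)%:E)%E.
    rewrite /Rintegral fineK// ; apply: integrable_fin_num => //.
    exact: integrable_continuous_itv.
  by rewrite -yb -Pa /P (ltW a0).
have [m nE] : exists m, n = m.+2.
  have : (1 < n)%N by rewrite -(ltr1n R).
  by case: (n) => [|[|m]] // _; exists m.
subst n; rewrite betaE in amin.
have [W [q [T [pW pq aT suppM]]]] :=
  HC Q b p alpha m a Q_C4 Q0 Q00 Qmid b0 pmin pE al_ge an HM amin.
rewrite /B /Bbound (supp_scaled nn muE).
have -> : beta * alpha ^+ 3 / m.+2%:R = b * alpha ^+ 3 by rewrite /b mulrAC.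
set N : R := m.+2%:R in n0 n1 betaE b0 *.
set E1 := T / _; set E2 := b * (N^-1 * _); set M := Num.min _ _; move=> [M0 h1 h2 h3 h4].
have N1 : 0 < N - 1 by rewrite subr_gt0.
have NN : 0 < N ^+ 2 by rewrite exprn_gt0.
have IDv : ID Q beta a = (N ^+ 2 * (E1 + 2 * E2))%:E.
  rewrite IDE aT -EFinM -EFinD; congr EFin.
  by rewrite /E1 /E2 -/N betaE; field; rewrite !gt_eqF.
have FDv : FD Q beta a = (N ^+ 2 * (E1 + E2))%:E.
  rewrite /FD IDv -EFinB; congr EFin.
  by rewrite /E1 /E2 -/N betaE; field; rewrite !gt_eqF.
have ICv : IC Q beta mu = (N ^+ 2 * (W + 2 * (b * q)))%:E.
  rewrite betaE (IC_scaled mQ Q0 b0 muE) /energy pW pq -!(EFinM, EFinD); congr EFin.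
  by rewrite -/N; ring.
have FCv : FC Q beta mu = (N ^+ 2 * (W + b * q))%:E.
  rewrite /FC ICv (integral_scaled muE); last 2 first.
  - exact/measurable_EFinP.
  - by move=> x; rewrite lee_fin.
  by rewrite pq -!EFinM -EFinB; congr EFin; rewrite betaE -/N; ring.
have CM : C * (M / alpha) <= (C + C ^+ 2) * (M / alpha).
  by rewrite ler_wpM2r ?lerDl ?exprn_ge0 ?divr_ge0// ltW.
have Bv : (C + C ^+ 2) * (N ^+ 2 / alpha) * M = N ^+ 2 * ((C + C ^+ 2) * (M / alpha)) by ring.
rewrite IDv FDv ICv FCv -!EFinB !lee_fin -!mulrBr Bv; split.
- by move=> x /suppM sx; rewrite /= in_itv.
- apply: (@le_trans _ _ (- (N ^+ 2 * (C * (Num.sqrt M / alpha))))).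
    rewrite lerN2; apply: sqrt_ge.
      by rewrite !mulr_ge0 ?invr_ge0 ?sqrtr_ge0// ltW.
    have -> : (N ^+ 2 * (C * (Num.sqrt M / alpha))) ^+ 2 = N ^+ 4 / alpha ^+ 2 * M * C ^+ 2.
      by rewrite -{2}(sqr_sqrtr M0); field; rewrite gt_eqF.
    have -> : N ^+ 2 / alpha * (N ^+ 2 * ((C + C ^+ 2) * (M / alpha))) =
        N ^+ 4 / alpha ^+ 2 * M * (C + C ^+ 2) by field; rewrite gt_eqF.
    rewrite ler_wpM2l ?lerDr ?(ltW C0)//.
    by rewrite mulr_ge0// divr_ge0 ?exprn_ge0// ltW.
  by rewrite -mulrN ler_pM2l//; clear -h4; lra.
- by rewrite pmulr_rle0// subr_le0.
- by rewrite -mulrN ler_pM2l//; clear -h2 CM; lra.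
- by rewrite ler_pM2l//; apply: (@le_trans _ _ 0); [by rewrite subr_le0|apply: mulr_ge0; [exact: ltW|rewrite divr_ge0// ltW]].
Qed.
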